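(* Let $K$ be a Dynkin diagram of $\mathrm{Ext}$ type. Then: (1) $\mathfrak m(K,X)$ is finite for all simply-laced Dynkin diagrams $X$. (2) $\mathfrak m(K,X)=2\,\mathfrak m(K^\circ,X^\circ)$ for all $X\in\mathrm{Hyp}\cap\mathrm{Ext}$, where $K^\circ$, $X^\circ$ denote the finite parts.
   Context: A generalized Cartan matrix (GCM) is an integer square matrix $A=(a_{ij})$ with $a_{ii}=2$, $a_{ij}\le 0$ for $i\ne j$, and $a_{ij}=0$ whenever $a_{ji}=0$. $\mathfrak{g}(A)$ is the associated Kac-Moody algebra over $\mathbb C$. For a symmetrizable GCM $A$ the Dynkin diagram $X=S(A)$ is identified with $A$; we write $\mathfrak g(X)$, $W(X)$ (Weyl group), $\alpha_p$ ($p$ a vertex; simple roots), etc. $X$ is called simply-laced if $A$ is symmetric (entries less than $-1$ are allowed off the diagonal); then we use the bilinear form on the root lattice given by $(\alpha_i\mid\alpha_j)=a_{ij}$. A $\pi$-system in $X$ is a finite set of distinct real roots $\{\beta_1,\dots,\beta_m\}$ of $\mathfrak{g}(X)$ such that $\beta_i-\beta_j$ is not a root for all $i\neq j$. Its type is the GCM $(\langle\beta_i^\vee,\beta_j\rangle)_{i,j}$ ($\beta^\vee$ the coroot of $\beta$), or the corresponding diagram, taken up to simultaneous permutation of rows and columns. $\mathfrak m(B,X)$ denotes the number of $W(X)$-orbits of $\pi$-systems of type $B$ in $X$. A simply-laced Dynkin diagram $Z$ is of $\mathrm{Ext}$ type (an overextension; $\mathrm{Ext}$ is the set of these) if there is a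 vertex $p$ of $Z$ such that $Y=Z\setminus\{p\}$ is of affine type and $(\delta_Y\mid\alpha_p)=-1$, where $\delta_Y$ is the null root of $Y$ (the positive imaginary root of $Y$ of minimal height). Such $p$ is unique, and there is a unique vertex $q$ of $Y$ with $(\alpha_q\mid\alpha_p)\ne0$. The finite part of $Z$ is the finite type diagram $Z^\circ=Y\setminus\{q\}$. An indecomposable symmetrizable GCM is of hyperbolic type if it is not of finite or affine type and every proper principal submatrix is a direct sum of GCMs of finite or affine type. $\mathrm{Hyp}$ is the set of all symmetrizable GCMs (diagrams) of hyperbolic type of rank $\ge3$. *)

(* Defs.v *)
From HB Require Import structures.
From mathcomp Require Import all_boot all_order all_algebra finmap.
From mathcomp Require Import all_classical all_reals.
From mathcomp Require Import complex.

Set Implicit Arguments.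
Unset Strict Implicit.
Unset Printing Implicit Defensive.

Import Order.TTheory GRing.Theory Num.Theory.
Local Open Scope ring_scope.
Local Open Scope classical_set_scope.

(** Conventions follow V. Kac, "Infinite dimensional Lie algebras".  A diagram
    with n vertices is its generalized Cartan matrix in 'M[int]_n; elements of
    the root lattice Q (resp. coroot lattice) are row vectors of coordinates
    in the basis of simple roots (resp. simple coroots). *)

Definition gcm n (A : 'M[int]_n) : Prop :=
  [/\ forall i, A i i = 2,
      forall i j, i != j -> A i j <= 0
    & forall i j, A j i = 0 -> A i j = 0].

Definition simply_laced n (A : 'M[int]_n) : Prop := gcm A /\ A^T = A.

Definition symmetrizable n (A : 'M[int]_n) : Prop :=
  exists (d : 'rV[rat]_n) (B : 'M[rat]_n),
    [/\ forall i, d 0 i != 0, B^T = B & map_mx intr A = diag_mx d *m B].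

Definition indecomposable n (A : 'M[int]_n) : Prop :=
  (0 < n)%N /\
  ~ exists J : {set 'I_n},
      [/\ J != finset.set0, J != [set: 'I_n]%SET
        & forall i j, i \in J -> j \notin J -> A i j = 0 /\ A j i = 0].

(** Realization (h, Pi, Pi^v) of a matrix of rank l: h is F^(2n-l), its dual is
    identified with row vectors through a(x) = x *m a^T, and the rows of
    [simple_roots] and [simple_coroots] are the alpha_i and alpha_i^v. *)
Record realization (F : fieldType) n (A : 'M[F]_n) := Realization {
  simple_coroots : 'M[F]_(n, n + (n - \rank A));
  simple_roots : 'M[F]_(n, n + (n - \rank A));
  simple_coroots_free : row_free simple_coroots;
  simple_roots_free : row_free simple_roots;
  realizationE : simple_coroots *m simple_roots^T = A
}.

(** Every matrix has a realization, unique up to isomorphism; this one is read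
    off the normal form A = L *m pid_mx l *m U, with L and U invertible. *)
Section StandardRealization.
Variables (F : fieldType) (n : nat) (A : 'M[F]_n).
Let l := \rank A.

Definition std_coroots : 'M[F]_(n, n + (n - l)) :=
  col_ebase A *m row_mx 1%:M 0.

Definition std_roots : 'M[F]_(n, n + (n - l)) :=
  (row_ebase A)^T *m
  row_mx (pid_mx l) (\matrix_(i, j) (i == l + j :> nat)%N%:R).

Lemma std_coroots_free : row_free std_coroots.
Proof.
apply/row_freeP; exists (col_mx (invmx (col_ebase A)) 0).
by rewrite -mulmxA mul_row_col mul1mx mul0mx addr0 mulmxV // col_ebase_unit.
Qed.

Lemma std_roots_free : row_free std_roots.
Proof.
set C : 'M[F]_(n, n - l) := \matrix_(i, j) (i == l + j :> nat)%N%:R.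
have CCt : pid_mx l *m (pid_mx l : 'M[F]_n)^T + C *m C^T = 1%:M.
  rewrite tr_pid_mx mul_pid_mx !minnn (minn_idPr (rank_leq_row A)).
  apply/matrixP=> i j; rewrite !mxE.
  have [il|li] := ltnP i l.
    rewrite big1 ?addr0 ?andbT // => k _; rewrite !mxE.
    by case: eqP => [e|_]; rewrite ?mul0r //; move: il; rewrite e ltnNge leq_addr.
  have ik : (i - l < n - l)%N by apply: ltn_sub2r => //; apply: leq_ltn_trans (ltn_ord i).
  rewrite andbF add0r (bigD1 (Ordinal ik)) //= !mxE /= subnKC // eqxx mul1r.
  rewrite big1 ?addr0 => [|k nk]; first by rewrite eq_sym.
  rewrite !mxE; case: eqP => [e|_]; rewrite ?mul0r //.
  by case/eqP: nk; apply: val_inj; rewrite /= e addKn.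
apply/row_freeP; exists ((row_mx (pid_mx l) C)^T *m invmx ((row_ebase A)^T)).
rewrite mulmxA -[_ *m _ *m _^T]mulmxA tr_row_mx mul_row_col CCt mulmx1.
by rewrite mulmxV // unitmx_tr row_ebase_unit.
Qed.

Lemma std_realizationE : std_coroots *m std_roots^T = A.
Proof.
rewrite trmx_mul trmxK tr_row_mx tr_pid_mx mulmxA -[_ *m _ *m col_mx _ _]mulmxA.
by rewrite mul_row_col mul1mx mul0mx addr0 mulmx_ebase.
Qed.

Definition std_realization : realization A :=
  Realization std_coroots_free std_roots_free std_realizationE.

End StandardRealization.

Inductive lie_term (F : Type) (n d : nat) : Type :=
| LZero
| LE of 'I_n
| LF of 'I_n
| LH of 'rV[F]_d
| LAdd of lie_term F n d & lie_term F n d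
| LScale of F & lie_term F n d
| LBr of lie_term F n d & lie_term F n d.
Arguments LZero {F n d}.
Arguments LE {F n d} i.
Arguments LF {F n d} i.
Arguments LH {F n d} h.

Section KacMoody.
Variables (F : fieldType) (n : nat) (A : 'M[F]_n) (D : realization A).
Local Notation term := (lie_term F n (n + (n - \rank A))).
Implicit Types (x y z : term) (h : 'rV[F]_(n + (n - \rank A))).

(** The auxiliary Lie algebra g~(A), generated by the e_i, the f_i and the
    space h, is the set of terms modulo [aux_eq]. *)
Inductive aux_eq : term -> term -> Prop :=
| aux_refl x : aux_eq x x
| aux_sym x y : aux_eq x y -> aux_eq y x
| aux_trans x y z : aux_eq x y -> aux_eq y z -> aux_eq x z
| aux_add x x' y y' :
    aux_eq x x' -> aux_eq y y' -> aux_eq (LAdd x y) (LAdd x' y')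
| aux_scale a x x' : aux_eq x x' -> aux_eq (LScale a x) (LScale a x')
| aux_br x x' y y' :
    aux_eq x x' -> aux_eq y y' -> aux_eq (LBr x y) (LBr x' y')
| aux_addA x y z : aux_eq (LAdd x (LAdd y z)) (LAdd (LAdd x y) z)
| aux_addC x y : aux_eq (LAdd x y) (LAdd y x)
| aux_add0 x : aux_eq (LAdd LZero x) x
| aux_scale0 x : aux_eq (LScale 0 x) LZero
| aux_scale1 x : aux_eq (LScale 1 x) x
| aux_scaleA a b x : aux_eq (LScale a (LScale b x)) (LScale (a * b) x)
| aux_scaleDr a x y :
    aux_eq (LScale a (LAdd x y)) (LAdd (LScale a x) (LScale a y))
| aux_scaleDl a b x :
    aux_eq (LScale (a + b) x) (LAdd (LScale a x) (LScale b x))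
| aux_brDl x y z : aux_eq (LBr (LAdd x y) z) (LAdd (LBr x z) (LBr y z))
| aux_brDr x y z : aux_eq (LBr x (LAdd y z)) (LAdd (LBr x y) (LBr x z))
| aux_brZl a x y : aux_eq (LBr (LScale a x) y) (LScale a (LBr x y))
| aux_brZr a x y : aux_eq (LBr x (LScale a y)) (LScale a (LBr x y))
| aux_brxx x : aux_eq (LBr x x) LZero
| aux_jacobi x y z :
    aux_eq (LAdd (LBr x (LBr y z)) (LAdd (LBr y (LBr z x)) (LBr z (LBr x y))))
           LZero
| aux_HD h h' : aux_eq (LH (h + h')) (LAdd (LH h) (LH h'))
| aux_HZ a h : aux_eq (LH (a *: h)) (LScale a (LH h))
| aux_EF i j :
    aux_eq (LBr (LE i) (LF j))
           (if i == j then LH (row i (simple_coroots D)) else LZero)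
| aux_HH h h' : aux_eq (LBr (LH h) (LH h')) LZero
| aux_HE h i :
    aux_eq (LBr (LH h) (LE i))
           (LScale ((h *m (row i (simple_roots D))^T) 0 0) (LE i))
| aux_HF h i :
    aux_eq (LBr (LH h) (LF i))
           (LScale (- ((h *m (row i (simple_roots D))^T) 0 0)) (LF i)).

Definition aux_ideal (I : term -> Prop) : Prop :=
  [/\ forall x y, aux_eq x y -> I x -> I y,
      I LZero,
      forall x y, I x -> I y -> I (LAdd x y),
      forall a x, I x -> I (LScale a x)
    & forall x y, I y -> I (LBr x y)].

(** The largest ideal of g~(A) meeting h trivially: a sum of ideals meeting h
    trivially meets h trivially, so the union below is that largest ideal.  The
    Kac-Moody algebra is g(A) = g~(A) / [max_ideal]. *)
Definition max_ideal x : Prop :=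
  exists I, [/\ aux_ideal I,
                forall h, I (LH h) -> aux_eq (LH h) LZero & I x].

Definition km_eq x y : Prop := max_ideal (LAdd x (LScale (-1) y)).

(** [root_space a x]: the class of x in g(A) lies in g(A)_a. *)
Definition root_space (a : 'rV[F]_(n + (n - \rank A))) x : Prop :=
  forall h, km_eq (LBr (LH h) x) (LScale ((h *m a^T) 0 0) x).

Definition km_root (a : 'rV[F]_(n + (n - \rank A))) : Prop :=
  a != 0 /\ exists x, root_space a x /\ ~ km_eq x LZero.

End KacMoody.

(** Roots of g(A), as elements of Q = 'rV[int]_n. *)
Definition is_root (F : fieldType) n (A : 'M[int]_n) (b : 'rV[int]_n) : Prop :=
  let D := std_realization (map_mx intr A : 'M[F]_n) in
  km_root D (map_mx intr b *m simple_roots D).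

Definition simple_root n (i : 'I_n) : 'rV[int]_n := delta_mx 0 i.

(** The pairing <c, b> of the coroot lattice with Q, where
    <alpha_i^v, alpha_j> = a_ij; for symmetric A it is also the bilinear form
    (c | b) on Q. *)
Definition pairing n (A : 'M[int]_n) (c b : 'rV[int]_n) : int :=
  (c *m A *m b^T) 0 0.

Definition simple_refl n (A : 'M[int]_n) (i : 'I_n) (b : 'rV[int]_n) :=
  b - pairing A (simple_root i) b *: simple_root i.

(** An element of W(A) is represented by a word in the (involutive) simple
    reflections.  The same word acts on Q by [weyl_act A] and on the coroot
    lattice by [weyl_act A^T]. *)
Definition weyl_act n (A : 'M[int]_n) (w : seq 'I_n) (b : 'rV[int]_n) :=
  foldr (simple_refl A) b w.

Definition real_root (F : fieldType) n (A : 'M[int]_n) (b : 'rV[int]_n) :=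
  is_root F A b /\ exists w i, b = weyl_act A w (simple_root i).

Definition imaginary_root (F : fieldType) n (A : 'M[int]_n) (b : 'rV[int]_n) :=
  is_root F A b /\ ~ real_root F A b.

(** (w alpha_i)^v = w (alpha_i^v). *)
Definition is_coroot n (A : 'M[int]_n) (b c : 'rV[int]_n) : Prop :=
  exists w i, b = weyl_act A w (simple_root i) /\
              c = weyl_act A^T w (simple_root i).

Definition height n (b : 'rV[int]_n) : int := \sum_i b 0 i.

Definition positive n (b : 'rV[int]_n) : Prop :=
  b != 0 /\ forall i, 0 <= b 0 i.

Definition null_root (F : fieldType) n (Y : 'M[int]_n) (b : 'rV[int]_n) :=
  [/\ imaginary_root F Y b, positive b
    & forall c, imaginary_root F Y c -> positive c -> height b <= height c].

Definition pi_system (F : fieldType) n (X : 'M[int]_n)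
    (S : {fset 'rV[int]_n}) : Prop :=
  (forall b, b \in S -> real_root F X b) /\
  (forall b c, b \in S -> c \in S -> b != c -> ~ is_root F X (b - c)).

(** Invariance under simultaneous permutations of rows and columns of B comes
    from the free choice of the enumeration b of S. *)
Definition of_type m (B : 'M[int]_m) n (X : 'M[int]_n)
    (S : {fset 'rV[int]_n}) : Prop :=
  exists b c : 'I_m -> 'rV[int]_n,
    [/\ injective b, S = [fset b i | i in 'I_m]%fset,
        forall i, is_coroot X (b i) (c i)
      & forall i j, pairing X (c i) (b j) = B i j].

Definition weyl_orbit n (X : 'M[int]_n) (S : {fset 'rV[int]_n}) :
    set {fset 'rV[int]_n} :=
  [set T | exists w, T = [fset weyl_act X w b | b in S]%fset].

Definition pi_system_orbits (F : fieldType) m (B : 'M[int]_m) n (X : 'M[int]_n) :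
    set (set {fset 'rV[int]_n}) :=
  [set weyl_orbit X S | S in [set S | pi_system F X S /\ of_type B X S]].

(** m(B, X) = k; that m(B, X) is finite reads [exists k, mult_eq F B X k]. *)
Definition mult_eq (F : fieldType) m (B : 'M[int]_m) n (X : 'M[int]_n) (k : nat) :
    Prop :=
  (pi_system_orbits F B X #= `I_k)%card.

Section Types.
Variable R : realType.

Definition vpos n (v : 'cV[R]_n) : Prop := forall i, 0 < v i 0.
Definition vnneg n (v : 'cV[R]_n) : Prop := forall i, 0 <= v i 0.

(** Conditions (Fin) and (Aff) of Kac, Theorem 4.3. *)
Definition finite_type n (A : 'M[int]_n) : Prop :=
  let AR : 'M[R]_n := map_mx intr A in
  [/\ gcm A, indecomposable A, \det AR != 0,
      exists u, vpos u /\ vpos (AR *m u)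
    & forall v, vnneg (AR *m v) -> vpos v \/ v = 0].

Definition affine_type n (A : 'M[int]_n) : Prop :=
  let AR : 'M[R]_n := map_mx intr A in
  [/\ gcm A, indecomposable A, (\rank AR).+1 = n,
      exists u, vpos u /\ AR *m u = 0
    & forall v, vnneg (AR *m v) -> AR *m v = 0].

Definition principal n (A : 'M[int]_n) (J : {set 'I_n}) : 'M[int]_#|J| :=
  mxsub (@enum_val _ (mem J)) (@enum_val _ (mem J)) A.

(** The principal submatrix indexed by J is a direct sum of GCMs of finite or
    affine type; P is the set of blocks. *)
Definition sum_of_finite_affine n (A : 'M[int]_n) (J : {set 'I_n}) : Prop :=
  exists P : {set {set 'I_n}},
    [/\ finset.partition P J,
        forall B C, B \in P -> C \in P -> B != C ->
          forall i j, i \in B -> j \in C -> A i j = 0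
      & forall B, B \in P ->
          finite_type (principal A B) \/ affine_type (principal A B)].

Definition hyperbolic_type n (A : 'M[int]_n) : Prop :=
  [/\ gcm A, symmetrizable A, indecomposable A,
      ~ finite_type A /\ ~ affine_type A
    & forall J : {set 'I_n}, J != [set: 'I_n]%SET -> sum_of_finite_affine A J].

Definition Hyp n (A : 'M[int]_n) : Prop := hyperbolic_type A /\ (3 <= n)%N.

Definition del_vertex n (Z : 'M[int]_n) (p : 'I_n) : 'M[int]_n.-1 :=
  row' p (col' p Z).

(** Inclusion of the root lattice of Z \ {p} into that of Z. *)
Definition extend_root n (p : 'I_n) (b : 'rV[int]_n.-1) : 'rV[int]_n :=
  \sum_j b 0 j *: simple_root (lift p j).

Definition ext_vertex n (Z : 'M[int]_n) (p : 'I_n) : Prop :=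
  affine_type (del_vertex Z p) /\
  exists d, null_root R[i] (del_vertex Z p) d /\
            pairing Z (extend_root p d) (simple_root p) = -1.

Definition Ext n (Z : 'M[int]_n) : Prop :=
  simply_laced Z /\ exists p, ext_vertex Z p.

(** [finite_part Z Z0]: Z0 is the diagram obtained from the overextension Z by
    deleting p and then q.  The vertices p and q are determined by Z. *)
Definition finite_part n (Z : 'M[int]_n) (Z0 : 'M[int]_n.-1.-1) : Prop :=
  exists (p : 'I_n) (q : 'I_n.-1),
    [/\ ext_vertex Z p,
        pairing Z (simple_root (lift p q)) (simple_root p) != 0
      & Z0 = del_vertex (del_vertex Z p) q].

End Types.

(* Main.v *)
Require Import Defs.
From HB Require Import structures.
From mathcomp Require Import all_boot all_order all_algebra finmap.
From mathcomp Require Import all_classical all_reals.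
From mathcomp Require Import complex ring lra zify.

Import Order.TTheory GRing.Theory Num.Theory.

(** In a simply-laced diagram every root has norm at most 2 and every root of
    positive norm is real, so a pi-system of simply-laced type K is the same as a
    family b of real roots with Gram matrix K.  Let K be an overextension, with
    vertices p and q and null root d.  The product of the reflections in alpha_q
    and d - alpha_q maps alpha_q + m d to alpha_q + (m + 2) d, so all b_q + 2m D
    are real roots, where D = sum_i d_i b_i; hence D is positive or negative.
    Up to sign and the Weyl group, D is positive and antidominant.  Minimising the
    height of b_p under the stabiliser of D makes b_p a simple root alpha_j with
    (D | alpha_j) = -1.  Then Y = supp D is affine, Y + j is an overextension, the
    other b_i lie in Y, those with i <> q even in the finite part of Y + j, and
    b_q is determined by D.  There are finitely many such normal forms, as a
    positive definite lattice has finitely many vectors of norm 2.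

    If X is hyperbolic and an overextension, then Y + j = X because 2 D + alpha_j
    has negative norm, and j is the overextending vertex of X because that vertex
    is unique.  Normal forms are thus pi-systems in the finite part X0 of X, of the
    type of the finite part of K.  The sign is an invariant of the orbit since the
    Weyl group preserves the positivity of D, and two normal forms are conjugate
    under W(X) iff they are conjugate under W(X0), the stabiliser of the
    antidominant vector 3 D + alpha_j. *)

Set Implicit Arguments.
Unset Strict Implicit.
Unset Printing Implicit Defensive.

Local Open Scope ring_scope.

#[local] Arguments weyl_act : simpl never.

(** * The pairing *)

(** Roots are defined through the Lie algebra. Four facts about them are extracted from a triangular
    decomposition of g~(A) and from sl2 theory modulo its maximal ideal: simple roots are roots,
    simple reflections preserve roots, roots have coherent signs, and the only multiples of alpha_i
    among them are alpha_i and -alpha_i. Everything else is lattice theory. It avoids the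
    classification of finite and affine diagrams: positivity of the form comes from vectors u >= 0
    with X u >= 0 on their support, and a null root enters through its coefficients and pairings.

    A pi-system is a set, and two enumerations of it with the same Gram matrix differ by a diagram
    automorphism. Passing from X0 to X therefore requires that automorphisms of K0 preserve the
    coefficients of d, and passing back requires that automorphisms of K fix p and q. The former
    holds because these coefficients are those of the highest root of K0, the latter because the
    overextending vertex is unique. *)

Section Pairing.
Variables (n : nat) (A : 'M[int]_n).
Implicit Types (x y z : 'rV[int]_n) (k : int).

Lemma pairingDl x y z : pairing A (x + y) z = pairing A x z + pairing A y z.
Proof. by rewrite /pairing !mulmxDl mxE. Qed.
Lemma pairingDr x y z : pairing A x (y + z) = pairing A x y + pairing A x z.
Proof. by rewrite /pairing linearD mulmxDr mxE. Qed.
Lemma pairingZl k x y : pairing A (k *: x) y = k * pairing A x y.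
Proof. by rewrite /pairing -!scalemxAl mxE. Qed.
Lemma pairingZr k x y : pairing A x (k *: y) = k * pairing A x y.
Proof. by rewrite /pairing linearZ -scalemxAr mxE. Qed.
Lemma pairingNl x y : pairing A (- x) y = - pairing A x y.
Proof. by rewrite -scaleN1r pairingZl mulN1r. Qed.
Lemma pairingNr x y : pairing A x (- y) = - pairing A x y.
Proof. by rewrite -scaleN1r pairingZr mulN1r. Qed.
Lemma pairingBl x y z : pairing A (x - y) z = pairing A x z - pairing A y z.
Proof. by rewrite pairingDl pairingNl. Qed.
Lemma pairingBr x y z : pairing A x (y - z) = pairing A x y - pairing A x z.
Proof. by rewrite pairingDr pairingNr. Qed.
Lemma pairing0l x : pairing A 0 x = 0.
Proof. by rewrite /pairing !mul0mx mxE. Qed.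
Lemma pairing0r x : pairing A x 0 = 0.
Proof. by rewrite /pairing trmx0 mulmx0 mxE. Qed.
Lemma pairing_suml (I : Type) (s : seq I) (P : pred I) (c : I -> 'rV[int]_n) y :
  pairing A (\sum_(i <- s | P i) c i) y = \sum_(i <- s | P i) pairing A (c i) y.
Proof. by apply: (big_morph (fun x => pairing A x y)) => [a b|]; rewrite ?pairingDl ?pairing0l. Qed.
Lemma pairing_sumr (I : Type) (s : seq I) (P : pred I) (c : I -> 'rV[int]_n) y :
  pairing A y (\sum_(i <- s | P i) c i) = \sum_(i <- s | P i) pairing A y (c i).
Proof. by apply: (big_morph (pairing A y)) => [a b|]; rewrite ?pairingDr ?pairing0r. Qed.

Lemma pairing_simple i j : pairing A (simple_root i) (simple_root j) = A i j.
Proof. by rewrite /pairing /simple_root -rowE trmx_delta -colE !mxE. Qed.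

Lemma simple_rootE (i j : 'I_n) : simple_root i 0 j = (j == i)%:R.
Proof. by rewrite mxE eqxx. Qed.

(* Restatements of mxE whose integer operations are recognised by lia. *)
Lemma coordN x i : (- x) 0 i = - x 0 i. Proof. by rewrite mxE. Qed.
Lemma coordD x y i : (x + y) 0 i = x 0 i + y 0 i. Proof. by rewrite mxE. Qed.
Lemma coordB x y i : (x - y) 0 i = x 0 i - y 0 i. Proof. by rewrite coordD coordN. Qed.
Lemma coordZ k x i : (k *: x) 0 i = k * x 0 i. Proof. by rewrite mxE. Qed.
Lemma coord0 i : (0 : 'rV[int]_n) 0 i = 0. Proof. by rewrite mxE. Qed.

Lemma row_simple x : x = \sum_i x 0 i *: simple_root i.
Proof. exact: row_sum_delta. Qed.

Lemma pairing_coord x y : pairing A x y = \sum_i x 0 i * pairing A (simple_root i) y.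
Proof. by rewrite {1}(row_simple x) pairing_suml; apply: eq_bigr => i _; rewrite pairingZl. Qed.

Lemma pairing_simple_coord i y : pairing A (simple_root i) y = \sum_j A i j * y 0 j.
Proof.
rewrite {1}(row_simple y) pairing_sumr; apply: eq_bigr => j _.
by rewrite pairingZr pairing_simple mulrC.
Qed.

End Pairing.

(** * Lie algebras with Chevalley generators *)

Section Weights.
Variables (F : numFieldType) (n d : nat) (A : 'M[int]_n) (rt crt : 'M[F]_(n, d)).

Definition wt (g : 'rV[int]_n) (h : 'rV[F]_d) : F :=
  (h *m (map_mx intr g *m rt)^T) 0 0.

Lemma wtD g g' h : wt (g + g') h = wt g h + wt g' h.
Proof. by rewrite /wt map_mxD mulmxDl linearD mulmxDr mxE. Qed.

Lemma wtN g h : wt (- g) h = - wt g h.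
Proof. by rewrite /wt map_mxN mulNmx linearN mulmxN mxE. Qed.

Lemma wt0 h : wt 0 h = 0.
Proof. by rewrite /wt map_mx0 mul0mx trmx0 mulmx0 mxE. Qed.

Lemma wtZ k g h : wt (k *: g) h = k%:~R * wt g h.
Proof. by rewrite /wt map_mxZ -scalemxAl linearZ -scalemxAr mxE. Qed.

Lemma wtHN g h : wt g (- h) = - wt g h.
Proof. by rewrite /wt mulNmx mxE. Qed.

Lemma wt_simple i h : wt (simple_root i) h = (h *m (row i rt)^T) 0 0.
Proof. by rewrite /wt map_delta_mx rowE. Qed.

(** In characteristic zero, free simple roots embed Q in the dual of h, and distinct linear forms
    differ on a basis vector. *)
Lemma wt_separates : row_free rt -> forall g g', g != g' -> exists h, wt g h != wt g' h.
Proof.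
move=> frt g g' ne; pose a := map_mx intr (g - g') *m rt.
have a0 : a != 0.
  apply: contraNneq ne => a0; rewrite -subr_eq0; apply/eqP.
  have e : map_mx (intr : int -> F) (g - g') = 0 :> 'rV[F]_n.
    by apply: (row_free_inj frt); rewrite mul0mx.
  apply/rowP => j; apply/eqP.
  by have /eqP := congr1 (fun v : 'rV[F]_n => v 0 j) e; rewrite !mxE intr_eq0.
have [j aj] : exists j, a 0 j != 0 by apply/rV0Pn.
exists (delta_mx 0 j : 'rV[F]_d); rewrite -subr_eq0 -wtN -wtD /wt -/a.
by rewrite -rowE mxE mxE.
Qed.

Lemma wt_coroot : crt *m rt^T = map_mx intr A ->
  forall i g, wt g (row i crt) = (pairing A (simple_root i) g)%:~R.
Proof.
move=> E i g; rewrite /wt trmx_mul mulmxA -row_mul E.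
rewrite /pairing /simple_root -rowE; transitivity (map_mx intr (row i A *m g^T) 0 0 : F).
  by rewrite map_mxM map_row; congr ((_ *m _) 0 0); apply/matrixP => a b; rewrite !mxE.
by rewrite mxE.
Qed.

End Weights.

Section Chevalley.
Variables (F : numFieldType) (n d : nat) (A : 'M[int]_n) (rt crt : 'M[F]_(n, d)).
Variables (V : lmodType F) (br : V -> V -> V).

(** n+ (or n-, when [e] is replaced by [f]) as the span of right-normed brackets of generators.
    Closure under arbitrary brackets is not built in; [triangular_all] shows that these spans and h
    fill the algebra. *)
Inductive npart (e : 'I_n -> V) : V -> Prop :=
| npart0 : npart e 0
| npartE i : npart e (e i)
| npartB i x : npart e x -> npart e (br (e i) x)
| npartD x y : npart e x -> npart e y -> npart e (x + y)
| npartZ a x : npart e x -> npart e (a *: x).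

Inductive hpart (e : 'I_n -> V) : 'rV[int]_n -> V -> Prop :=
| hpart0 g : hpart e g 0
| hpartE i : hpart e (simple_root i) (e i)
| hpartB i g x : hpart e g x -> hpart e (simple_root i + g) (br (e i) x)
| hpartD g x y : hpart e g x -> hpart e g y -> hpart e g (x + y)
| hpartZ g a x : hpart e g x -> hpart e g (a *: x).

(** The properties of g~(A) that the root theory uses. [chev_gen] says that the generators generate,
    [chev_sep] that n+ + n- meets h trivially and that [H] is injective. The roles of [e] and [f]
    can be exchanged, so each statement about n+ also yields one about n-. *)
Record chevalley (e f : 'I_n -> V) (H : 'rV[F]_d -> V) : Prop := {
  brDl : forall x y z, br (x + y) z = br x z + br y z;
  brDr : forall x y z, br x (y + z) = br x y + br x z;
  brZl : forall a x y, br (a *: x) y = a *: br x y;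
  brZr : forall a x y, br x (a *: y) = a *: br x y;
  brxx : forall x, br x x = 0;
  jacobi : forall x y z, br x (br y z) + (br y (br z x) + br z (br x y)) = 0;
  chevHD : forall h h', H (h + h') = H h + H h';
  chevHZ : forall a h, H (a *: h) = a *: H h;
  chevEF : forall i j, br (e i) (f j) = if i == j then H (row i crt) else 0;
  chevHH : forall h h', br (H h) (H h') = 0;
  chevHE : forall h i, br (H h) (e i) = wt rt (simple_root i) h *: e i;
  chevHF : forall h i, br (H h) (f i) = - wt rt (simple_root i) h *: f i;
  chev_gen : forall P : V -> Prop, P 0 -> (forall i, P (e i)) ->
    (forall i, P (f i)) -> (forall h, P (H h)) ->
    (forall x y, P x -> P y -> P (x + y)) -> (forall a x, P x -> P (a *: x)) ->
    (forall x y, P x -> P y -> P (br x y)) -> forall x, P x;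
  chev_sep : forall x y h, npart e x -> npart f y -> x + y = H h -> h = 0
}.

Section Theory.
Variables (e f : 'I_n -> V) (H : 'rV[F]_d -> V).
Hypothesis C : chevalley e f H.

Lemma br0r x : br x 0 = 0.
Proof. by rewrite -(scale0r (0 : V)) (brZr C) !scale0r. Qed.
Lemma br0l x : br 0 x = 0.
Proof. by rewrite -(scale0r (0 : V)) (brZl C) !scale0r. Qed.
Lemma brNr x y : br x (- y) = - br x y.
Proof. by rewrite -scaleN1r (brZr C) scaleN1r. Qed.
Lemma brC x y : br x y = - br y x.
Proof.
have := brxx C (x + y); rewrite (brDl C) !(brDr C) !(brxx C) add0r addr0.
by move/eqP; rewrite addr_eq0 => /eqP.
Qed.
Lemma br_der x y z : br x (br y z) = br (br x y) z + br y (br x z).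
Proof.
have /eqP := jacobi C x y z; rewrite addr_eq0 => /eqP->.
by rewrite opprD -brNr -brC addrC [X in _ = X + _]brC.
Qed.
Lemma chevH0 : H 0 = 0.
Proof. by apply: (addrI (H 0)); rewrite -(chevHD C) !addr0. Qed.
Lemma chevHN h : H (- h) = - H h.
Proof. by apply/eqP; rewrite -addr_eq0 -(chevHD C) addNr chevH0. Qed.
Lemma chevH_inj0 h : H h = 0 -> h = 0.
Proof.
move=> h0; apply: (chev_sep C (npart0 e) (npart0 f)).
by rewrite addr0.
Qed.

Lemma hpart_npart g x : hpart e g x -> npart e x.
Proof. by elim=> *; [apply: npart0|apply: npartE|apply: npartB|apply: npartD|apply: npartZ]. Qed.

Lemma hpart_wt g x h : hpart e g x -> br (H h) x = wt rt g h *: x.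
Proof.
elim=> [g'|i|i g' y _ IH|g' y z _ IHy _ IHz|g' a y _ IH].
- by rewrite br0r scaler0.
- exact: chevHE C h i.
- by rewrite br_der (chevHE C) (brZl C) IH (brZr C) wtD scalerDl.
- by rewrite (brDr C) IHy IHz scalerDr.
- by rewrite (brZr C) IH !scalerA mulrC.
Qed.

(** For a bracket with e_i of degree k alpha_i, induction gives k - 1 = 1 and an inner factor
    proportional to e_i, and [e_i, e_i] = 0 kills it. This is the source of the fact that multiples
    k alpha_i with k > 1 are not roots. *)
Lemma hpart_pos g x : hpart e g x -> x = 0 \/
  [/\ g != 0, forall i, 0 <= g 0 i &
      forall i (k : int), g = k *: simple_root i -> k = 1 /\ exists a, x = a *: e i].
Proof.
elim=> [g'|i|i g' y _ IH|g' y z _ IHy _ IHz|g' a y _ IH]; first by left.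
- right; split.
  + by apply/eqP => /matrixP/(_ 0 i); rewrite !mxE !eqxx.
  + by move=> j; rewrite mxE; case: eqP.
  + move=> j k /matrixP eq; have := eq 0 i; rewrite !mxE !eqxx /=.
    case: eqVneq => [<-|_]; rewrite ?mulr0 // mulr1 => <-.
    by split=> //; exists 1; rewrite scale1r.
- case: IH => [->|[g0 gp gk]]; first by left; rewrite br0r.
  case: (pselect (exists j (k : int), simple_root i + g' = k *: simple_root j)); last first.
    move=> nex; right; split.
    + apply/eqP => eq; apply: nex; exists i, 0; by rewrite eq scale0r.
    + by move=> j; rewrite !mxE; case: eqP => _ /=; rewrite ?add0r // addr_ge0.
    + by move=> j k eq; case: nex; exists j, k.
  case=> [j [k eq]]; left.
  have ij : i = j.
    apply/eqP; apply/negPn/negP => ij.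
    have := congr1 (fun v : 'rV[int]_n => v 0 i) eq; rewrite !mxE !eqxx /= (negPf ij) mulr0 => e1.
    by have := gp i; rewrite -(lerD2l 1) e1 addr0.
  rewrite -ij in eq.
  have eq' : g' = (k - 1) *: simple_root i.
    by rewrite scalerBl scale1r -eq addrC addKr.
  by case: (gk _ _ eq') => _ [a ->]; rewrite (brZr C) (brxx C) scaler0.
- case: IHy => [->|[g0 gp gk]]; first by rewrite add0r.
  case: IHz => [->|[g1 gp1 gk1]]; first by right; rewrite addr0.
  right; split=> // i k eq; have [k1 [a ->]] := gk _ _ eq.
  by split=> //; have [_ [b ->]] := gk1 _ _ eq; exists (a + b); rewrite scalerDl.
- case: IH => [->|[g0 gp gk]]; first by left; rewrite scaler0.
  right; split=> // i k eq; have [k1 [b ->]] := gk _ _ eq.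
  by split=> //; exists (a * b); rewrite scalerA.
Qed.

Record lideal (I : V -> Prop) : Prop := {
  lid0 : I 0;
  lidD : forall x y, I x -> I y -> I (x + y);
  lidZ : forall a x, I x -> I (a *: x);
  lidB : forall x y, I y -> I (br x y) }.

(** The counterpart of [max_ideal] in an abstract algebra; [max_idealE] identifies the two. *)
Definition imax x := exists I, [/\ lideal I, forall h, I (H h) -> h = 0 & I x].

Section Ideal.
Variable I : V -> Prop.
Hypothesis LI : lideal I.

Lemma lidN x : I x -> I (- x).
Proof. by move=> Ix; rewrite -scaleN1r; apply: (lidZ LI). Qed.
Lemma lidBr x y : I x -> I y -> I (x - y).
Proof. by move=> Ix Iy; apply: (lidD LI) => //; apply: lidN. Qed.
Lemma lidBl x y : I x -> I (br x y).
Proof. by move=> Ix; rewrite brC; apply: lidN; apply: (lidB LI). Qed.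
Lemma lidZK a x : a != 0 -> I (a *: x) -> I x.
Proof.
by move=> a0 /(lidZ LI a^-1); rewrite scalerA mulVf // scale1r.
Qed.
Lemma lid_sum (T : eqType) (s : seq T) (c : T -> V) :
  (forall i, i \in s -> I (c i)) -> I (\sum_(i <- s) c i).
Proof.
move=> Is; rewrite big_seq; apply: (big_ind I) => //; first exact: lid0 LI.
exact: lidD LI.
Qed.

Hypothesis frt : row_free rt.

(* Ideals are graded: apply ad h - g0(h) to remove one homogeneous component. *)
Lemma lid_graded (s : seq 'rV[int]_n) (c : 'rV[int]_n -> V) : uniq s ->
  (forall g h, br (H h) (c g) = wt rt g h *: c g) ->
  I (\sum_(g <- s) c g) -> forall g, g \in s -> I (c g).
Proof.
elim: s c => [|g0 s IH] c //= /andP[g0s us] wc.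
rewrite big_cons => Is.
have Is' g : g \in s -> I (c g).
  move=> gs; have ne : g != g0 by apply: contraNneq g0s => <-.
  have [h hh] := wt_separates frt ne.
  apply: (@lidZK (wt rt g h - wt rt g0 h)); first by rewrite subr_eq0.
  pose c' g := (wt rt g h - wt rt g0 h) *: c g.
  apply: (IH c') => // [g' h'|].
    by rewrite /c' (brZr C) wc !scalerA mulrC.
  have -> : \sum_(j <- s) c' j = br (H h) (c g0 + \sum_(j <- s) c j)
       - wt rt g0 h *: (c g0 + \sum_(j <- s) c j).
    rewrite (brDr C) wc scalerDr opprD addrACA subrr add0r scaler_sumr -sumrN.
    rewrite (big_morph (br (H h)) (brDr C (H h)) (br0r _)) -big_split /=.
    by apply: eq_bigr => j _; rewrite wc /c' scalerBl.
  by apply: lidBr; [apply: (lidB LI)|apply: (lidZ LI)].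
move=> g; rewrite inE => /orP[/eqP->|]; last exact: Is'.
rewrite -[c g0](addrK (\sum_(j <- s) c j)); apply: lidBr => //.
exact: lid_sum.
Qed.

End Ideal.

Hypotheses (frt : row_free rt) (crtE : crt *m rt^T = map_mx intr A) (GA : gcm A).

Lemma coroot_simple i j : wt rt (simple_root j) (row i crt) = (A i j)%:~R.
Proof.
rewrite (wt_coroot crtE); congr (_%:~R).
by rewrite pairing_simple.
Qed.

Lemma f_iter_wt i m x : br (H (row i crt)) x = m *: x -> forall j,
  br (H (row i crt)) (iter j (br (f i)) x) = (m - (2 * j)%:R) *: iter j (br (f i)) x.
Proof.
move=> wx; elim=> [|j IH] /=; first by rewrite muln0 subr0.
rewrite br_der (chevHF C) IH (brZl C) (brZr C) -scalerDl coroot_simple.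
case: GA => -> _ _; congr (_ *: _).
by rewrite mulnS natrD (_ : 2%:~R = 2%:R) //; ring.
Qed.

(** The sl2 commutation formula with the term in [br (e i) x] kept, because x need not be a highest
    weight vector. *)
Lemma e_f_iter i m x : br (H (row i crt)) x = m *: x -> forall j,
  br (e i) (iter j.+1 (br (f i)) x) =
  iter j.+1 (br (f i)) (br (e i) x)
   + (j.+1%:R * (m - j%:R)) *: iter j (br (f i)) x.
Proof.
move=> wx; elim=> [|j IH].
  by rewrite /= br_der (chevEF C) eqxx wx addrC mul1r subr0.
rewrite iterS br_der (chevEF C) eqxx (f_iter_wt wx) IH (brDr C) (brZr C) -!iterS.
rewrite addrCA -scalerDl; congr (_ + _ *: _).
by rewrite natrM -[in RHS]addn1 -[in X in _ = _ * (m - X)]addn1 !natrD; ring.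
Qed.

(** * Strings and local nilpotency modulo an ideal *)

Section NilpotentModulo.
Variable I : V -> Prop.
Hypothesis LI : lideal I.

(* For x of weight m, the sl2 argument only needs e nilpotent on x: if f^m x = 0 then
   f^(m+2) (e x) = 0, so e x = 0 by induction, x is a highest weight vector and
   e f^(j+1) x = (j+1)(m-j) f^j x. *)
Lemma f_iter_inj i N m x : br (H (row i crt)) x = m%:R *: x ->
  I (iter N (br (e i)) x) -> I (iter m (br (f i)) x) -> I x.
Proof.
have Ief y : I y -> I (br (f i) y) by apply: lidB.
elim: N m x => [|N IH] m x wx //; rewrite iterSr => Ie If.
have wex : br (H (row i crt)) (br (e i) x) = (m + 2)%:R *: br (e i) x.
  rewrite br_der (chevHE C) wx (brZl C) (brZr C) -scalerDl coroot_simple.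
  by case: GA => -> _ _; rewrite addrC natrD.
have Iex : I (br (e i) x).
  apply: IH wex Ie _; rewrite addn2 iterS; apply/Ief.
  have := e_f_iter wx m; rewrite subrr mulr0 scale0r addr0 => <-.
  by apply: (lidB LI); apply/Ief.
suff: forall j, (j <= m)%N -> I (iter (m - j) (br (f i)) x).
  by move/(_ m (leqnn m)); rewrite subnn.
elim=> [|j IHj] jm; first by rewrite subn0.
have {IHj} := IHj (ltnW jm); rewrite -(subnSK jm) => /(lidB LI (e i)).
rewrite (e_f_iter wx) => Is.
have : I (((m - j.+1).+1%:R * (m%:R - (m - j.+1)%:R)) *: iter (m - j.+1) (br (f i)) x).
  rewrite -[X in I X](addKr (iter (m - j.+1).+1 (br (f i)) (br (e i) x))).
  apply: (lidD LI _ Is); apply: (lidN LI).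
  by elim: (m - j.+1).+1 => [|k IHk] //=; apply/Ief.
apply: (lidZK LI); rewrite mulf_neq0 ?pnatr_eq0 //.
by rewrite -natrB ?leq_subr // pnatr_eq0 subKn.
Qed.

Lemma iter_ideal z N x : I x -> I (iter N (br z) x).
Proof. by move=> Ix; elim: N => //= N; apply: lidB. Qed.

Lemma iter_br z N x y : iter N.+1 (br z) (br x y) =
  iter N (br z) (br (br z x) y) + iter N (br z) (br x (br z y)).
Proof.
rewrite iterSr br_der; elim: N => //= N ->; exact: brDr C _ _ _.
Qed.

(** By the Leibniz rule, a + b derivations put at least a on x or at least b on y. Distributing one
    derivation at a time avoids binomial coefficients. *)
Lemma iter_br_ideal z a b x y : I (iter a (br z) x) -> I (iter b (br z) y) ->
  I (iter (a + b) (br z) (br x y)).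
Proof.
have [N le] := ubnP (a + b); elim: N a b x y le => // N IH [|a] b x y le Ia Ib.
  by apply: iter_ideal; apply: lidBl.
case: b => [|b] in le Ib *; first by apply: iter_ideal; apply: (lidB LI).
rewrite addSn iter_br; apply: (lidD LI).
  by apply: IH; rewrite -?iterSr.
by rewrite addnS -addSn; apply: IH; rewrite -?iterSr // addSnnS.
Qed.

Lemma iterD_ideal z k N x : I (iter N (br z) x) -> I (iter (k + N) (br z) x).
Proof. by rewrite iterD; apply: iter_ideal. Qed.

Lemma iter_add z N x y : iter N (br z) (x + y) = iter N (br z) x + iter N (br z) y.
Proof. by elim: N => //= N ->; rewrite (brDr C). Qed.

Lemma iter_scale z N a x : iter N (br z) (a *: x) = a *: iter N (br z) x.
Proof. by elim: N => //= N ->; rewrite (brZr C). Qed.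

Hypothesis serre : forall i j, i != j -> exists N, I (iter N (br (e i)) (e j)).

(** The elements on which ad e_i is nilpotent modulo I form a subalgebra, so generators suffice: e_j
    by the Serre hypothesis, H h after two steps, and f_j after three, through alpha_i^v and a
    multiple of e_i. *)
Lemma ad_e_nilpotent i x : exists N, I (iter N (br (e i)) x).
Proof.
move: x; apply: (chev_gen C).
- by exists 0%N; apply: lid0 LI.
- move=> j; have [<-|ij] := eqVneq i j; last exact: serre.
  by exists 1%N; rewrite /= (brxx C); apply: lid0 LI.
- move=> j; exists 3; rewrite /= (chevEF C); case: eqP => _.
    rewrite [br (e i) (H _)]brC (chevHE C) brNr (brZr C) (brxx C) scaler0 oppr0.
    exact: lid0 LI.
  by rewrite !br0r; apply: lid0 LI.
- move=> h; exists 2; rewrite /= [br (e i) (H _)]brC (chevHE C) brNr (brZr C) (brxx C) scaler0 oppr0.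
  exact: lid0 LI.
- move=> x y [M Ix] [N Iy]; exists (M + N)%N; rewrite iter_add.
  by apply: (lidD LI); [rewrite addnC|]; apply: iterD_ideal.
- by move=> a x [M Ix]; exists M; rewrite iter_scale; apply: (lidZ LI).
- by move=> x y [M Ix] [N Iy]; exists (M + N)%N; apply: iter_br_ideal.
Qed.

End NilpotentModulo.

End Theory.

(** The Chevalley involution as a change of generators. The sign on [H] is forced by [f_i, e_i] =
    -alpha_i^v. *)
Lemma chevalley_swap e f H : chevalley e f H -> chevalley f e (fun h => H (- h)).
Proof.
move=> C; split; try by [case: C].
- by move=> h h'; rewrite opprD (chevHD C).
- by move=> a h; rewrite -scalerN (chevHZ C).
- move=> i j; rewrite (brC C) (chevEF C) eq_sym; case: eqP => [->|_].
    by rewrite (chevHN C).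
  by rewrite oppr0.
- by move=> h i; rewrite (chevHF C) wtHN opprK.
- by move=> h i; rewrite (chevHE C) wtHN.
- move=> P P0 Pf Pe PH PD PZ PB; apply: (chev_gen C) => // h.
  by rewrite -[h]opprK.
- move=> x y h nx ny xy; have := chev_sep C ny nx; rewrite addrC => /(_ _ xy).
  by move/eqP; rewrite oppr_eq0 => /eqP.
Qed.

(** * The Serre relations modulo the maximal ideal *)

Section Serre.
Variables (e f : 'I_n -> V) (H : 'rV[F]_d -> V).
Hypothesis C : chevalley e f H.
Hypotheses (frt : row_free rt) (crtE : crt *m rt^T = map_mx intr A) (GA : gcm A).
Notation brC := (brC C).
Notation br_der := (br_der C).
Notation br0l := (br0l C).
Notation br0r := (br0r C).
Notation brNr := (brNr C).

Inductive eclosure (u : V) : V -> Prop :=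
| eclosure0 : eclosure u 0
| eclosureU : eclosure u u
| eclosureB i x : eclosure u x -> eclosure u (br (e i) x)
| eclosureD x y : eclosure u x -> eclosure u y -> eclosure u (x + y)
| eclosureZ a x : eclosure u x -> eclosure u (a *: x).

(** [eclosure u] is U(n+) u. A weight vector u killed by all f_k is a lowest weight vector, so U(n+)
    u is stable under h and under the f_k, hence under everything that the generators generate. *)
Lemma eclosure_ideal u : (forall h, exists a, br (H h) u = a *: u) ->
  (forall k, br (f k) u = 0) -> lideal (eclosure u).
Proof.
move=> Hu fu.
have cH h x : eclosure u x -> eclosure u (br (H h) x).
  elim=> [||i y cy IH|y z _ IHy _ IHz|a y _ IH].
  - by rewrite br0r; apply: eclosure0.
  - by have [a ->] := Hu h; apply/eclosureZ/eclosureU.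
  - by rewrite br_der (chevHE C) (brZl C); apply/eclosureD/eclosureB => //; apply/eclosureZ/eclosureB.
  - by rewrite (brDr C); apply: eclosureD.
  - by rewrite (brZr C); apply: eclosureZ.
have cf k x : eclosure u x -> eclosure u (br (f k) x).
  elim=> [||i y cy IH|y z _ IHy _ IHz|a y _ IH].
  - by rewrite br0r; apply: eclosure0.
  - by rewrite fu; apply: eclosure0.
  - rewrite br_der [br (f k) (e i)]brC (chevEF C).
    apply: eclosureD; last exact: eclosureB.
    case: eqP => _; last by rewrite oppr0 br0l; apply: eclosure0.
    by rewrite -(chevHN C); apply: cH.
  - by rewrite (brDr C); apply: eclosureD.
  - by rewrite (brZr C); apply: eclosureZ.
split; [exact: eclosure0|exact: eclosureD|exact: eclosureZ|].
apply: (chev_gen C).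
- by move=> y _; rewrite br0l; apply: eclosure0.
- by move=> i y; apply: eclosureB.
- exact: cf.
- exact: cH.
- by move=> x y IHx IHy z cz; rewrite (brDl C); apply: eclosureD; auto.
- by move=> a x IH z cz; rewrite (brZl C); apply: eclosureZ; auto.
- move=> x y IHx IHy z cz.
  have -> : br (br x y) z = br x (br y z) + (-1) *: br y (br x z).
    by rewrite scaleN1r br_der addrK.
  by apply: eclosureD; auto; apply: eclosureZ; auto.
Qed.

(** With N = -a_ij, the element (ad e_i)^(N+1) e_j is killed by every f_k, so the ideal that it
    generates is U(n+) applied to it. That ideal lies in n+ and meets h trivially. *)
Lemma serre_e i j : i != j -> exists N, imax H (iter N (br (e i)) (e j)).
Proof.
move=> ij; have [A2 Aneg Asym] := GA.
pose N := `|A i j|%N; have AN : A i j = - N%:Z by rewrite /N lez0_abs ?opprK ?Aneg.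
exists N.+1; set u := iter _ _ _; exists (eclosure u); split; [|move=> h cu|exact: eclosureU].
- apply: eclosure_ideal => [h|k].
  + rewrite /u; elim: N.+1 => [|M [a IH]] /=; first by exists (wt rt (simple_root j) h); rewrite (chevHE C).
    exists (wt rt (simple_root i) h + a).
    by rewrite br_der (chevHE C) IH (brZl C) (brZr C) scalerDl.
  + have [ki|ki] := eqVneq k i; last first.
      have com y : br (f k) (br (e i) y) = br (e i) (br (f k) y).
        by rewrite br_der [br (f k) (e i)]brC (chevEF C) eq_sym (negPf ki) oppr0 br0l add0r.
      have -> : br (f k) u = iter N.+1 (br (e i)) (br (f k) (e j)).
        by rewrite /u; elim: N.+1 => //= M IHM; rewrite com IHM.
      rewrite [br (f k) (e j)]brC (chevEF C); case: eqP => [_|_]; last first.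
        by rewrite oppr0; elim: N.+1 => //= M ->; rewrite br0r.
      rewrite iterSr brNr brC opprK (chevHE C) coroot_simple //.
      (* What is left is a multiple a_ji e_i under (ad e_i)^N. It dies by [e_i, e_i] = 0 if N > 0;
         for N = 0, a_ij = 0 forces a_ji = 0. *)
      case: (posnP N) => [N0|].
        by rewrite (Asym j i) ?scale0r ?N0 // AN N0.
      move=> N0; rewrite -(prednK N0) iterSr (brZr C) (brxx C) scaler0.
      by elim: N.-1 => //= M ->; rewrite br0r.
    rewrite ki.
    have w : br (H (- row i crt)) (e j) = N%:R *: e j.
      rewrite (chevHE C) wtHN coroot_simple // AN; congr (_ *: _).
      by rewrite mulrNz opprK.
    (* For the swapped triple e_j has weight N, so the coefficient (N + 1)(N - N) in the sl2 formula
       vanishes. *)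
    rewrite /u (e_f_iter (chevalley_swap C) crtE GA w) subrr mulr0 scale0r addr0.
    rewrite [br (f i) (e j)]brC (chevEF C) eq_sym (negPf ij) oppr0.
    by elim: N.+1 => //= M ->; rewrite br0r.
- apply: (chev_sep C (x := H h) (y := 0)); last by rewrite addr0.
    elim: cu => [||k x _|x y _ nx _ ny|a x _ nx]; try by constructor.
    by rewrite /u; elim: N.+1 => [|M IH] /=; constructor.
  exact: npart0.
Qed.

End Serre.
End Chevalley.

(** * Triangular decomposition, grading and roots *)

Section Roots.
Variables (F : numFieldType) (n d : nat) (A : 'M[int]_n) (rt crt : 'M[F]_(n, d)).
Variables (V : lmodType F) (br : V -> V -> V).
Hypotheses (frt : row_free rt) (crtE : crt *m rt^T = map_mx intr A) (GA : gcm A).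
Notation chevalley := (chevalley rt crt br).
Notation npart := (npart br).
Notation hpart := (hpart br).
Notation lideal := (lideal br).
Notation imax := (imax br).

Section Decomposition.
Variables (e f : 'I_n -> V) (H : 'rV[F]_d -> V).
Hypothesis C : chevalley e f H.

Lemma npart_H h x : npart e x -> npart e (br (H h) x).
Proof.
elim=> [|i|i y ny IH|y z _ IHy _ IHz|a y _ IH].
- by rewrite (br0r C); apply: npart0.
- by rewrite (chevHE C); apply/npartZ/npartE.
- rewrite (br_der C) (chevHE C) (brZl C).
  by apply/npartD/npartB => //; apply/npartZ/npartB.
- by rewrite (brDr C); apply: npartD.
- by rewrite (brZr C); apply: npartZ.
Qed.

Lemma npart_lower i x : npart e x ->
  exists y h, npart e y /\ br (f i) x = y + H h.
Proof.
elim=> [|j|j y ny [y' [h' [ny' IH]]]|y z _ [y' [h [ny IHy]]] _ [z' [h' [nz IHz]]]|a y _ [y' [h [ny IH]]]].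
- by exists 0, 0; rewrite (br0r C) (chevH0 C) addr0; split=> //; apply: npart0.
- exists 0; exists (if j == i then - row j crt else 0); split; first exact: npart0.
  by rewrite (brC C) (chevEF C) add0r; case: eqP; rewrite ?(chevHN C) ?(chevH0 C) ?oppr0.
- exists (br (if j == i then - H (row j crt) else 0) y + br (e j) y'
    - wt rt (simple_root j) h' *: e j), 0; split.
    apply: npartD; last by rewrite -scaleNr; apply/npartZ/npartE.
    apply: npartD; last exact: npartB.
    case: eqP => _; first by rewrite -(chevHN C); apply: npart_H.
    by rewrite (br0l C); apply: npart0.
  rewrite (br_der C) IH (brDr C) (chevH0 C) addr0 -addrA.
  rewrite [br (f i) (e j)](brC C) (chevEF C) [br (e j) (H _)](brC C) (chevHE C).
  by case: eqP; rewrite ?oppr0.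
- exists (y' + z'), (h + h'); split; first exact: npartD.
  by rewrite (brDr C) IHy IHz (chevHD C) addrACA.
- exists (a *: y'), (a *: h); split; first exact: npartZ.
  by rewrite (brZr C) IH (chevHZ C) scalerDr.
Qed.

Lemma npart_hpart x : npart e x -> exists l : seq ('rV[int]_n * V),
  (forall p, p \in l -> hpart e p.1 p.2) /\ x = \sum_(p <- l) p.2.
Proof.
elim=> [|j|j y ny [l [hl ->]]|y z _ [l [hl ->]] _ [l' [hl' ->]]|a y _ [l [hl ->]]].
- by exists [::]; rewrite big_nil.
- exists [:: (simple_root j, e j)]; rewrite big_seq1; split=> // p.
  by rewrite inE => /eqP->; apply: hpartE.
- exists [seq (simple_root j + p.1, br (e j) p.2) | p <- l]; split.
    by move=> p /mapP[p' /hl hp ->]; apply: hpartB.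
  by rewrite big_map (big_morph (br (e j)) (brDr C _) (br0r C _)).
- exists (l ++ l'); rewrite big_cat; split=> // p.
  by rewrite mem_cat => /orP[/hl|/hl'].
- exists [seq (p.1, a *: p.2) | p <- l]; split.
    by move=> p /mapP[p' /hl hp ->]; apply: hpartZ.
  by rewrite big_map scaler_sumr.
Qed.

End Decomposition.

Section Triangular.
Variables (e f : 'I_n -> V) (H : 'rV[F]_d -> V).

Definition triangular x := exists a b h, [/\ npart e a, npart f b & x = a + b + H h].

Hypothesis C : chevalley e f H.

Lemma triangularD x y : triangular x -> triangular y -> triangular (x + y).
Proof.
move=> [a [b [h [na nb ->]]]] [a' [b' [h' [na' nb' ->]]]].
exists (a + a'), (b + b'), (h + h'); split; try exact: npartD.
by rewrite (chevHD C) addrACA; congr (_ + _); rewrite addrACA.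
Qed.

Lemma triangularZ k x : triangular x -> triangular (k *: x).
Proof.
move=> [a [b [h [na nb ->]]]]; exists (k *: a), (k *: b), (k *: h).
by split; try exact: npartZ; rewrite (chevHZ C) !scalerDr.
Qed.

Lemma triangular_e i x : triangular x -> triangular (br (e i) x).
Proof.
move=> [a [b [h [na nb ->]]]].
have [b' [h' [nb' eb]]] := npart_lower (chevalley_swap C) i nb.
exists (br (e i) a - wt rt (simple_root i) h *: e i), b', (- h'); split=> //.
  by apply: npartD; [exact: npartB|rewrite -scaleNr; apply/npartZ/npartE].
rewrite !(brDr C) eb [br (e i) (H h)](brC C) (chevHE C) -!addrA; congr (_ + _).
by rewrite addrA [LHS]addrC.
Qed.

End Triangular.

Section Homogeneous.
Variables (e f : 'I_n -> V) (H : 'rV[F]_d -> V).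
Hypothesis C : chevalley e f H.

Lemma triangular_swap x : triangular e f H x -> triangular f e (fun h => H (- h)) x.
Proof.
by move=> [a [b [h [na nb ->]]]]; exists b, a, (- h); rewrite opprK [b + a]addrC.
Qed.

Lemma triangular_swapV x : triangular f e (fun h => H (- h)) x -> triangular e f H x.
Proof. by move=> [a [b [h [na nb ->]]]]; exists b, a, (- h); rewrite [b + a]addrC. Qed.

(** n+ + n- + h contains the generators and is stable under ad of each of them, hence under ad z for
    every z by the Jacobi identity. *)
Lemma triangular_all x : triangular e f H x.
Proof.
have t0 : triangular e f H 0.
  by exists 0, 0, 0; rewrite (chevH0 C) !addr0; split=> //; apply: npart0.
have tE i : triangular e f H (e i).
  by exists (e i), 0, 0; rewrite (chevH0 C) !addr0; split=> //; constructor.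
have tF i : triangular e f H (f i).
  by exists 0, (f i), 0; rewrite (chevH0 C) add0r !addr0; split=> //; constructor.
have tH h : triangular e f H (H h).
  by exists 0, 0, h; rewrite !add0r; split=> //; constructor.
have tbr : forall z y, triangular e f H y -> triangular e f H (br z y).
  apply: (chev_gen C).
  - by move=> y _; rewrite (br0l C).
  - by move=> i y; apply: triangular_e.
  - move=> i y /triangular_swap ty; apply: triangular_swapV.
    exact: (triangular_e (chevalley_swap C)).
  - move=> h y [a [b [h' [na nb ->]]]].
    exists (br (H h) a), (br (H h) b), 0; split; first exact: (npart_H C).
      by have := npart_H (chevalley_swap C) (- h) nb; rewrite opprK.
    by rewrite !(brDr C) (chevHH C) (chevH0 C).
  - by move=> x' y IHx IHy z tz; rewrite (brDl C); apply: (triangularD C); auto.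
  - by move=> a y IH z tz; rewrite (brZl C); apply: (triangularZ C); auto.
  - move=> x' y IHx IHy z tz.
    have -> : br (br x' y) z = br x' (br y z) + (-1) *: br y (br x' z).
      by rewrite scaleN1r (br_der C) addrK.
    by apply: (triangularD C); auto; apply: (triangularZ C); auto.
move: x; apply: (chev_gen C) => //.
- exact: (triangularD C).
- exact: (triangularZ C).
- by move=> x y _; apply: tbr.
Qed.

(** Keeping the three parts in one predicate makes it additive; by [hpart_pos] at most one of them
    is non-zero. *)
Definition homog (g : 'rV[int]_n) (y : V) := exists a b h,
  [/\ y = a + b + H h, hpart e g a, hpart f (- g) b & g != 0 -> h = 0].

Lemma homog0 g : homog g 0.
Proof. by exists 0, 0, 0; rewrite (chevH0 C) !addr0; split=> //; constructor. Qed.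

Lemma homogD g x y : homog g x -> homog g y -> homog g (x + y).
Proof.
move=> [a [b [h [-> na nb h0]]]] [a' [b' [h' [-> na' nb' h0']]]].
exists (a + a'), (b + b'), (h + h'); split; try exact: hpartD.
  by rewrite (chevHD C) addrACA; congr (_ + _); rewrite addrACA.
by move=> g0; rewrite h0 // h0' // addr0.
Qed.

Lemma homog_wt g y h : homog g y -> br (H h) y = wt rt g h *: y.
Proof.
move=> [a [b [h' [-> ha hb g0]]]].
rewrite !(brDr C) (chevHH C) addr0 !scalerDr (hpart_wt C _ ha).
have := hpart_wt (chevalley_swap C) (- h) hb; rewrite opprK wtHN wtN opprK => ->.
have [->|/g0->] := eqVneq g 0; first by rewrite !wt0 !scale0r !addr0.
by rewrite (chevH0 C) scaler0 addr0.
Qed.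

Lemma homog_decomposition x : exists s c,
  [/\ uniq s, forall g, homog g (c g) & x = \sum_(g <- s) c g].
Proof.
have [a [b [h [na nb ->]]]] := triangular_all x.
have [la [hla ->]] := npart_hpart C na.
have [lb [hlb ->]] := npart_hpart (chevalley_swap C) nb.
pose l := la ++ [seq (- p.1, p.2) | p <- lb] ++ [:: (0, H h)].
have hl p : p \in l -> homog p.1 p.2.
  rewrite !mem_cat inE => /or3P[/hla hp|/mapP[p' /hlb hp ->]|/eqP->].
  - by exists p.2, 0, 0; rewrite (chevH0 C) !addr0; split=> //; constructor.
  - exists 0, p'.2, 0; rewrite (chevH0 C) add0r addr0 opprK; split=> //; constructor.
  - by exists 0, 0, h; rewrite !add0r eqxx; split=> //; constructor.
exists (undup [seq p.1 | p <- l]), (fun g => \sum_(p <- l | p.1 == g) p.2).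
split; first exact: undup_uniq.
  move=> g; rewrite big_seq_cond; apply: (big_ind (homog g)).
  - exact: homog0.
  - exact: homogD.
  - by move=> p /andP[/hl hp /eqP <-].
transitivity (\sum_(p <- l) p.2).
  by rewrite !big_cat /= big_map big_seq1 addrA.
rewrite (exchange_big_dep xpredT) //= big_seq [RHS]big_seq.
apply: eq_bigr => p pl; rewrite (eq_bigl (pred1 p.1)); last by move=> g; rewrite /= eq_sym.
rewrite -big_filter filter_pred1_uniq ?undup_uniq ?mem_undup ?map_f //.
by rewrite big_seq1.
Qed.

(** Ideals are graded, and the component of degree 0 of an element of I lies in both I and h, so it
    vanishes. This is why a sum of two ideals meeting h trivially again meets h trivially. *)
Lemma lideal_no_h I u : lideal I -> (forall h, I (H h) -> h = 0) -> I u ->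
  exists a b, [/\ npart e a, npart f b & u = a + b].
Proof.
move=> LI Ih Iu; have [s [c [us hc eu]]] := homog_decomposition u.
have Ic g : g \in s -> I (c g).
  apply: (lid_graded C LI frt us (c := c)); last by rewrite -eu.
  by move=> g' h; apply: homog_wt.
rewrite eu big_seq; apply: (big_ind (fun u => exists a b, [/\ npart e a, npart f b & u = a + b])).
- by exists 0, 0; rewrite addr0; split=> //; constructor.
- move=> x y [a [b [na nb ->]]] [a' [b' [na' nb' ->]]].
  by exists (a + a'), (b + b'); rewrite addrACA; split=> //; apply: npartD.
- move=> g /Ic; have [a [b [h [-> ha hb g0]]]] := hc g.
  have [eg|/g0->] := eqVneq g 0; last first.
    move=> _; exists a, b; rewrite (chevH0 C) addr0; split=> //.
      exact: hpart_npart ha.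
    exact: hpart_npart hb.
  have -> : a = 0 by case: (hpart_pos C ha) => // -[]; rewrite eg eqxx.
  have -> : b = 0 by case: (hpart_pos (chevalley_swap C) hb) => // -[]; rewrite eg oppr0 eqxx.
  rewrite !add0r => /Ih ->; exists 0, 0; rewrite (chevH0 C) addr0.
  by split=> //; constructor.
Qed.

Lemma imax_h h : imax H (H h) -> h = 0.
Proof. by move=> [I [_ Ih /Ih]]. Qed.

Lemma imax_ideal : lideal (imax H).
Proof.
split.
- exists (fun x => x = 0); split=> //; last by move=> h; apply: (chevH_inj0 C).
  by split=> // [x y -> ->|a x ->|x y ->]; rewrite ?addr0 ?scaler0 ?(br0r C).
- move=> x y [I [LI Ih Ix]] [J [LJ Jh Jy]].
  exists (fun z => exists u v, [/\ I u, J v & z = u + v]); split; last by exists x, y.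
    split.
    - by exists 0, 0; rewrite addr0; split=> //; [apply: lid0 LI|apply: lid0 LJ].
    - move=> z z' [u [v [Iu Jv ->]]] [u' [v' [Iu' Jv' ->]]].
      exists (u + u'), (v + v'); rewrite addrACA.
      by split=> //; [apply: (lidD LI)|apply: (lidD LJ)].
    - move=> a z [u [v [Iu Jv ->]]]; exists (a *: u), (a *: v); rewrite scalerDr.
      by split=> //; [apply: (lidZ LI)|apply: (lidZ LJ)].
    - move=> w z [u [v [Iu Jv ->]]]; exists (br w u), (br w v); rewrite (brDr C).
      by split=> //; [apply: (lidB LI)|apply: (lidB LJ)].
  move=> h [u [v [Iu Jv hE]]].
  have [a [b [na nb eu]]] := lideal_no_h LI Ih Iu.
  have [a' [b' [na' nb' ev]]] := lideal_no_h LJ Jh Jv.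
  apply: (chev_sep C (x := a + a') (y := b + b')); try exact: npartD.
  by rewrite hE eu ev addrACA.
- by move=> a x [I [LI Ih Ix]]; exists I; split=> //; apply: (lidZ LI).
- by move=> x y [I [LI Ih Ix]]; exists I; split=> //; apply: (lidB LI).
Qed.

Definition wroot (g : 'rV[int]_n) := g != 0 /\
  exists y, (forall h, br (H h) y = wt rt g h *: y) /\ ~ imax H y.

(** A weight vector modulo the maximal ideal is replaced by its component of degree g. In (ad h -
    g(h)) x the component of degree g' is scaled by g'(h) - g(h), and it lies in the ideal because
    ideals are graded; so every component of degree other than g is in the ideal, and the one of
    degree g cannot be. *)
Lemma wroot_homog g x : g != 0 -> ~ imax H x ->
  (forall h, imax H (br (H h) x - wt rt g h *: x)) ->
  exists y, homog g y /\ ~ imax H y.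
Proof.
move=> g0 nx wx; have L := imax_ideal.
have [s [c [us hc ex]]] := homog_decomposition x.
have wc g' h : br (H h) (c g') = wt rt g' h *: c g' by apply: homog_wt.
exists (c g); split=> // Icg; apply: nx; rewrite ex; apply: (lid_sum L) => g' g's.
have [->//|ne] := eqVneq g' g.
have [h hh] := wt_separates frt ne.
apply: (lidZK L (a := wt rt g' h - wt rt g h)); first by rewrite subr_eq0.
apply: (lid_graded C L frt us (c := fun g' => (wt rt g' h - wt rt g h) *: c g')) => //.
  by move=> g1 h1; rewrite (brZr C) wc !scalerA mulrC.
move: (wx h); rewrite {1 2}ex (big_morph (br (H h)) (brDr C _) (br0r C _)).
rewrite scaler_sumr -sumrB; congr imax.
by apply: eq_bigr => g1 _; rewrite wc scalerBl.
Qed.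

Lemma wroot_pos g : wroot g ->
  ((forall i, 0 <= g 0 i) \/ (forall i, 0 <= - g 0 i)) /\
  (forall i k, g = k *: simple_root i -> k = 1 \/ k = -1).
Proof.
move=> [g0 [x [wx nx]]].
have L := imax_ideal.
have [|y [[a [b [h [ey ha hb h0]]]] ny]] := @wroot_homog g x g0 nx.
  by move=> h; rewrite wx subrr; apply: lid0 L.
rewrite ey h0 // (chevH0 C) addr0 in ny.
have [a0|[_ gp gk]] := hpart_pos C ha; last first.
  by split; [left|move=> i k /gk[]; left].
have [b0|[_ gp gk]] := hpart_pos (chevalley_swap C) hb; last first.
  split; first by right=> i; have := gp i; rewrite mxE.
  move=> i k eg; right; have [|] := gk i (- k); first by rewrite eg scaleNr.
  by move=> /eqP; rewrite eqr_oppLR => /eqP.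
by case: ny; rewrite a0 b0 addr0; apply: lid0 L.
Qed.

(** If e_i were in the maximal ideal, so would be [e_i, f_i] = alpha_i^v, an element of h on which
    alpha_i takes the value 2. *)
Lemma wroot_simple i : wroot (simple_root i).
Proof.
split; first by apply/eqP => /matrixP/(_ 0 i); rewrite !mxE !eqxx.
exists (e i); split; first by move=> h; rewrite (chevHE C).
move=> /(lidBl C imax_ideal (f i)); rewrite (chevEF C) eqxx => /imax_h h0.
have := coroot_simple crtE i i; rewrite h0 /wt mul0mx mxE.
by case: GA => -> _ _ /eqP; rewrite eq_sym intr_eq0.
Qed.

(** With m the pairing of alpha_i^v and g, the vector f_i^m y has weight g - m alpha_i. It survives
    in the quotient by [f_iter_inj], because ad e_i is locally nilpotent modulo the maximal
    ideal. *)
Lemma wroot_reflect_pos i g : wroot g -> 0 <= pairing A (simple_root i) g ->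
  wroot (simple_refl A i g).
Proof.
have L := imax_ideal.
move=> [g0 [y [wy ny]]]; case Em : (pairing _ _ _) => [m|//] _.
have wm : br (H (row i crt)) y = m%:R *: y by rewrite wy (wt_coroot crtE) Em.
have ek k h : br (H h) (iter k (br (f i)) y) =
    wt rt (g - k%:Z *: simple_root i) h *: iter k (br (f i)) y.
  elim: k => [|k IH] /=; first by rewrite scale0r subr0 wy.
  rewrite (br_der C) (chevHF C) IH (brZl C) (brZr C) -scalerDl; congr (_ *: _).
  rewrite !wtD !wtN !wtZ intS intrD mulrDl opprD mul1r; ring.
split.
  apply: contra_neq g0; rewrite /simple_refl Em => /eqP; rewrite subr_eq0 => /eqP eg.
  have : pairing A (simple_root i) g = (Posz m) * 2.
    by rewrite {1}eg pairingZr pairing_simple; case: GA => ->.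
  rewrite Em eg => mm; suff -> : m = 0%N by rewrite scale0r.
  by apply/eqP; move: mm; lia.
exists (iter m (br (f i)) y); rewrite /simple_refl Em; split=> // If.
apply: ny; have [N eN] := ad_e_nilpotent C L (serre_e C crtE GA) i y.
exact: (f_iter_inj C crtE GA L wm eN If).
Qed.

End Homogeneous.

Lemma imax_swap (H : 'rV[F]_d -> V) x : imax H x <-> imax (fun h => H (- h)) x.
Proof.
split=> -[I [LI Ih Ix]]; exists I; split=> // h.
  by move/Ih/eqP; rewrite oppr_eq0 => /eqP.
by rewrite -[X in H X]opprK => /Ih/eqP; rewrite oppr_eq0 => /eqP.
Qed.

Lemma wroot_swap (H : 'rV[F]_d -> V) g : wroot H g <-> wroot (fun h => H (- h)) (- g).
Proof.
split=> -[g0 [y [wy ny]]]; split; rewrite ?oppr_eq0 // in g0 *; exists y; split.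
- by move=> h; rewrite wy wtN wtHN.
- by move=> /(imax_swap H y).2.
- by move=> h; have := wy (- h); rewrite opprK wtN wtHN opprK.
- by move=> /(imax_swap H y).1.
Qed.

Lemma wroot_reflect e f H i g : chevalley e f H -> wroot H g -> wroot H (simple_refl A i g).
Proof.
move=> C rg; have [p|p] := leP 0 (pairing A (simple_root i) g).
  exact: wroot_reflect_pos C _ _ rg p.
have pN : pairing A (simple_root i) (- g) = - pairing A (simple_root i) g.
  by rewrite /pairing linearN mulmxN mxE.
apply: (wroot_swap H _).2; have -> : - simple_refl A i g = simple_refl A i (- g).
  by rewrite /simple_refl pN scaleNr opprB opprK addrC.
apply: (wroot_reflect_pos (chevalley_swap C)); first exact: (wroot_swap H g).1.
by rewrite pN oppr_ge0 ltW.
Qed.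

End Roots.

(** * The roots of a Kac-Moody algebra *)

Section AuxiliaryAlgebra.
Variables (F : numFieldType) (n : nat) (A : 'M[F]_n) (D : realization A).
Notation term := (lie_term F n (n + (n - \rank A))).
Notation "x ~ y" := (aux_eq D x y) (at level 70).

(** Terms modulo [aux_eq]: an element is an equivalence class, encoded as a predicate, and choice
    provides the representatives [aux_repr]. *)
Record auxalg : Type := AuxAlg {
  aux_class : term -> Prop;
  aux_classP : exists t, aux_class = aux_eq D t }.

HB.instance Definition _ := gen_eqMixin auxalg.
HB.instance Definition _ := gen_choiceMixin auxalg.

Definition aux_pi t : auxalg := AuxAlg (ex_intro _ t erefl).
Definition aux_repr (g : auxalg) : term := projT1 (cid (aux_classP g)).

Lemma aux_reprK g : aux_pi (aux_repr g) = g.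
Proof.
rewrite /aux_repr; case: g => c p /=; case: cid => t /= ct.
by subst c; congr AuxAlg; apply: Prop_irrelevance.
Qed.

Lemma aux_piP s t : aux_pi s = aux_pi t <-> s ~ t.
Proof.
split=> [[e]|e].
  by rewrite e; apply: aux_refl.
suff ec : aux_eq D s = aux_eq D t.
  rewrite /aux_pi; move: (ex_intro _ s _) (ex_intro _ t _); rewrite ec => p q.
  by congr AuxAlg; apply: Prop_irrelevance.
apply/funext => u; apply/propext; split=> h; last exact: aux_trans e h.
exact: aux_trans (aux_sym e) h.
Qed.

Lemma aux_repr_pi t : aux_repr (aux_pi t) ~ t.
Proof. by apply/aux_piP; rewrite aux_reprK. Qed.

Definition lq_add x y := aux_pi (LAdd (aux_repr x) (aux_repr y)).
Definition lq_scl a x := aux_pi (LScale a (aux_repr x)).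
Definition lq_br x y := aux_pi (LBr (aux_repr x) (aux_repr y)).

Lemma aux_piD s t : aux_pi (LAdd s t) = lq_add (aux_pi s) (aux_pi t).
Proof. by apply/aux_piP/aux_add; apply: aux_sym; apply: aux_repr_pi. Qed.
Lemma aux_piZ a t : aux_pi (LScale a t) = lq_scl a (aux_pi t).
Proof. by apply/aux_piP/aux_scale; apply: aux_sym; apply: aux_repr_pi. Qed.
Lemma aux_piB s t : aux_pi (LBr s t) = lq_br (aux_pi s) (aux_pi t).
Proof. by apply/aux_piP/aux_br; apply: aux_sym; apply: aux_repr_pi. Qed.

Definition lq_opp x := lq_scl (-1) x.

Let add_A : associative lq_add.
Proof.
move=> x y z; rewrite -(aux_reprK x) -(aux_reprK y) -(aux_reprK z) -!aux_piD.
by apply/aux_piP; apply: aux_addA.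
Qed.
Let add_C : commutative lq_add.
Proof. by move=> x y; apply/aux_piP; apply: aux_addC. Qed.
Let add_0 : left_id (aux_pi LZero) lq_add.
Proof.
by move=> x; rewrite -(aux_reprK x) -aux_piD; apply/aux_piP; apply: aux_add0.
Qed.
Let add_N : left_inverse (aux_pi LZero) lq_opp lq_add.
Proof.
move=> x; rewrite /lq_opp -(aux_reprK x) -aux_piZ -aux_piD; apply/aux_piP.
apply: (@aux_trans _ _ _ _ _ (LScale (-1 + 1) (aux_repr x))).
  apply: aux_sym; apply: (aux_trans (aux_scaleDl _ _ _ _)).
  by apply: aux_add; [apply: aux_refl|apply: aux_scale1].
by rewrite addNr; apply: aux_scale0.
Qed.

HB.instance Definition _ := GRing.isZmodule.Build auxalg add_A add_C add_0 add_N.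

Let scl_A a b x : lq_scl a (lq_scl b x) = lq_scl (a * b) x.
Proof.
by rewrite -(aux_reprK x) -!aux_piZ; apply/aux_piP; apply: aux_scaleA.
Qed.
Let scl_1 : left_id 1 lq_scl.
Proof.
by move=> x; rewrite -(aux_reprK x) -!aux_piZ; apply/aux_piP; apply: aux_scale1.
Qed.
Let scl_Dr a x y : lq_scl a (lq_add x y) = lq_add (lq_scl a x) (lq_scl a y).
Proof.
rewrite -(aux_reprK x) -(aux_reprK y) -aux_piD -!aux_piZ -aux_piD.
by apply/aux_piP; apply: aux_scaleDr.
Qed.
Let scl_Dl v a b : lq_scl (a + b) v = lq_add (lq_scl a v) (lq_scl b v).
Proof.
rewrite -(aux_reprK v) -!aux_piZ -aux_piD.
by apply/aux_piP; apply: aux_scaleDl.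
Qed.
HB.instance Definition _ := GRing.Zmodule_isLmodule.Build F auxalg scl_A scl_1 scl_Dr scl_Dl.

Lemma aux_piDE s t : aux_pi (LAdd s t) = aux_pi s + aux_pi t.
Proof. exact: aux_piD. Qed.
Lemma aux_piZE a t : aux_pi (LScale a t) = a *: aux_pi t.
Proof. exact: aux_piZ. Qed.
Lemma aux_pi0 : aux_pi LZero = 0.
Proof. by []. Qed.

End AuxiliaryAlgebra.

(* The dual of Kac's representation of g~ on the tensor algebra: e_i evaluates a
   function of words at words starting with i, h acts at the word w by
   lambda - alpha_w, and f_i is then forced by [e_i, f_j].  At w, elements of n+
   (n-) only see words longer (shorter) than w, so n+ + n- meets h trivially. *)
Section WordRepresentation.
Variables (F : numFieldType) (n : nat) (A : 'M[F]_n) (D : realization A).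
Notation term := (lie_term F n (n + (n - \rank A))).
Notation d := (n + (n - \rank A))%N.
Notation fn := (seq 'I_n -> F).
Variable lam : 'rV[F]_d.

Definition alpha (i : 'I_n) (h : 'rV[F]_d) : F := (h *m (row i (simple_roots D))^T) 0 0.
Definition wordwt (w : seq 'I_n) (h : 'rV[F]_d) : F :=
  (h *m lam^T) 0 0 - \sum_(i <- w) alpha i h.

Fixpoint word_f (i : 'I_n) (w : seq 'I_n) (phi : fn) : F :=
  if w is j :: w' then
    word_f i w' (fun v => phi (j :: v))
    + (if i == j then wordwt w' (row i (simple_coroots D)) * phi w' else 0)
  else 0.

Fixpoint word_rep (t : term) (phi : fn) (w : seq 'I_n) : F :=
  match t with
  | LZero => 0
  | LE i => phi (i :: w)
  | LF i => word_f i w phi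
  | LH h => wordwt w h * phi w
  | LAdd s t => word_rep s phi w + word_rep t phi w
  | LScale a t => a * word_rep t phi w
  | LBr s t => word_rep s (word_rep t phi) w - word_rep t (word_rep s phi) w
  end.

Lemma word_fD i w phi psi :
  word_f i w (fun v => phi v + psi v) = word_f i w phi + word_f i w psi.
Proof.
elim: w phi psi => [|j w IH] phi psi /=; first by rewrite addr0.
by rewrite IH; case: eqP => _; [ring|rewrite !addr0].
Qed.

Lemma word_fZ i w a phi : word_f i w (fun v => a * phi v) = a * word_f i w phi.
Proof.
elim: w phi => [|j w IH] phi /=; first by rewrite mulr0.
by rewrite IH; case: eqP => _; [ring|rewrite !addr0].
Qed.

Lemma word_f0 i w phi : (forall v, (size v < size w)%N -> phi v = 0) -> word_f i w phi = 0.
Proof.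
elim: w phi => [|j w IH] phi //= h; rewrite IH => [|v vw]; last exact: h.
by rewrite h ?mulr0 ?if_same ?addr0.
Qed.

Lemma word_repD t phi psi w : word_rep t (fun v => phi v + psi v) w =
  word_rep t phi w + word_rep t psi w.
Proof.
elim: t phi psi w => [|i|i|h|s IHs t IHt|a t IH|s IHs t IHt] phi psi w /=.
- by rewrite addr0.
- by [].
- exact: word_fD.
- by rewrite mulrDr.
- by rewrite IHs IHt addrACA.
- by rewrite IH mulrDr.
- have -> : word_rep t (fun v => phi v + psi v) = fun v => word_rep t phi v + word_rep t psi v.
    by apply/funext => v; rewrite IHt.
  have -> : word_rep s (fun v => phi v + psi v) = fun v => word_rep s phi v + word_rep s psi v.
    by apply/funext => v; rewrite IHs.
  by rewrite IHs IHt opprD addrACA.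
Qed.

Lemma word_repZ t a phi w : word_rep t (fun v => a * phi v) w = a * word_rep t phi w.
Proof.
elim: t phi w => [|i|i|h|s IHs t IHt|b t IH|s IHs t IHt] phi w /=.
- by rewrite mulr0.
- by [].
- exact: word_fZ.
- by rewrite mulrCA.
- by rewrite IHs IHt mulrDr.
- by rewrite IH mulrCA.
- have -> : word_rep t (fun v => a * phi v) = fun v => a * word_rep t phi v.
    by apply/funext => v; rewrite IHt.
  have -> : word_rep s (fun v => a * phi v) = fun v => a * word_rep s phi v.
    by apply/funext => v; rewrite IHs.
  by rewrite IHs IHt mulrBr.
Qed.

Lemma word_repB t phi psi w : word_rep t (fun v => phi v - psi v) w =
  word_rep t phi w - word_rep t psi w.
Proof.
rewrite -mulN1r -word_repZ -word_repD; congr (word_rep t _ w).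
by apply/funext => v; rewrite mulN1r.
Qed.

Lemma wordwt_cons i w h : wordwt (i :: w) h = wordwt w h - alpha i h.
Proof. by rewrite /wordwt big_cons opprD addrA addrAC. Qed.

Lemma wordwtD w h h' : wordwt w (h + h') = wordwt w h + wordwt w h'.
Proof.
rewrite /wordwt mulmxDl mxE addrACA -opprD; congr (_ - _).
by rewrite -big_split; apply: eq_bigr => i _; rewrite /alpha mulmxDl mxE.
Qed.

Lemma wordwtZ w a h : wordwt w (a *: h) = a * wordwt w h.
Proof.
rewrite /wordwt -scalemxAl mxE mulrBr; congr (_ - _).
by rewrite mulr_sumr; apply: eq_bigr => i _; rewrite /alpha -scalemxAl mxE.
Qed.

Lemma word_fH i w phi h : wordwt w h * word_f i w phi - word_f i w (fun v => wordwt v h * phi v)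
  = - alpha i h * word_f i w phi.
Proof.
elim: w phi => [|j w IH] phi /=; first by rewrite !mulr0 subr0.
have -> : (fun v => wordwt (j :: v) h * phi (j :: v)) =
   (fun v => (fun v => wordwt v h * phi (j :: v)) v + (- alpha j h) * phi (j :: v)).
  by apply/funext => v; rewrite wordwt_cons mulrBl mulNr.
rewrite word_fD (word_fZ _ _ _ (fun v => phi (j :: v))).
move: (IH (fun v => phi (j :: v))) => /eqP; rewrite subr_eq => /eqP IH'.
have {IH'} -> : word_f i w (fun v => wordwt v h * phi (j :: v)) =
   (wordwt w h + alpha i h) * word_f i w (fun v => phi (j :: v)).
  by rewrite mulrDl IH'; ring.
by rewrite wordwt_cons; case: eqP => [->|_]; ring.
Qed.

Lemma word_rep_sound s t : aux_eq D s t -> word_rep s = word_rep t.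
Proof.
have E (u v : term) : (forall phi w, word_rep u phi w = word_rep v phi w) -> word_rep u = word_rep v.
  by move=> h; apply/funext => phi; apply/funext => w.
elim=> {s t}.
- by [].
- by [].
- by move=> x y z _ -> _ ->.
- by move=> x x' y y' _ IH _ IH'; apply: E => phi w /=; rewrite IH IH'.
- by move=> a x x' _ IH; apply: E => phi w /=; rewrite IH.
- by move=> x x' y y' _ IH _ IH'; apply: E => phi w /=; rewrite IH IH'.
- by move=> x y z; apply: E => phi w /=; rewrite addrA.
- by move=> x y; apply: E => phi w /=; rewrite addrC.
- by move=> x; apply: E => phi w /=; rewrite add0r.
- by move=> x; apply: E => phi w /=; rewrite mul0r.
- by move=> x; apply: E => phi w /=; rewrite mul1r.
- by move=> a b x; apply: E => phi w /=; rewrite mulrA.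
- by move=> a x y; apply: E => phi w /=; rewrite mulrDr.
- by move=> a b x; apply: E => phi w /=; rewrite mulrDl.
- by move=> x y z; apply: E => phi w /=; rewrite word_repD opprD addrACA.
- by move=> x y z; apply: E => phi w /=; rewrite word_repD opprD addrACA.
- by move=> a x y; apply: E => phi w /=; rewrite word_repZ mulrBr.
- by move=> a x y; apply: E => phi w /=; rewrite word_repZ mulrBr.
- by move=> x; apply: E => phi w /=; rewrite subrr.
- by move=> x y z; apply: E => phi w /=; rewrite !word_repB; ring.
- by move=> h h'; apply: E => phi w /=; rewrite wordwtD mulrDl.
- by move=> a h; apply: E => phi w /=; rewrite wordwtZ mulrA.
- move=> i j; apply: E => phi w /=; rewrite eq_sym addrAC subrr add0r.
  by case: eqP => [->|].
- by move=> h h'; apply: E => phi w /=; rewrite mulrCA subrr.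
- move=> h i; apply: E => phi w /=; rewrite wordwt_cons -/(alpha i h); ring.
- by move=> h i; apply: E => phi w /=; rewrite word_fH.
Qed.

End WordRepresentation.

(** * Separating h from n+ and n- *)

Section Quotient.
Variables (F : numFieldType) (n : nat) (A : 'M[F]_n) (D : realization A).
Notation term := (lie_term F n (n + (n - \rank A))).
Notation d := (n + (n - \rank A))%N.
Notation rep l x := (word_rep D l (@aux_repr F n A D x)).
Notation pi := (aux_pi D).

Lemma rep_pi l t : rep l (pi t) = word_rep D l t.
Proof. by apply: word_rep_sound; apply: aux_repr_pi. Qed.

Lemma repD l x y phi w : rep l (x + y) phi w = rep l x phi w + rep l y phi w.
Proof. by rewrite -{1}(aux_reprK x) -{1}(aux_reprK y) -aux_piDE rep_pi. Qed.

Lemma repZ l a x phi w : rep l (a *: x) phi w = a * rep l x phi w.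
Proof. by rewrite -{1}(aux_reprK x) -aux_piZE rep_pi. Qed.

Lemma repB l x y phi w : rep l (lq_br x y) phi w =
  rep l x (rep l y phi) w - rep l y (rep l x phi) w.
Proof. by rewrite rep_pi. Qed.

Definition qe i := pi (LE i).
Definition qf i := pi (LF i).
Definition qh h := pi (LH h).

Lemma npart_e_rep l x : npart (@lq_br _ _ _ D) qe x -> forall w phi,
  (forall v, (size w < size v)%N -> phi v = 0) -> rep l x phi w = 0.
Proof.
elim=> [|i|i y _ IH|y z _ IHy _ IHz|a y _ IH] w phi h.
- by rewrite rep_pi.
- by rewrite rep_pi /= h.
- rewrite repB rep_pi /= !IH ?subrr // => v vw; apply: h => /=.
    exact: ltnW.
  exact: ltnW.
- by rewrite repD IHy // IHz // addr0.
- by rewrite repZ IH // mulr0.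
Qed.

Lemma npart_f_rep l x : npart (@lq_br _ _ _ D) qf x -> forall w phi,
  (forall v, (size v < size w)%N -> phi v = 0) -> rep l x phi w = 0.
Proof.
elim=> [|i|i y _ IH|y z _ IHy _ IHz|a y _ IH] w phi h.
- by rewrite rep_pi.
- by rewrite rep_pi /= word_f0.
- rewrite repB rep_pi /= IH ?word_f0 ?subrr // => v vw; last first.
    by apply: word_f0 => u uv; apply/h/(ltn_trans uv).
  by apply: IH => u uv; apply/h/(ltn_trans uv).
- by rewrite repD IHy // IHz // addr0.
- by rewrite repZ IH // mulr0.
Qed.

Lemma qh_sep x y h : npart (@lq_br _ _ _ D) qe x -> npart (@lq_br _ _ _ D) qf y ->
  x + y = qh h -> h = 0.
Proof.
move=> nx ny xy; apply/rowP => j; rewrite mxE.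
(* Take lambda to be the j-th coordinate form and phi the indicator of the empty word. Evaluated at
   the empty word, n+ only sees longer words, where phi vanishes, n- acts by zero, and h acts by its
   j-th coordinate. *)
pose phi (v : seq 'I_n) : F := (v == [::])%:R.
have := repD (delta_mx 0 j) x y phi [::]; rewrite xy rep_pi /=.
rewrite (npart_e_rep _ nx) ?(npart_f_rep _ ny) //; last by move=> [].
rewrite addr0 /phi eqxx mulr1 /wordwt big_nil subr0 trmx_delta -colE mxE.
by [].
Qed.

End Quotient.

(** * Roots of g(A) read in g~(A) *)

Section KacMoodyRoots.
Variables (F : numFieldType) (n : nat) (A : 'M[int]_n).
Notation AF := (map_mx intr A : 'M[F]_n).
Notation D := (std_realization AF).
Notation d := (n + (n - \rank AF))%N.
Notation G := (auxalg D).
Notation pi := (aux_pi D).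
Notation rt := (simple_roots D).
Notation crt := (simple_coroots D).

Lemma aux_chevalley : chevalley rt crt (@lq_br _ _ _ D) (@qe _ _ _ D) (@qf _ _ _ D) (@qh _ _ _ D).
Proof.
have K := @aux_reprK _ _ _ D.
split.
- by move=> x y z; rewrite -(K x) -(K y) -(K z) -aux_piDE -!aux_piB -aux_piDE; apply/aux_piP; apply: aux_brDl.
- by move=> x y z; rewrite -(K x) -(K y) -(K z) -aux_piDE -!aux_piB -aux_piDE; apply/aux_piP; apply: aux_brDr.
- by move=> a x y; rewrite -(K x) -(K y) -aux_piZE -!aux_piB -aux_piZE; apply/aux_piP; apply: aux_brZl.
- by move=> a x y; rewrite -(K x) -(K y) -aux_piZE -!aux_piB -aux_piZE; apply/aux_piP; apply: aux_brZr.
- by move=> x; rewrite -(K x) -aux_piB -aux_pi0; apply/aux_piP; apply: aux_brxx.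
- by move=> x y z; rewrite -(K x) -(K y) -(K z) -!aux_piB -[X in _ + X]aux_piDE -aux_piDE -aux_pi0; apply/aux_piP; apply: aux_jacobi.
- by move=> h h'; rewrite /qh -aux_piDE; apply/aux_piP; apply: aux_HD.
- by move=> a h; rewrite /qh -aux_piZE; apply/aux_piP; apply: aux_HZ.
- move=> i j; rewrite -aux_piB -[LHS]/(pi _).
  transitivity (pi (if i == j then LH (row i crt) else LZero)); last by case: eqP.
  by apply/aux_piP; apply: aux_EF.
- by move=> h h'; rewrite -aux_piB -aux_pi0; apply/aux_piP; apply: aux_HH.
- by move=> h i; rewrite -aux_piB -aux_piZE wt_simple; apply/aux_piP; apply: aux_HE.
- by move=> h i; rewrite -aux_piB -aux_piZE wt_simple; apply/aux_piP; apply: aux_HF.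
- move=> P P0 Pe Pf Ph PD PZ PB x; rewrite -(K x); elim: (aux_repr x) => //.
  + by move=> s Ps t Pt; rewrite aux_piDE; apply: PD.
  + by move=> a t Pt; rewrite aux_piZE; apply: PZ.
  + by move=> s Ps t Pt; rewrite aux_piB; apply: PB.
- exact: qh_sep.
Qed.

Lemma max_idealE t : max_ideal D t <-> imax (@lq_br _ _ _ D) (@qh _ _ _ D) (pi t).
Proof.
have K := @aux_reprK _ _ _ D; have C := aux_chevalley.
split=> -[I [LI Ih It]].
  case: LI => Ieq I0 ID IZ IB.
  have Ipi s : I (aux_repr (pi s)) <-> I s.
    by split; apply: Ieq; [|apply: aux_sym]; apply: aux_repr_pi.
  exists (fun x => I (aux_repr x)); split; last exact/Ipi.
    split.
    - exact/Ipi.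
    - move=> x y Ix Iy; rewrite -(K x) -(K y) -aux_piDE; apply/Ipi; exact: ID.
    - move=> a x Ix; rewrite -(K x) -aux_piZE; apply/Ipi; exact: IZ.
    - move=> x y Iy; rewrite -(K x) -(K y) -aux_piB; apply/Ipi; exact: IB.
  by move=> h /Ipi/Ih/aux_piP h0; apply: (chevH_inj0 C).
exists (fun s => I (pi s)); split=> //.
  split.
  - by move=> x y /aux_piP ->.
  - exact: lid0 LI.
  - by move=> x y Ix Iy; rewrite aux_piDE; apply: (lidD LI).
  - by move=> a x Ix; rewrite aux_piZE; apply: (lidZ LI).
  - by move=> x y Iy; rewrite aux_piB; apply: (lidB LI).
move=> h /Ih ->; apply/aux_piP; exact: (chevH0 C).
Qed.

Lemma is_rootE b : is_root F A b <-> wroot rt (@lq_br _ _ _ D) (@qh _ _ _ D) b.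
Proof.
have C := aux_chevalley; have L := imax_ideal (simple_roots_free D) C.
have K := @aux_reprK _ _ _ D.
have km0 t : km_eq D t LZero <-> imax (@lq_br _ _ _ D) (@qh _ _ _ D) (pi t).
  rewrite /km_eq; split=> [/max_idealE|h]; last apply/max_idealE.
    by rewrite aux_piDE aux_piZE aux_pi0 scaler0 addr0.
  by rewrite aux_piDE aux_piZE aux_pi0 scaler0 addr0.
have b0 : (map_mx intr b *m rt != 0) = (b != 0).
  rewrite -(mul0mx _ rt) (inj_eq (row_free_inj (simple_roots_free D))).
  congr (~~ _); apply/eqP/eqP => [e|->]; last by rewrite map_mx0.
  apply/rowP => j; apply/eqP.
  by have /eqP := congr1 (fun v : 'rV[F]_n => v 0 j) e; rewrite !mxE intr_eq0.
have km h t : km_eq D (LBr (LH h) t) (LScale ((h *m (map_mx intr b *m rt)^T) 0 0) t) <->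
   imax (@lq_br _ _ _ D) (@qh _ _ _ D) (lq_br (qh D h) (pi t) - wt rt b h *: pi t).
  rewrite /km_eq; split=> [/max_idealE|e]; last apply/max_idealE.
    by rewrite aux_piDE !aux_piZE aux_piB scaleN1r.
  by rewrite aux_piDE !aux_piZE aux_piB scaleN1r.
rewrite /is_root /km_root /root_space b0; split=> -[bn0 [x [wx nx]]].
  split=> //; have [||y [hy ny]] := wroot_homog (simple_roots_free D) C (x := pi x) bn0.
  - by move=> /km0.
  - by move=> h; apply/km.
  by exists y; split=> // h; apply: (homog_wt C).
split=> //; exists (aux_repr x); split.
  by move=> h; apply/km; rewrite K wx subrr; apply: lid0 L.
by move=> /km0; rewrite K.
Qed.

Hypothesis GA : gcm A.

Let frt := simple_roots_free D.
Let crtE := realizationE D.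

Lemma is_root_simple i : is_root F A (simple_root i).
Proof. by apply/is_rootE; apply: (wroot_simple frt crtE GA aux_chevalley). Qed.

Lemma is_root_reflect i b : is_root F A b -> is_root F A (simple_refl A i b).
Proof. by move=> /is_rootE r; apply/is_rootE; apply: (wroot_reflect frt crtE GA i aux_chevalley). Qed.

Lemma is_root_coherent b : is_root F A b ->
  (forall i, 0 <= b 0 i) \/ (forall i, 0 <= - b 0 i).
Proof. by move=> /is_rootE /(wroot_pos frt aux_chevalley)[]. Qed.

Lemma is_root_multiple b i k : is_root F A b -> b = k *: simple_root i -> k = 1 \/ k = -1.
Proof. by move=> /is_rootE /(wroot_pos frt aux_chevalley)[_]; apply. Qed.

End KacMoodyRoots.

(** * Real roots and the Weyl group *)

Section WeylGroup.
Variables (n : nat) (X : 'M[int]_n).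
Implicit Types (x y z v : 'rV[int]_n) (k : int) (w : seq 'I_n).

Lemma simple_reflD i x y : simple_refl X i (x + y) = simple_refl X i x + simple_refl X i y.
Proof. by rewrite /simple_refl pairingDr scalerDl opprD addrACA. Qed.
Lemma simple_reflZ i k x : simple_refl X i (k *: x) = k *: simple_refl X i x.
Proof. by rewrite /simple_refl pairingZr scalerBr scalerA. Qed.

Lemma weyl_act_cons i w x : weyl_act X (i :: w) x = simple_refl X i (weyl_act X w x).
Proof. by []. Qed.
Lemma weyl_actD w x y : weyl_act X w (x + y) = weyl_act X w x + weyl_act X w y.
Proof. by elim: w => // i w IH; rewrite !weyl_act_cons IH simple_reflD. Qed.
Lemma weyl_actZ w k x : weyl_act X w (k *: x) = k *: weyl_act X w x.
Proof. by elim: w => // i w IH; rewrite !weyl_act_cons IH simple_reflZ. Qed.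
Lemma weyl_actN w x : weyl_act X w (- x) = - weyl_act X w x.
Proof. by rewrite -scaleN1r weyl_actZ scaleN1r. Qed.
Lemma weyl_act0 w : weyl_act X w 0 = 0.
Proof. by have := weyl_actZ w 0 0; rewrite !scale0r. Qed.
Lemma weyl_act_sum w (I : Type) (s : seq I) (P : pred I) (c : I -> 'rV[int]_n) :
  weyl_act X w (\sum_(i <- s | P i) c i) = \sum_(i <- s | P i) weyl_act X w (c i).
Proof. exact: (big_morph (weyl_act X w) (weyl_actD w) (weyl_act0 w)). Qed.

Lemma weyl_act_cat w w' x : weyl_act X (w ++ w') x = weyl_act X w (weyl_act X w' x).
Proof. by rewrite /weyl_act foldr_cat. Qed.
Lemma weyl_act_seq1 i x : weyl_act X [:: i] x = simple_refl X i x.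
Proof. by []. Qed.

Definition nneg (v : 'rV[int]_n) := forall i, 0 <= v 0 i.
Definition real v := exists w i, v = weyl_act X w (simple_root i).
Definition supported (J : pred 'I_n) v := forall i, ~~ J i -> v 0 i = 0.

Lemma nneg_simple i : nneg (simple_root i).
Proof. by move=> j; rewrite simple_rootE; case: eqP. Qed.
Lemma nneg_antisym x : nneg x -> nneg (- x) -> x = 0.
Proof.
move=> hx hy; apply/rowP => i; rewrite [RHS]mxE; apply/le_anti.
by have := hy i; rewrite mxE oppr_ge0 => ->; rewrite hx.
Qed.

Lemma supported0 J : supported J 0. Proof. by move=> i; rewrite mxE. Qed.
Lemma supportedD J x y : supported J x -> supported J y -> supported J (x + y).
Proof. by move=> hx hy i Ji; rewrite mxE hx // hy // addr0. Qed.
Lemma supportedZ J k x : supported J x -> supported J (k *: x).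
Proof. by move=> hx i Ji; rewrite mxE hx // mulr0. Qed.
Lemma supportedN J x : supported J x -> supported J (- x).
Proof. by move=> hx i Ji; rewrite mxE hx // oppr0. Qed.
Lemma supported_sum J (I : Type) (s : seq I) (P : pred I) (c : I -> 'rV[int]_n) :
  (forall i, P i -> supported J (c i)) -> supported J (\sum_(i <- s | P i) c i).
Proof.
by move=> h; apply: (big_ind (supported J)) => //; [apply: supported0|apply: supportedD].
Qed.
Lemma supported_simple (J : pred 'I_n) i : J i -> supported J (simple_root i).
Proof.
by move=> Ji j; rewrite simple_rootE; case: eqP => // ->; rewrite Ji.
Qed.
Lemma sub_supported (J J' : pred 'I_n) x : subpred J J' -> supported J x -> supported J' x.
Proof. by move=> JJ hx i Ji; apply: hx; apply: contra Ji; apply: JJ. Qed.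

Lemma simple_refl_coord i x j : simple_refl X i x 0 j =
  x 0 j - pairing X (simple_root i) x * (j == i)%:R.
Proof. by rewrite /simple_refl 2!mxE mxE simple_rootE. Qed.

Lemma supported_refl (J : pred 'I_n) i x : J i -> supported J x -> supported J (simple_refl X i x).
Proof.
by move=> Ji hx; apply/supportedD => //; apply/supportedN/supportedZ/supported_simple.
Qed.

Hypothesis SL : simply_laced X.

Lemma sl_diag i : X i i = 2. Proof. by case: SL => -[]. Qed.
Lemma sl_neg i j : i != j -> X i j <= 0. Proof. by case: SL => -[_ h _] _; apply: h. Qed.
Lemma sl_sym i j : X i j = X j i.
Proof. by case: SL => _ /matrixP/(_ i j); rewrite mxE. Qed.

Lemma pairingC x y : pairing X x y = pairing X y x.
Proof.
rewrite /pairing; transitivity ((x *m X *m y^T)^T 0 0); first by rewrite [RHS]mxE.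
by rewrite !trmx_mul trmxK (proj2 SL) mulmxA.
Qed.

Lemma simple_reflK i : involutive (simple_refl X i).
Proof.
move=> x; rewrite /simple_refl pairingBr pairingZr pairing_simple sl_diag.
rewrite -addrA -opprD -scalerDl [X in X *: _](_ : _ = 0) ?scale0r ?subr0 //; ring.
Qed.

Lemma simple_refl_iso i x y : pairing X (simple_refl X i x) (simple_refl X i y) = pairing X x y.
Proof.
rewrite /simple_refl !(pairingBr, pairingBl, pairingZr, pairingZl) pairing_simple sl_diag.
by rewrite [pairing X x (simple_root i)]pairingC; ring.
Qed.

Lemma weyl_act_iso w x y : pairing X (weyl_act X w x) (weyl_act X w y) = pairing X x y.
Proof. by elim: w => //= i w IH; rewrite !weyl_act_cons simple_refl_iso. Qed.

Lemma weyl_act_revK w x : weyl_act X (rev w) (weyl_act X w x) = x.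
Proof.
elim: w x => //= i w IH x; rewrite rev_cons -cats1 weyl_act_cat /= weyl_act_seq1.
by rewrite weyl_act_cons simple_reflK.
Qed.
Lemma weyl_act_Krev w x : weyl_act X w (weyl_act X (rev w) x) = x.
Proof. by rewrite -{1}(revK w) weyl_act_revK. Qed.

Lemma simple_refl_simple i : simple_refl X i (simple_root i) = - simple_root i.
Proof.
rewrite /simple_refl pairing_simple sl_diag -[X in X - _]scale1r -scalerBl.
by rewrite (_ : 1 - 2 = -1) ?scaleN1r //; ring.
Qed.

Lemma real_simple i : real (simple_root i). Proof. by exists [::], i. Qed.
Lemma real_weyl w x : real x -> real (weyl_act X w x).
Proof. by move=> [v [i ->]]; exists (w ++ v), i; rewrite weyl_act_cat. Qed.
Lemma real_refl i x : real x -> real (simple_refl X i x).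
Proof. exact: (@real_weyl [:: i]). Qed.
Lemma real_opp x : real x -> real (- x).
Proof.
move=> [w [i ->]]; exists (w ++ [:: i]), i.
by rewrite weyl_act_cat weyl_act_seq1 simple_refl_simple weyl_actN.
Qed.
Lemma real_norm x : real x -> pairing X x x = 2.
Proof. by move=> [w [i ->]]; rewrite weyl_act_iso pairing_simple sl_diag. Qed.
Lemma real_neq0 x : real x -> x != 0.
Proof. by move=> /real_norm; case: eqP => // ->; rewrite pairing0l. Qed.

(* The reflection in a real root is w s_i w^-1. *)
Lemma real_reflection b : real b -> exists w, forall x,
  weyl_act X w x = x - pairing X b x *: b.
Proof.
move=> [w [i ->]]; exists (w ++ i :: rev w) => x.
rewrite weyl_act_cat weyl_act_cons /simple_refl weyl_actD weyl_actN weyl_actZ.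
by rewrite weyl_act_Krev -[pairing X (simple_root i) _](weyl_act_iso w) weyl_act_Krev.
Qed.

Lemma norm_even x : exists k, pairing X x x = 2 * k.
Proof.
rewrite (row_simple x); apply: (big_ind (fun x => exists k, pairing X x x = 2 * k)).
- by exists 0; rewrite pairing0l.
- move=> y z [k yk] [l zl]; exists (k + l + pairing X y z).
  rewrite !(pairingDl, pairingDr) yk zl [pairing X z y]pairingC; ring.
- move=> i _; exists (x 0 i * x 0 i); rewrite pairingZl pairingZr pairing_simple sl_diag; ring.
Qed.

(** (x | x) is the sum of the x_i (alpha_i | x), so some term is positive. *)
Lemma norm_descent x : nneg x -> 0 < pairing X x x ->
  exists i, 0 < x 0 i /\ 0 < pairing X (simple_root i) x.
Proof.
move=> px Nx; apply: contrapT => nex.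
suff : pairing X x x <= 0 by rewrite leNgt Nx.
rewrite {1}pairing_coord; apply: sumr_le0 => i _.
have [->|xi] := eqVneq (x 0 i) 0; first by rewrite mul0r.
apply: mulr_ge0_le0 => //; rewrite leNgt; apply/negP => h; apply: nex; exists i.
by rewrite lt_def xi px.
Qed.

Lemma height_refl i x : height (simple_refl X i x) = height x - pairing X (simple_root i) x.
Proof.
rewrite /height (eq_bigr (fun j => x 0 j - pairing X (simple_root i) x * (j == i)%:R)); last first.
  by move=> j _; rewrite simple_refl_coord.
rewrite sumrB -mulr_sumr; congr (_ - _).
rewrite (bigD1 i) //= eqxx big1 ?addr0 ?mulr1 // => j /negPf.
by move=> ->.
Qed.

Lemma nneg_height x : nneg x -> 0 <= height x.
Proof. by move=> px; apply: sumr_ge0. Qed.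

(** s_i only changes the coordinate at i, so every other coordinate of x is both >= 0 and <= 0. *)
Lemma refl_flip i x : nneg x -> nneg (- simple_refl X i x) -> x = x 0 i *: simple_root i.
Proof.
move=> px nx; apply/rowP => j; rewrite mxE simple_rootE.
have [->|ji] := eqVneq j i; first by rewrite mulr1.
rewrite mulr0; apply/le_anti; rewrite px andbT.
by have := nx j; rewrite mxE simple_refl_coord (negPf ji) mulr0 subr0 oppr_ge0.
Qed.

(** * Roots of positive norm are real *)

Section IsRoot.
Variable F : numFieldType.
Let GA : gcm X := proj1 SL.

Lemma is_root_real x : real x -> is_root F X x.
Proof.
move=> [w [i ->]]; elim: w => [|j w IH]; first exact: is_root_simple.
by rewrite weyl_act_cons; apply: is_root_reflect.
Qed.

Let pm x := is_root F X x \/ is_root F X (- x).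

Lemma simple_reflN i x : simple_refl X i (- x) = - simple_refl X i x.
Proof. by rewrite -scaleN1r simple_reflZ scaleN1r. Qed.

(** Assuming only that x or -x is a root treats negative roots in the same descent. As long as the
    norm is positive, some simple reflection lowers the height; it keeps x non-negative unless x is
    a multiple of alpha_i, hence alpha_i itself. *)
Lemma pm_root_norm x : pm x -> nneg x -> real x \/ pairing X x x <= 0.
Proof.
move=> rx px; have := nneg_height px; case Eh : (height x) => [h|//] _.
elim/ltn_ind: h x rx px Eh => h IH x rx px Eh.
have [Nx|Nx] := leP (pairing X x x) 0; first by right.
have [i [xi pi]] := norm_descent px Nx.
have rs : pm (simple_refl X i x).
  by case: rx => rx; [left|right; rewrite -simple_reflN]; apply: is_root_reflect.
have [ps|ns] : nneg (simple_refl X i x) \/ nneg (- simple_refl X i x).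
  case: rs => /is_root_coherent[] c; [left|right|right|left] => j; have := c j;
  by rewrite ?mxE ?opprK.
  have := nneg_height ps; case Es : (height _) => [h'|//] _.
  have [] := IH h' _ (simple_refl X i x) rs ps Es.
  - by move: Es; rewrite height_refl Eh; lia.
  - by move=> /(real_refl i); rewrite simple_reflK; left.
  - by rewrite simple_refl_iso leNgt Nx.
left; have ex := refl_flip px ns.
have x1 : x 0 i = 1.
  have [//|] : x 0 i = 1 \/ x 0 i = -1.
    case: rx => rx; first exact: (is_root_multiple rx ex).
    have [|e|e] := is_root_multiple (i := i) (k := - x 0 i) rx.
    - by rewrite {1}ex scaleNr.
    - by right; apply: oppr_inj; rewrite opprK.
    - by left; apply: oppr_inj.
  by move=> e; rewrite e in xi.
by rewrite ex x1 scale1r; apply: real_simple.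
Qed.

Lemma is_root_norm x : is_root F X x -> real x \/ pairing X x x <= 0.
Proof.
move=> rx; have [px|nx] := is_root_coherent rx; first by apply: pm_root_norm; first left.
have [||rN|] := @pm_root_norm (- x).
- by right; rewrite opprK.
- by move=> i; rewrite mxE.
- by left; rewrite -[x]opprK; apply: real_opp.
- by rewrite pairingNl pairingNr opprK; right.
Qed.

Lemma real_rootE x : real_root F X x <-> real x.
Proof. by split=> [[]//|rx]; split=> //; apply: is_root_real. Qed.

Lemma imaginary_norm x : imaginary_root F X x -> pairing X x x <= 0.
Proof. by move=> [/is_root_norm[]// rx []]; apply/real_rootE. Qed.

(** The norm 2 + 2 - 2 (b | c) of a difference is at least 4, more than any root allows. *)
Lemma pi_system_sl (S : {fset 'rV[int]_n}) : (forall b, b \in S -> real b) ->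
  (forall b c, b \in S -> c \in S -> b != c -> pairing X b c <= 0) -> pi_system F X S.
Proof.
move=> rS gS; split=> [b /rS/real_rootE//|b c bS cS bc rbc].
have N : 4 <= pairing X (b - c) (b - c).
  rewrite !(pairingBl, pairingBr) [pairing X c b]pairingC !real_norm; auto.
  by have := gS b c bS cS bc; lia.
by case: (is_root_norm rbc) => [/real_norm e|]; move: N; rewrite ?e; lia.
Qed.

End IsRoot.

(** The statement does not mention a field, so the coherence of roots over the rationals can be
    used. *)
Lemma real_coherent x : real x -> nneg x \/ nneg (- x).
Proof.
move=> /(is_root_real rat) /is_root_coherent[] h; [left|right] => // i.
by rewrite mxE.
Qed.

(** The height descent only reflects at vertices where x is positive and never enlarges the support,
    so all letters stay in the support of x. *)
Lemma real_support x : real x -> nneg x ->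
  exists w i, [/\ x = weyl_act X w (simple_root i), x 0 i != 0 & all (fun j => x 0 j != 0) w].
Proof.
move=> rx px; have := nneg_height px; case Eh : (height x) => [h|//] _.
elim/ltn_ind: h x rx px Eh => h IH x rx px Eh.
have Nx := real_norm rx.
have [|i [xi pi]] := norm_descent px; first by rewrite Nx.
have rs := real_refl i rx.
have [ps|ns] := real_coherent rs.
  have := nneg_height ps; case Es : (height _) => [h'|//] _.
  have [|w [j [e ej ew]]] := IH h' _ (simple_refl X i x) rs ps Es.
    by move: Es; rewrite height_refl Eh; lia.
  have sub (k : 'I_n) : simple_refl X i x 0 k != 0 -> x 0 k != 0.
    rewrite simple_refl_coord; have [->|ki] := eqVneq k i; last by rewrite mulr0 subr0.
    by move=> _; rewrite gt_eqF.
  exists (i :: w), j; split; first by rewrite weyl_act_cons -e simple_reflK.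
    exact: sub.
  by rewrite /= gt_eqF //=; apply: sub_all ew.
exists [::], i; split=> //; last by rewrite gt_eqF.
have ex := refl_flip px ns; rewrite {1}ex.
move: Nx; rewrite ex pairingZl pairingZr pairing_simple sl_diag mxE simple_rootE eqxx mulr1 => N.
suff -> : x 0 i = 1 by rewrite scale1r.
have : x 0 i * x 0 i = 1 by lia.
by move: xi; nia.
Qed.

End WeylGroup.

(** * Semidefinite forms *)

Section WeightedForm.
Variables (R : realFieldType) (n : nat) (w : 'I_n -> 'I_n -> R) (y : 'I_n -> R).
Hypothesis wC : forall i j, w i j = w j i.

(** When the off-diagonal weights are <= 0 and the row sums are >= 0, the right-hand side is visibly
    >= 0, and it vanishes only if y is constant along edges. *)
Lemma weighted_form : \sum_i \sum_j w i j * (y i * y j) =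
  \sum_i (\sum_j w i j) * y i ^+ 2
   - 2^-1 * \sum_i \sum_j w i j * (y i - y j) ^+ 2.
Proof.
have E : \sum_i \sum_j w i j * (y i - y j) ^+ 2 =
    2 * (\sum_i (\sum_j w i j) * y i ^+ 2) - 2 * \sum_i \sum_j w i j * (y i * y j).
  transitivity (\sum_i \sum_j w i j * y i ^+ 2 + \sum_i \sum_j w i j * y j ^+ 2
     - 2 * \sum_i \sum_j w i j * (y i * y j)).
    rewrite mulr_sumr -big_split -sumrB; apply: eq_bigr => i _.
    rewrite mulr_sumr -big_split -sumrB; apply: eq_bigr => j _ /=; ring.
  congr (_ - _); rewrite mulrDl !mul1r; congr (_ + _).
    by apply: eq_bigr => i _; rewrite mulr_suml.
  rewrite exchange_big; apply: eq_bigr => i _; rewrite mulr_suml.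
  by apply: eq_bigr => j _; rewrite wC.
by rewrite E mulrBr !mulKf ?pnatr_eq0 // opprB addrC subrK.
Qed.

Hypotheses (wneg : forall i j, i != j -> w i j <= 0) (wrow : forall i, 0 <= \sum_j w i j).

Let T i j := w i j * (y i - y j) ^+ 2.
Let Tneg i j : T i j <= 0.
Proof.
have [->|ij] := eqVneq i j; first by rewrite /T subrr expr0n mulr0.
by rewrite /T mulr_le0_ge0 ?wneg ?sqr_ge0.
Qed.

Lemma weighted_form_ge0 : 0 <= \sum_i \sum_j w i j * (y i * y j).
Proof.
rewrite weighted_form subr_ge0; apply: (@le_trans _ _ 0).
  rewrite mulr_ge0_le0 ?invr_ge0 //.
  by apply: sumr_le0 => i _; apply: sumr_le0 => j _; apply: Tneg.
by apply: sumr_ge0 => i _; apply: mulr_ge0; rewrite ?sqr_ge0.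
Qed.

Lemma weighted_form_eq0 : \sum_i \sum_j w i j * (y i * y j) <= 0 ->
  forall i j, w i j != 0 -> y i = y j.
Proof.
rewrite weighted_form => le i j wij; apply/eqP; rewrite -subr_eq0 -sqrf_eq0.
have T0 : T i j = 0.
  apply/le_anti; rewrite Tneg -oppr_le0 /=.
  have s0 : 0 <= \sum_i (\sum_j w i j) * y i ^+ 2.
    by apply: sumr_ge0 => k _; apply: mulr_ge0; rewrite ?sqr_ge0.
  have : - \sum_i \sum_j T i j <= 0 by move: le s0; rewrite -/T; lra.
  apply: le_trans; rewrite (bigD1 i) //= (bigD1 j) //= !opprD -addrA lerDl.
  rewrite -opprD oppr_ge0; rewrite -[leRHS](addr0 0); apply: lerD; first by apply: sumr_le0.
  by apply: sumr_le0 => k _; apply: sumr_le0.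
by move/eqP: T0; rewrite mulf_eq0 (negPf wij).
Qed.

End WeightedForm.

(** * Exchange, stabilisers and vectors of norm 2 *)

Section RealRoots.
Variables (n : nat) (X : 'M[int]_n).
Hypothesis SL : simply_laced X.
Implicit Types (x y z v : 'rV[int]_n) (w : seq 'I_n).
Notation B := (pairing X).
Notation a := (@simple_root n).

Lemma real_reflect b x : real X b -> real X x -> real X (x - B b x *: b).
Proof. by move=> /(real_reflection SL)[w hw] rx; rewrite -hw; apply: real_weyl. Qed.

Lemma real_multiple x i (k : int) : real X x -> nneg x -> x = k *: a i -> x = a i.
Proof.
move=> /(real_norm SL) N px ex; have := px i; move: N; rewrite ex mxE simple_rootE eqxx.
rewrite pairingZl pairingZr pairing_simple (sl_diag SL) mulr1 => N k0.
suff -> : k = 1 by rewrite scale1r.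
by have : k * k = 1 by [lia]; nia.
Qed.

Lemma real_refl_nneg x i : real X x -> nneg x -> x <> a i -> nneg (simple_refl X i x).
Proof.
move=> rx px xi; have [//|nx] := real_coherent SL (real_refl i rx).
by case: xi; apply: (real_multiple rx px (refl_flip px nx)).
Qed.

(** The exchange condition: if u^-1 b is negative, the reflection s_b removes one letter from u. It
    is the letter at which the root, moved along the word, has become simple. *)
Lemma weyl_exchange (u : seq 'I_n) b : real X b -> nneg b -> nneg (- weyl_act X (rev u) b) ->
  exists u', size u = (size u').+1 /\
    forall x, weyl_act X u x - B b (weyl_act X u x) *: b = weyl_act X u' x.
Proof.
elim: u b => [|j u IH] b rb pb nb.
  by have := real_neq0 SL rb; rewrite (nneg_antisym pb nb) eqxx.
have [ebj|bj] := pselect (b = a j).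
  exists u; split=> // x; rewrite -/(simple_refl X j _) ebj weyl_act_cons.
  by rewrite -/(simple_refl X j (simple_refl X j _)) simple_reflK.
have [|u' [su eu]] := IH (simple_refl X j b) (real_refl j rb) (real_refl_nneg rb pb bj).
  by move: nb; rewrite rev_cons -cats1 weyl_act_cat weyl_act_seq1.
exists (j :: u'); split; first by rewrite /= su.
move=> x; rewrite !weyl_act_cons -eu simple_reflD simple_reflN simple_reflZ simple_reflK //.
by rewrite -[B (simple_refl X j b) _](simple_refl_iso SL j) simple_reflK.
Qed.

(* Humphreys 1.12: a minimal word stabilising v starts with a reflection fixing v. *)
Lemma weyl_stabilizer v w : (forall i, B (a i) v <= 0) -> weyl_act X w v = v ->
  exists w', all (fun i => B (a i) v == 0) w' /\ forall x, weyl_act X w x = weyl_act X w' x.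
Proof.
move=> dv; have [m] := ubnP (size w); elim: m w => // m IH [|i w] sw wv.
  by exists [::].
have rb : real X (weyl_act X (rev w) (a i)) by apply/real_weyl/real_simple.
have [pb|nb] := real_coherent SL rb; last first.
  (* Here w^-1 alpha_i is negative, so s_i w acts as w with a letter deleted, and the word gets
     shorter. *)
  have [|u [su eu]] := weyl_exchange (real_simple X i) (@nneg_simple n i) (u := w).
    by [].
  have eu' x : weyl_act X (i :: w) x = weyl_act X u x by rewrite -eu.
  have [||w' [aw ew]] := IH u.
  - by move: sw; rewrite /= su; lia.
  - by rewrite -eu'.
  by exists w'; split=> // x; rewrite eu' ew.
have vi : B (a i) v = 0.
  apply/le_anti; rewrite dv /=.
  (* As s_i w fixes v, w v = s_i v, so (w^-1 alpha_i | v) = (alpha_i | s_i v) = -(alpha_i | v). A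
     positive root pairs non-positively with the antidominant v. *)
  have -> : B (a i) v = - B (weyl_act X (rev w) (a i)) v.
    rewrite -[in RHS](weyl_act_iso SL w) weyl_act_Krev //.
    rewrite -(simple_reflK SL i (weyl_act X w v)) -weyl_act_cons wv.
    by rewrite /simple_refl pairingBr pairingZr pairing_simple (sl_diag SL); ring.
  rewrite oppr_ge0 pairing_coord; apply: sumr_le0 => k _.
  exact: mulr_ge0_le0 (pb k) (dv k).
have sv : simple_refl X i v = v by rewrite /simple_refl vi scale0r subr0.
have [||w' [aw ew]] := IH w.
- by move: sw; rewrite /=; lia.
- by rewrite -[LHS](simple_reflK SL i) -weyl_act_cons wv sv.
exists (i :: w'); rewrite /= vi eqxx aw; split=> // x.
by rewrite !weyl_act_cons ew.
Qed.

(** Write x = w alpha_i with all letters in its support. If T contains i, a letter outside T fixes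
    every vector supported in T and the support of x, because no edge joins the two parts; so the
    orbit never leaves T. *)
Lemma real_connected x (T : pred 'I_n) : real X x -> nneg x ->
  (forall i j, x 0 i != 0 -> x 0 j != 0 -> T i -> ~~ T j -> X i j = 0) ->
  supported T x \/ supported (predC T) x.
Proof.
move=> rx px hT; have [w [i [ex xi aw]]] := real_support SL rx px.
pose S (T' : pred 'I_n) k := T' k && (x 0 k != 0).
have main (T' : pred 'I_n) : T' i -> (forall i j, x 0 i != 0 -> x 0 j != 0 -> T' i -> ~~ T' j -> X i j = 0) ->
    supported T' x.
  move=> Ti hT'; suff : supported (S T') x by apply: sub_supported => k /andP[].
  rewrite {1}ex; elim: w aw {ex} => [|k w IH] /=.
    by move=> _; apply: supported_simple; rewrite /S Ti.
  move=> /andP[xk aw]; rewrite weyl_act_cons.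
  have [Tk|Tk] := boolP (T' k).
    by apply: supported_refl; [rewrite /S Tk|apply: IH].
  suff -> : simple_refl X k (weyl_act X w (a i)) = weyl_act X w (a i) by apply: IH.
  rewrite /simple_refl pairing_simple_coord big1 ?scale0r ?subr0 // => l _.
  have [/andP[Tl xl]|nS] := boolP (S T' l); last by rewrite (IH aw l nS) mulr0.
  by rewrite (sl_sym SL) hT' ?mul0r.
have [Ti|Ti] := boolP (T i); first by left; apply: main.
right; apply: main => // j k xj xk /= Tj; rewrite negbK => Tk.
by rewrite (sl_sym SL) hT.
Qed.

Definition posdef_on (J : pred 'I_n) := forall v, supported J v -> v != 0 -> 0 < B v v.

(* For J affine the form is positive away from the multiples of the null root,
   which have full support. *)
Definition almost_posdef (J : pred 'I_n) := forall v, supported J v -> v != 0 ->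
  (exists2 j, J j & v 0 j = 0) -> 0 < B v v.

Lemma pos_norm_ge2 v : 0 < B v v -> 2 <= B v v.
Proof. by have [k ->] := norm_even SL v; lia. Qed.

Definition vplus v : 'rV[int]_n := \row_i Num.max (v 0 i) 0.

Lemma vplus_coord v i : vplus v 0 i = Num.max (v 0 i) 0. Proof. by rewrite mxE. Qed.

Lemma vplusE v : v = vplus v - vplus (- v).
Proof. by apply/rowP => i; rewrite coordB !vplus_coord coordN; lia. Qed.

Lemma pairing_nneg_disjoint x y : nneg x -> nneg y -> (forall i, x 0 i = 0 \/ y 0 i = 0) ->
  B x y <= 0.
Proof.
move=> px py dxy; rewrite pairing_coord; apply: sumr_le0 => i _.
have [->|xi] := dxy i; first by rewrite mul0r.
apply: mulr_ge0_le0 => //; rewrite pairing_simple_coord; apply: sumr_le0 => j _.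
have [<-|ij] := eqVneq i j; first by rewrite xi mulr0.
exact: mulr_le0_ge0 (sl_neg SL ij) (py j).
Qed.

(** Split v into positive and negative parts of disjoint supports, which pair non-positively. If
    both are non-zero, each vanishes somewhere in J, hence has norm at least 2, and v has norm at
    least 4. *)
Lemma norm2_coherent J v : almost_posdef J -> supported J v -> B v v = 2 -> nneg v \/ nneg (- v).
Proof.
move=> pJ sv Nv.
have pp x : nneg (vplus x) by move=> i; rewrite vplus_coord; lia.
have sp x : supported J x -> supported J (vplus x).
  by move=> sx i Ji; rewrite vplus_coord sx // maxxx.
have np x : supported J x -> vplus x != 0 -> vplus (- x) != 0 -> 2 <= B (vplus x) (vplus x).
  move=> sx x0 y0; apply: pos_norm_ge2; apply: pJ => //; first exact: sp.
  case/rV0Pn: y0 => i; rewrite vplus_coord coordN => yi; exists i.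
    by apply: contraT => Ji; move: yi; rewrite sx // oppr0 maxxx eqxx.
  by move: yi; rewrite vplus_coord; lia.
have [p0|p0] := eqVneq (vplus v) 0.
  by right; rewrite (vplusE v) p0 sub0r opprK; apply: pp.
have [n0|n0] := eqVneq (vplus (- v)) 0.
  by left; rewrite (vplusE v) n0 subr0; apply: pp.
have := np v sv p0 n0; have := np (- v) (supportedN sv) n0; rewrite opprK => /(_ p0).
have : B (vplus v) (vplus (- v)) <= 0.
  apply: pairing_nneg_disjoint; try exact: pp.
  by move=> i; rewrite !vplus_coord coordN; lia.
move: Nv; rewrite {1 2}(vplusE v) !(pairingBl, pairingBr) [B (vplus (- v)) (vplus v)]pairingC //.
by lia.
Qed.

(** The height descent again, with [norm2_coherent] in place of the coherence of roots; thus vectors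
    of norm 2 are recognised as real roots without the Lie algebra. *)
Lemma norm2_real J v : almost_posdef J -> supported J v -> B v v = 2 ->
  exists w i, [/\ v = weyl_act X w (a i), J i & all J w].
Proof.
move=> pJ; have pos : forall v, nneg v -> supported J v -> B v v = 2 ->
    exists w i, [/\ v = weyl_act X w (a i), J i & all J w].
  move=> {}v pv; have := nneg_height pv; case Eh : (height v) => [h|//] _.
  elim/ltn_ind: h v pv Eh => h IH v pv Eh sv Nv.
  have [|i [vi pi]] := norm_descent (X := X) pv; first by rewrite Nv.
  have Ji : J i by apply: contraT => /sv vi0; move: vi; rewrite vi0.
  have ss : supported J (simple_refl X i v) by apply: supported_refl.
  have Ns : B (simple_refl X i v) (simple_refl X i v) = 2 by rewrite simple_refl_iso.
  have [ps|ns] := norm2_coherent pJ ss Ns.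
    have := nneg_height ps; case Es : (height _) => [h'|//] _.
    have [|w [j [e Jj aw]]] := IH h' _ _ ps Es ss Ns.
      by move: Es; rewrite height_refl Eh; lia.
    exists (i :: w), j; rewrite /= Ji; split=> //.
    by rewrite weyl_act_cons -e simple_reflK.
  exists [::], i; split=> //; have ex := refl_flip pv ns.
  move: Nv; rewrite {1 2}ex pairingZl pairingZr pairing_simple (sl_diag SL) => N.
  rewrite ex; suff -> : v 0 i = 1 by rewrite scale1r.
  by have : v 0 i * v 0 i = 1 by [lia]; nia.
move=> sv Nv; have [pv|nv] := norm2_coherent pJ sv Nv; first exact: pos.
have [||w [i [e Ji aw]]] := pos (- v) nv.
- exact: supportedN.
- by rewrite pairingNl pairingNr opprK.
exists (w ++ [:: i]), i; rewrite all_cat aw /= Ji; split=> //.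
by rewrite weyl_act_cat weyl_act_seq1 simple_refl_simple // weyl_actN -e opprK.
Qed.

(* Two vectors of norm 2 that are congruent mod 3 differ by 3z with
   9 (z|z) <= 8, and (z|z) is even. *)
Lemma norm2_mod3 J x y : posdef_on J -> supported J x -> supported J y ->
  B x x = 2 -> B y y = 2 -> (forall i, (x 0%R i = y 0%R i %[mod 3])%Z) -> x = y.
Proof.
move=> pJ sx sy Nx Ny xy.
pose z : 'rV[int]_n := \row_i ((x 0%R i - y 0%R i)%R %/ 3)%Z.
have ez : x - y = 3 *: z.
  apply/rowP => i; rewrite !mxE mulrC divzK //.
  by have /eqP := xy i; rewrite eqz_mod_dvd.
have sz : supported J z by move=> i Ji; rewrite mxE sx // sy // subrr div0z.
apply/eqP; rewrite -subr_eq0 ez; apply: contraT => nz.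
have z0 : z != 0 by apply: contraNneq nz => ->; rewrite scaler0.
have Nz := pos_norm_ge2 (pJ z sz z0).
have sD : supported J (x + y) by apply: supportedD.
have ND : 0 <= B (x + y) (x + y).
  by have [->|/(pJ _ sD)/ltW] := eqVneq (x + y) 0; rewrite ?pairing0l.
have : B (x - y) (x - y) = 9 * B z z by rewrite ez pairingZl pairingZr; lia.
move: ND; rewrite !(pairingBl, pairingBr, pairingDl, pairingDr) Nx Ny [B y x]pairingC //.
by lia.
Qed.

End RealRoots.

Section IntegerSums.
Variables (I : finType) (P : pred I) (f : I -> int).

Lemma sum_eq1 : (forall i, P i -> 0 <= f i) -> \sum_(i | P i) f i = 1 ->
  exists j, [/\ P j, f j = 1 & forall i, P i -> i != j -> f i = 0].
Proof.
move=> f0 S; have [j [Pj fj]] : exists j, P j /\ f j != 0.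
  apply: contrapT => nex; suff: \sum_(i | P i) f i = 0 by rewrite S.
  by apply: big1 => i Pi; apply/eqP; apply: contrapT => /negP fi; apply: nex; exists i.
have rest0 : 0 <= \sum_(i | P i && (i != j)) f i by apply: sumr_ge0 => i /andP[/f0].
move: S; rewrite (bigD1 j) //= => S; have fj0 := f0 j Pj.
have r0 : \sum_(i | P i && (i != j)) f i = 0.
  by move: S rest0 fj fj0; set r := \sum_(i | _) _; lia.
exists j; split=> //; first by rewrite r0 addr0 in S.
move=> i Pi ij; move/eqP: r0; rewrite psumr_eq0; last by move=> k /andP[/f0].
by move=> /allP/(_ i (mem_index_enum i)); rewrite Pi ij => /eqP.
Qed.

Lemma nneg_mul_eq1 (u s : int) : 0 <= u -> 0 <= s -> u * s = 1 -> u = 1 /\ s = 1.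
Proof.
case: u => // u; case: s => // s _ _ us.
have /eqP : (u * s = 1)%N by lia.
by rewrite muln_eq1 => /andP[/eqP-> /eqP->].
Qed.

End IntegerSums.

(** * Root lattices of subdiagrams *)

Section Embedding.
Variables (m n : nat) (f : 'I_m -> 'I_n) (A : 'M[int]_m) (X : 'M[int]_n).
Hypotheses (finj : injective f) (AX : forall i j, A i j = X (f i) (f j)).

Definition emb (x : 'rV[int]_m) : 'rV[int]_n := \sum_j x 0 j *: simple_root (f j).

Lemma emb_coord x j : emb x 0 (f j) = x 0 j.
Proof.
rewrite /emb summxE (bigD1 j) //= coordZ simple_rootE eqxx mulr1 big1 ?addr0 // => i ij.
by rewrite coordZ simple_rootE (inj_eq finj) eq_sym (negPf ij) mulr0.
Qed.

Lemma emb_coord0 x i : (forall j, i != f j) -> emb x 0 i = 0.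
Proof.
move=> h; rewrite /emb summxE big1 // => j _.
by rewrite coordZ simple_rootE (negPf (h j)) mulr0.
Qed.

Lemma embD x y : emb (x + y) = emb x + emb y.
Proof. by rewrite -big_split; apply: eq_bigr => j _; rewrite coordD scalerDl. Qed.
Lemma embZ k x : emb (k *: x) = k *: emb x.
Proof. by rewrite scaler_sumr; apply: eq_bigr => j _; rewrite coordZ scalerA. Qed.
Lemma embN x : emb (- x) = - emb x.
Proof. by rewrite -scaleN1r embZ scaleN1r. Qed.
Lemma emb0 : emb 0 = 0.
Proof. by have := embZ 0 0; rewrite !scale0r. Qed.
Lemma emb_sum (I : Type) (s : seq I) (P : pred I) (c : I -> 'rV[int]_m) :
  emb (\sum_(i <- s | P i) c i) = \sum_(i <- s | P i) emb (c i).
Proof. exact: (big_morph emb embD emb0). Qed.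

Lemma emb_simple j : emb (simple_root j) = simple_root (f j).
Proof.
rewrite /emb (bigD1 j) //= simple_rootE eqxx scale1r big1 ?addr0 // => i ij.
by rewrite simple_rootE (negPf ij) scale0r.
Qed.

Lemma emb_inj : injective emb.
Proof. by move=> x y e; apply/rowP => j; rewrite -!emb_coord e. Qed.

Lemma pairing_emb x y : pairing X (emb x) (emb y) = pairing A x y.
Proof.
rewrite /emb pairing_suml [RHS]pairing_coord; apply: eq_bigr => i _.
rewrite pairingZl pairing_sumr pairing_simple_coord; congr (_ * _).
by apply: eq_bigr => j _; rewrite pairingZr pairing_simple AX mulrC.
Qed.

Lemma weyl_act_emb w x : weyl_act X (map f w) (emb x) = emb (weyl_act A w x).
Proof.
elim: w => // i w IH; rewrite /= !weyl_act_cons IH /simple_refl.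
by rewrite embD embN embZ -emb_simple pairing_emb.
Qed.

Lemma embK (x : 'rV[int]_n) : (forall i, (forall j, i != f j) -> x 0 i = 0) ->
  x = emb (\row_j x 0 (f j)).
Proof.
move=> h; apply/rowP => i; have [[j ->]|nj] := pselect (exists j, i = f j).
  by rewrite emb_coord mxE.
have nj' j : i != f j by apply/eqP => e; apply: nj; exists j.
by rewrite emb_coord0 // h.
Qed.

Lemma emb_simply_laced : simply_laced X -> simply_laced A.
Proof.
move=> SL; split; first split.
- by move=> i; rewrite AX sl_diag.
- by move=> i j ij; rewrite AX sl_neg // (inj_eq finj).
- by move=> i j; rewrite !AX sl_sym.
by apply/matrixP => i j; rewrite mxE !AX sl_sym.
Qed.

Lemma real_emb x : real A x -> real X (emb x).
Proof. by move=> [w [i ->]]; exists (map f w), (f i); rewrite -emb_simple weyl_act_emb. Qed.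

End Embedding.

(** * Null vectors and overextensions *)

Section NullVector.
Variables (n : nat) (X : 'M[int]_n).
Hypothesis SL : simply_laced X.
Notation B := (pairing X).
Implicit Types x y v : 'rV[int]_n.
Notation a := (@simple_root n).

Lemma pairing_double_sum x y : B x y = \sum_i \sum_j X i j * (x 0 i * y 0 j).
Proof.
rewrite pairing_coord; apply: eq_bigr => i _; rewrite pairing_simple_coord mulr_sumr.
by apply: eq_bigr => j _; ring.
Qed.

Section Rescaled.
Variables (R : realFieldType) (u : 'I_n -> R).
Hypotheses (u0 : forall i, 0 <= u i) (Xu : forall i, 0 <= u i * \sum_j (X i j)%:~R * u j).
(** Rescaling by u turns X u >= 0 on the support of u into non-negative row sums. With y = v / u the
    weighted form of y is (v | v); where u vanishes so does v, and the division returns 0. *)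
Let w i j : R := (X i j)%:~R * (u i * u j).
Variable v : 'rV[int]_n.
Hypothesis vu : forall i, u i = 0 -> v 0 i = 0.
Let y i : R := (v 0 i)%:~R / u i.

Let wC i j : w i j = w j i. Proof. by rewrite /w (sl_sym SL) [u i * _]mulrC. Qed.
Let wneg i j : i != j -> w i j <= 0.
Proof.
by move=> ij; rewrite mulr_le0_ge0 ?mulr_ge0 // lerz0 sl_neg.
Qed.
Let wrow i : 0 <= \sum_j w i j.
Proof.
suff -> : \sum_j w i j = u i * \sum_j (X i j)%:~R * u j by [].
by rewrite mulr_sumr; apply: eq_bigr => j _; rewrite /w; ring.
Qed.
Let uy i : u i * y i = (v 0 i)%:~R.
Proof.
have [ui|ui] := eqVneq (u i) 0; first by rewrite ui mul0r vu.
by rewrite /y mulrC divfK.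
Qed.
Let Bw : (B v v)%:~R = \sum_i \sum_j w i j * (y i * y j).
Proof.
rewrite pairing_double_sum rmorph_sum; apply: eq_bigr => i _.
rewrite rmorph_sum; apply: eq_bigr => j _.
by rewrite /w 2!rmorphM /= -!uy; ring.
Qed.

Lemma rescaled_ge0 : 0 <= B v v.
Proof. by rewrite -(ler0z R) Bw; apply: weighted_form_ge0. Qed.

Lemma rescaled_eq0 : B v v <= 0 -> forall i j, X i j != 0 -> u i != 0 -> u j != 0 ->
  (v 0 i)%:~R / u i = (v 0 j)%:~R / u j.
Proof.
rewrite -(lerz0 R) Bw => le i j Xij ui uj.
apply: (weighted_form_eq0 wC wneg wrow le).
by rewrite !mulf_neq0 // intr_eq0.
Qed.

End Rescaled.

Section IntegralNullVector.
Variable d : 'rV[int]_n.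
Hypotheses (d0 : nneg d) (dk : forall i, d 0 i != 0 -> B (a i) d = 0).
Variable v : 'rV[int]_n.
Hypothesis sv : supported (fun i => d 0 i != 0) v.

Let Xu i : 0 <= (d 0 i)%:~R * \sum_j (X i j)%:~R * (d 0 j)%:~R :> rat.
Proof.
have [->|/dk] := eqVneq (d 0 i) 0; first by rewrite mul0r.
rewrite pairing_simple_coord => di; suff -> : \sum_j (X i j)%:~R * (d 0 j)%:~R = 0 :> rat.
  by rewrite mulr0.
transitivity ((\sum_j X i j * d 0 j)%:~R : rat); last by rewrite di.
by rewrite rmorph_sum; apply: eq_bigr => j _; rewrite rmorphM.
Qed.

Let vu i : (d 0 i)%:~R = 0 :> rat -> v 0 i = 0.
Proof. by move=> /eqP; rewrite intr_eq0 => di; apply: sv; rewrite di. Qed.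

Let du i : 0 <= (d 0 i)%:~R :> rat. Proof. by rewrite ler0z. Qed.

Lemma null_form_ge0 : 0 <= B v v.
Proof. exact: (rescaled_ge0 du Xu vu). Qed.

Lemma null_form_eq0 : B v v <= 0 -> forall i j, X i j != 0 -> d 0 i != 0 -> d 0 j != 0 ->
  v 0 i * d 0 j = v 0 j * d 0 i.
Proof.
move=> le i j Xij di dj; have := rescaled_eq0 du Xu vu le Xij.
rewrite !intr_eq0 => /(_ di dj) /eqP; rewrite eqr_div ?intr_eq0 //.
by rewrite -!intrM eqr_int => /eqP.
Qed.

End IntegralNullVector.

Lemma indecomposable_closed : indecomposable X -> forall T : pred 'I_n,
  (exists i, T i) -> (forall i j, T i -> X i j != 0 -> T j) -> forall i, T i.
Proof.
move=> [_ ind] T [i0 Ti0] cl i; apply: contrapT => Ti; apply: ind.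
exists [set j | T j]%SET; split.
- by apply/finset.set0Pn; exists i0; rewrite inE.
- by apply/eqP => /setP/(_ i); rewrite !inE => /idP.
move=> j k; rewrite !inE => Tj Tk; have X0 : X j k = 0.
  by apply/eqP; apply: contraNT Tk; apply: cl.
by rewrite (sl_sym SL k) X0.
Qed.

(** An imaginary root is only known to have norm <= 0. The equality case of the weighted form, taken
    with the positive real vector u killed by X, makes d_i / u_i constant along edges, so d is a
    positive multiple of u. *)
Lemma affine_null (R : realType) (d : 'rV[int]_n) : affine_type R X -> positive d -> B d d <= 0 ->
  (forall i, 0 < d 0 i) /\ forall i, B (a i) d = 0.
Proof.
move=> [_ ind _ [u [u0 Xu]] _] [d0 dn] Nd.
have u0' i : 0 <= u i 0 by apply: ltW.
have row i : \sum_j (X i j)%:~R * u j 0 = 0.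
  have /matrixP/(_ i 0) := Xu; rewrite !mxE => {2}<-.
  by apply: eq_bigr => j _; rewrite mxE.
have Xu' i : 0 <= u i 0 * \sum_j (X i j)%:~R * u j 0 by rewrite row mulr0.
have vu i : u i 0 = 0 -> d 0 i = 0 by move=> e; have := u0 i; rewrite e ltxx.
have un i : u i 0 != 0 by rewrite gt_eqF //; apply: u0.
have prop := rescaled_eq0 u0' Xu' vu Nd.
case/rV0Pn: d0 => i0 di0.
pose c : R := (d 0 i0)%:~R / u i0 0.
have c0 : 0 < c by rewrite divr_gt0 // ltr0z lt_def di0 dn.
have dc i : (d 0 i)%:~R = c * u i 0.
  suff : (d 0 i)%:~R / u i 0 == c by move=> /eqP <-; rewrite divfK // gt_eqF.
  move: i; apply: (indecomposable_closed ind) => [|i j /eqP ei Xij].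
    by exists i0; rewrite eqxx.
  by rewrite -(prop i j Xij) ?un // ei eqxx.
split=> i; first by rewrite -(ltr0z R) dc mulr_gt0.
apply/eqP; rewrite pairing_simple_coord -(intr_eq0 R) rmorph_sum.
rewrite (eq_bigr (fun j => c * ((X i j)%:~R * u j 0))); last first.
  by move=> j _; rewrite rmorphM /= dc mulrCA.
by rewrite -mulr_sumr row mulr0.
Qed.

(* X is an overextension of X \ p with null root d; the last clause says that
   X \ p is connected. *)
Record ext_datum (p : 'I_n) (d : 'rV[int]_n) : Prop := {
  ext_p : d 0 p = 0;
  ext_pos : forall i, i != p -> 0 < d 0 i;
  ext_pair : forall i, B (a i) d = - (i == p)%:R;
  ext_conn : forall T : pred 'I_n, (exists2 i, i != p & T i) ->
    (forall i j, i != p -> j != p -> T i -> X i j != 0 -> T j) ->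
    forall i, i != p -> T i }.

Section ExtDatum.
Variables (p : 'I_n) (d : 'rV[int]_n).
Hypothesis ed : ext_datum p d.

Lemma ext_nneg : nneg d.
Proof.
move=> i; have [->|ip] := eqVneq i p; first by rewrite (ext_p ed).
exact/ltW/(ext_pos ed).
Qed.

Lemma ext_pair0 i : i != p -> B (a i) d = 0.
Proof. by move=> ip; rewrite (ext_pair ed) (negPf ip) oppr0. Qed.

Lemma ext_neq0 i : (d 0 i != 0) = (i != p).
Proof.
have [->|ip] := eqVneq i p; first by rewrite (ext_p ed) eqxx.
by rewrite gt_eqF // (ext_pos ed).
Qed.

Lemma pairing_ext x : B x d = - x 0 p.
Proof.
rewrite pairing_coord (bigD1 p) //= (ext_pair ed) eqxx big1 ?addr0.
  by rewrite mulrN mulr1.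
by move=> i ip; rewrite ext_pair0 // mulr0.
Qed.

Lemma ext_norm : B d d = 0.
Proof. by rewrite pairing_ext (ext_p ed) oppr0. Qed.

(** (alpha_p | d) = -1 is a sum of non-positive integers d_i X_ip, so exactly one of them is
    non-zero, and it is the product of d_q >= 1 and X_qp <= -1. *)
Lemma ext_neighbour : exists q, [/\ q != p, d 0 q = 1, X q p = -1 &
  forall i, i != p -> i != q -> X i p = 0].
Proof.
have S : \sum_(i | i != p) - (d 0 i * X i p) = 1.
  rewrite sumrN; apply/eqP; rewrite eqr_oppLR; apply/eqP.
  transitivity (B (a p) d); last by rewrite (ext_pair ed) eqxx.
  rewrite pairing_simple_coord [RHS](bigD1 p) //= (ext_p ed) mulr0 add0r.
  by apply: eq_bigr => i _; rewrite (sl_sym SL) mulrC.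
have [i ip|q [qp fq hq]] := sum_eq1 _ S.
  by rewrite oppr_ge0 mulr_ge0_le0 ?(sl_neg SL) ?ext_nneg.
have dq := ext_pos ed qp; have Xq := sl_neg SL qp.
have X1 : X q p <= -1.
  have [X0|X0] := eqVneq (X q p) 0; last by lia.
  by move: fq; rewrite X0 mulr0.
have dq1 : d 0 q = 1 by apply/le_anti/andP; split; nia.
exists q; split=> //; first by move: fq; rewrite dq1; lia.
move=> i ip iq; have /eqP := hq i ip iq.
by rewrite oppr_eq0 mulf_eq0 => /orP[|/eqP//]; rewrite gt_eqF // (ext_pos ed).
Qed.

Lemma ext_form_ge0 v : v 0 p = 0 -> 0 <= B v v.
Proof.
move=> vp; apply: (null_form_ge0 ext_nneg (d := d)).
  by move=> i; rewrite ext_neq0; apply: ext_pair0.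
by move=> i; rewrite ext_neq0 negbK => /eqP ->.
Qed.

(** v is proportional to d along the connected diagram without p, and d_q = 1 makes the factor the
    integer v_q. *)
Lemma ext_form_eq0 q v : d 0 q = 1 -> v 0 p = 0 -> B v v <= 0 -> v = v 0 q *: d.
Proof.
move=> dq vp N.
have q_p : q != p by rewrite -ext_neq0 dq.
have dk i : d 0 i != 0 -> B (a i) d = 0 by rewrite ext_neq0; apply: ext_pair0.
have sv : supported (fun i => d 0 i != 0) v.
  by move=> i; rewrite ext_neq0 negbK => /eqP ->.
have prop := null_form_eq0 ext_nneg dk sv N.
have T i : i != p -> v 0 i == v 0 q * d 0 i.
  move: i; apply: (ext_conn ed).
    by exists q => //; rewrite dq mulr1.
  move=> i j ip jp /eqP vi Xij.
  have := prop i j Xij; rewrite !ext_neq0 => /(_ ip jp); rewrite vi => e.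
  have di : d 0 i != 0 by rewrite ext_neq0.
  by apply/eqP/(mulIf di); rewrite -e; ring.
apply/rowP => i; rewrite coordZ; have [->|ip] := eqVneq i p.
  by rewrite vp (ext_p ed) mulr0.
exact/eqP/T.
Qed.

Lemma ext_almost_posdef : almost_posdef X (fun i => i != p).
Proof.
move=> v sv v0 [j jp vj]; have vp : v 0 p = 0 by apply: sv; rewrite eqxx.
rewrite lt_def ext_form_ge0 // andbT; apply: contraNneq v0 => N.
have [q [_ dq _ _]] := ext_neighbour.
have ev : v = v 0 q *: d by apply: ext_form_eq0; rewrite ?N.
suff vq : v 0 q = 0 by rewrite ev vq scale0r.
move: vj; rewrite {1}ev coordZ => /eqP; rewrite mulf_eq0 => /orP[/eqP//|].
by rewrite gt_eqF // (ext_pos ed).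
Qed.

Lemma ext_posdef (j : 'I_n) : j != p -> posdef_on X (fun i => (i != p) && (i != j)).
Proof.
move=> jp v sv v0; apply: ext_almost_posdef => //.
  by apply: sub_supported sv => i /andP[].
by exists j => //; apply: sv; rewrite eqxx andbF.
Qed.

End ExtDatum.
End NullVector.

(** * Uniqueness of the overextending vertex *)

Section ExtVertex.

Lemma ext_vertex_datum (R : realType) n (Z : 'M[int]_n) (p : 'I_n) :
  simply_laced Z -> ext_vertex R Z p -> exists d, ext_datum Z p d.
Proof.
move=> SL [affY [d [[imd posd _] dp]]].
have AX i j : del_vertex Z p i j = Z (lift p i) (lift p j) by rewrite !mxE.
have SY := emb_simply_laced (@lift_inj _ p) AX SL.
have Nd := imaginary_norm SY imd.
have [d0 dk] := affine_null SY affY posd Nd.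
have liftP i : i != p -> exists j, i = lift p j.
  by rewrite eq_sym => /unlift_some[j ->]; exists j.
exists (emb (lift p) d); split.
- by apply: emb_coord0 => j; apply: neq_lift.
- by move=> i /liftP[j ->]; rewrite emb_coord //; apply: lift_inj.
- move=> i; have [->|ip] := eqVneq i p.
    by rewrite pairingC // -[emb _ _]/(extend_root p d) dp.
  have [j ->] := liftP i ip.
  by rewrite -(@emb_simple _ _ (lift p)) (pairing_emb AX) dk oppr0.
- move=> T [i ip Ti] cl k kp.
  have [j ij] := liftP i ip; have [l ->] := liftP k kp.
  case: affY => _ ind _ _ _.
  apply: (indecomposable_closed SY ind (T := fun j => T (lift p j))).
    by exists j; rewrite -ij.
  move=> i1 j1 T1; rewrite AX => X1.
  by apply: cl X1; rewrite // eq_sym neq_lift.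
Qed.

End ExtVertex.

Section IntegerBounds.
Variables (x y : int) (b : bool).
Hypotheses (x0 : x <= 0) (y0 : y <= 0).

(** In these bounds x and y stand for off-diagonal entries: the factor 2 is the coefficient of a
    vertex on the path joining two branch vertices, and an indicator is the contribution of one end
    of the path to the coefficient of a vertex off it. *)
Lemma edge_le_double : - x <= - x * 2. Proof. by lia. Qed.
Lemma edge_le_indicl : - x <= - x * ((x != 0)%:R + b%:R).
Proof. by case: eqVneq => [->|_]; [lia|case: b; lia]. Qed.
Lemma edge_le_indicr : - x <= - x * (b%:R + (x != 0)%:R).
Proof. by rewrite addrC edge_le_indicl. Qed.
Lemma edge_indic_le : 2 * ((x != 0)%:R + (y != 0)%:R) <= - x * 2 + - y * 2.
Proof. by case: eqVneq => [->|]; case: eqVneq => [->|]; lia. Qed.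
Lemma two_edges : x != 0 -> y != 0 -> 2 * 2 <= - x * 2 + - y * 2.
Proof. by lia. Qed.

End IntegerBounds.

(** * Branch vertices of positive definite diagrams *)

Section BranchVertices.
Variables (n : nat) (X : 'M[int]_n) (M : pred 'I_n).
Hypotheses (SL : simply_laced X) (pM : posdef_on X M).
Hypothesis cM : forall T : pred 'I_n, (exists2 i, M i & T i) ->
    (forall i j, M i -> M j -> T i -> X i j != 0 -> T j) -> forall i, M i -> T i.
Notation B := (pairing X).

Definition valency v : int := \sum_(j | M j && (j != v)) - X v j.

(* Otherwise M contains a diagram of type D_n^(1): the vector with entries 2 on a
   path joining the two vertices and 1 on their other neighbours has norm <= 0. *)
Lemma branch_vertex_unique v v' : M v -> M v' -> 3 <= valency v -> 3 <= valency v' -> v = v'.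
Proof.
move=> Mv Mv' dv dv'; apply/eqP/contraT => vv'.
pose e i j := [&& M i, M j, i != j & X i j != 0].
(* A path without repetition, so that [index] locates the two path neighbours of an inner vertex. *)
have [s es [ls us]] : exists2 s, path e v s & v' = last v s /\ uniq (v :: s).
  have : connect e v v'.
    apply: (cM (T := connect e v)) Mv' => [|i j Mi Mj ci Xij].
      by exists v => //; apply: connect0.
    have [<-//|ij] := eqVneq i j.
    by apply: connect_trans ci (connect1 _); rewrite /e Mi Mj ij.
  by move=> /connectP[s es ->]; case/shortenP: es => s' es' us' _; exists s'.
set t := v :: s.
have Mt i : i \in t -> M i.
  rewrite inE => /orP[/eqP->//|si].
  have : path (fun _ j => M j) v s by apply: sub_path es => k j /and4P[].
  elim: (s) si (v) => //= j s' IH; rewrite inE => /orP[/eqP->|/IH IH'] u /andP[Mj ps] //.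
  exact: IH' ps.
have v't : v' \in t by rewrite ls mem_last.
have vt : v \in t by rewrite inE eqxx.
have nextP i : i \in t -> i != v' -> exists j, [/\ j \in t, e i j & index j t = (index i t).+1].
  move=> it iv'; have lt : (index i t < size t)%N by rewrite index_mem.
  have il : (index i t < size s)%N.
    rewrite ltn_neqAle -ltnS lt andbT; apply: contra iv' => /eqP ei.
    by rewrite ls (last_nth v) -/t -ei nth_index.
  exists (nth v t (index i t).+1); split; first by rewrite mem_nth.
    by have /pathP-/(_ v _ il) := es; rewrite -/t nth_index.
  by rewrite index_uniq.
have prevP i : i \in t -> i != v -> exists j, [/\ j \in t, e j i & index i t = (index j t).+1].
  move=> it iv; have : index i t != 0%N by rewrite /= [v == i]eq_sym (negPf iv).
  rewrite -lt0n => i0; have lt : (index i t < size t)%N by rewrite index_mem.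
  have il : ((index i t).-1 < size s)%N by rewrite -ltnS prednK.
  exists (nth v t (index i t).-1); split; first by rewrite mem_nth // ltnW.
    have /pathP-/(_ v _ il) := es; rewrite -/t.
    by rewrite -[nth v s _]/(nth v t (index i t).-1.+1) prednK // nth_index.
  have il' : ((index i t).-1 < size t)%N by apply: ltnW.
  by rewrite (index_uniq v il' us) prednK.
(* A vertex off the path attached to both ends receives 1 from each of them. *)
have [c cE] : exists c : 'rV[int]_n, forall i, c 0 i =
    if i \in t then 2 else if M i then (X v i != 0)%:R + (X v' i != 0)%:R else 0.
  by eexists (\row_i _) => i; rewrite mxE.
have c0 i : 0 <= c 0 i by rewrite cE; case: ifP => // _; case: ifP => // _; rewrite addr_ge0.
have sc : supported M c.
  by move=> i Mi; rewrite cE (negPf Mi); case: ifP => // /Mt; rewrite (negPf Mi).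
have BE i : B (simple_root i) c = 2 * c 0 i - \sum_(j | j != i) - X i j * c 0 j.
  rewrite pairing_simple_coord (bigD1 i) //= (sl_diag SL) -sumrN; congr (_ + _).
  by apply: eq_bigr => j _; rewrite mulNr opprK.
have tge i j : i != j -> 0 <= - X i j * c 0 j.
  by move=> ij; rewrite mulr_ge0 // oppr_ge0 sl_neg.
have two i j k : i != j -> i != k -> j != k -> 2 * c 0 i <= - X i j * c 0 j + - X i k * c 0 k ->
    B (simple_root i) c <= 0.
  move=> ij ik jk h; rewrite BE (bigD1 j) 1?eq_sym //= (bigD1 k) /=; last by rewrite ![k == _]eq_sym ik.
  have : 0 <= \sum_(l | (l != i) && (l != j) && (l != k)) - X i l * c 0 l.
    by apply: sumr_ge0 => l /andP[/andP[li _] _]; apply: tge; rewrite eq_sym.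
  by move: h; set r := \sum_(l | _) _; clear; lia.
(* At an end the path neighbour counts twice and the other edges at least once, so the neighbours
   contribute at least valency + 1 >= 4, which balances the diagonal term 2 c_w = 4. *)
have endP w : M w -> w \in t -> (forall j, M j -> j != w -> j \notin t -> - X w j <= - X w j * c 0 j) ->
    3 <= valency w -> (exists j, [/\ j \in t, j != w & X w j != 0]) -> B (simple_root w) c <= 0.
  move=> Mw wt hw vw [j0 [j0t j0w Xj0]]; rewrite BE cE wt.
  have Mj0 := Mt _ j0t.
  have : valency w + 1 <= \sum_(j | j != w) - X w j * c 0 j.
    rewrite /valency (bigD1 j0) ?Mj0 //= [X in _ <= X](bigD1 j0) //= cE j0t addrAC lerD //.
      suff : - X w j0 + 1 <= - X w j0 * 2 by [].
      have Xw : X w j0 <= 0 by apply: (sl_neg SL); rewrite eq_sym.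
      clear -Xj0 Xw; lia.
    rewrite big_mkcond [X in _ <= X]big_mkcond; apply: ler_sum => j _.
    have [->|jw] := eqVneq j w; first by rewrite andbF.
    have [->|jj0] := eqVneq j j0; first by rewrite !andbF.
    rewrite /= !andbT; have [Mj|Mj] := boolP (M j); last by apply: tge; rewrite eq_sym.
    have [jt|jt] := boolP (j \in t); last exact: hw.
    by rewrite cE jt; apply: edge_le_double; apply: (sl_neg SL); rewrite eq_sym; exact: jw.
  by move: vw; set r := \sum_(j | _) _; clear; lia.
have Bc i : c 0 i != 0 -> B (simple_root i) c <= 0.
  rewrite {1}cE; have [it _|it] := boolP (i \in t).
    have Mi := Mt i it.
    have [iv|iv] := eqVneq i v.
      rewrite iv; apply: endP => //.
        move=> j Mj jv jt; rewrite cE (negPf jt) Mj.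
        by apply: edge_le_indicl; apply: (sl_neg SL); rewrite eq_sym; exact: jv.
      have [j [jt /and4P[_ _ vj Xvj] _]] := nextP v vt vv'.
      by exists j; rewrite eq_sym.
    have [iv'|iv'] := eqVneq i v'.
      rewrite iv'; apply: endP => //.
        move=> j Mj jv jt; rewrite cE (negPf jt) Mj.
        by apply: edge_le_indicr; apply: (sl_neg SL); rewrite eq_sym; exact: jv.
      rewrite eq_sym in vv'.
      have [j [jt /and4P[_ _ vj Xvj] _]] := prevP v' v't vv'.
      by exists j; rewrite sl_sym.
    have [j [jt /and4P[_ _ ij Xij] ixj]] := nextP i it iv'.
    have [k [kt /and4P[_ _ ki Xki] ixk]] := prevP i it iv.
    apply: (two i j k) => //; first by rewrite eq_sym.
    - by apply/eqP => ejk; move: ixj; rewrite ejk ixk => /eqP; rewrite -addn2 -[X in X == _]addn0 eqn_add2l.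
    - rewrite !cE it jt kt [X i k](sl_sym SL).
      by apply: two_edges; rewrite ?sl_neg.
  case: ifP => // Mi ci.
  have iv : i != v by apply: contraNneq it => ->.
  have iv' : i != v' by apply: contraNneq it => ->.
  apply: (two i v v') => //; rewrite !cE vt v't (negPf it) Mi.
  rewrite [X i v](sl_sym SL) [X i v'](sl_sym SL).
  by apply: edge_indic_le; apply: (sl_neg SL); rewrite eq_sym; [exact: iv|exact: iv'].
have : 0 < B c c.
  apply: pM => //; apply/eqP => /matrixP/(_ 0 v).
  by rewrite -[LHS]/(c 0 v) cE vt mxE.
rewrite ltNge pairing_coord => /negP[]; apply: sumr_le0 => i _.
have [->|ci] := eqVneq (c 0 i) 0; first by rewrite mul0r.
exact: mulr_ge0_le0 (c0 i) (Bc i ci).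
Qed.

End BranchVertices.

(** * Two overextending vertices *)

Section ExtUnique.
Variables (n : nat) (X : 'M[int]_n).
Hypothesis SL : simply_laced X.
Notation B := (pairing X).

Section TwoVertices.
Variables (p p' q q' : 'I_n) (d d' : 'rV[int]_n).
Hypotheses (ed : ext_datum X p d) (ed' : ext_datum X p' d') (pp' : p != p').
Hypotheses (qp : q != p) (dq : d 0 q = 1) (Xq : X q p = -1).
Hypothesis Xp : forall i, i != p -> i != q -> X i p = 0.
Hypotheses (qp' : q' != p') (dq' : d' 0 q' = 1) (Xq' : X q' p' = -1).
Hypothesis Xp' : forall i, i != p' -> i != q' -> X i p' = 0.

Let M i := (i != p) && (i != p').

Let aE : d' 0 p = d 0 p'.
Proof.
by have := pairing_ext ed' d; rewrite pairingC // (pairing_ext ed) => /oppr_inj.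
Qed.

Let dq'E : d 0 q' = 2 * d 0 p'.
Proof.
have := ext_pair0 ed (i := p'); rewrite eq_sym => /(_ pp').
rewrite pairing_simple_coord (bigD1 p') //= (bigD1 q') //= (sl_diag SL) (sl_sym SL) Xq'.
rewrite big1 ?addr0; last by move=> i /andP[i1 i2]; rewrite (sl_sym SL) Xp' ?mul0r.
by lia.
Qed.

Let a_gt0 : 0 < d 0 p'. Proof. by apply: (ext_pos ed); rewrite eq_sym. Qed.

Let Mq' : M q'.
Proof.
rewrite /M qp' andbT; apply/eqP => e; have := dq'E; rewrite e (ext_p ed).
by have := a_gt0; lia.
Qed.

(** p' is a leaf attached to q', so removing it from the connected diagram without p keeps it
    connected; T' gives p' the value of T at q'. *)
Lemma ext_conn2 (T : pred 'I_n) : (exists2 i, M i & T i) ->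
  (forall i j, M i -> M j -> T i -> X i j != 0 -> T j) -> forall i, M i -> T i.
Proof.
move=> [i0 /andP[i0p i0p'] Ti0] cl.
pose T' i := if i == p' then T q' else T i.
have H i : i != p -> T' i.
  move: i; apply: (ext_conn ed); first by exists i0; rewrite // /T' (negPf i0p').
  move=> i j ip jp; rewrite /T'; have [->|ip'] := eqVneq i p'.
    have [_ //|jp'] := eqVneq j p' => Tq' X0.
    have [->//|jq'] := eqVneq j q'.
    by move: X0; rewrite (sl_sym SL) Xp' ?eqxx.
  have [->|jp'] := eqVneq j p' => Ti X0; last by apply: cl X0 => //; apply/andP.
  have [<-//|iq'] := eqVneq i q'.
  by move: X0; rewrite Xp' ?eqxx.
by move=> i /andP[ip ip']; have := H i ip; rewrite /T' (negPf ip').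
Qed.

Lemma ext_posdef2 : posdef_on X M.
Proof. by apply: (ext_posdef SL ed); rewrite eq_sym. Qed.

(* Follow the chain starting at q: as long as no branch vertex is met, d increases
   by 1 and d' by a = d_{p'} at each step. *)
Lemma ext_branch_vertex : exists v, [/\ M v, 3 <= valency X M v &
  d' 0 v = d 0 p' * (d 0 v + 1)].
Proof.
have Mq : M q.
  rewrite /M qp /=; apply/eqP => e.
  have := ext_pair0 ed' pp'; rewrite pairing_simple_coord (bigD1 p) //= (bigD1 q) //=.
  rewrite {2}e (ext_p ed') mulr0 add0r (sl_diag SL) big1 ?addr0.
    by rewrite aE; have := a_gt0; lia.
  by move=> i /andP[ip iq]; rewrite (sl_sym SL) Xp ?mul0r.
have d'q : d' 0 q = 2 * d 0 p'.
  have := ext_pair0 ed' pp'; rewrite pairing_simple_coord (bigD1 p) //= (bigD1 q) //=.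
  rewrite (sl_diag SL) (sl_sym SL) Xq big1 ?addr0; first by rewrite aE; lia.
  by move=> i /andP[ip iq]; rewrite (sl_sym SL) Xp ?mul0r.
have a0 := a_gt0; have dq'2 := dq'E; set a := d 0 p' in a0 d'q dq'2 *.
(* s is the current vertex of the chain and u the previous one. As d_s grows along the chain and is
   at most the height of d, N bounds the number of remaining steps. *)
have main N (s u : 'I_n) : (height d - d 0 s < N%:Z) -> M s -> u != s -> u != p' -> X s u = -1 ->
    d 0 s = d 0 u + 1 -> d' 0 u = a * (d 0 u + 1) -> d' 0 s = a * (d 0 s + 1) ->
    exists v, [/\ M v, 3 <= valency X M v & d' 0 v = a * (d 0 v + 1)].
  elim: N s u => [|N IH] s u hN Ms us up' Xsu du d'u d's.
    have : d 0 s <= height d.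
      by rewrite /height (bigD1 s) //= lerDl; apply: sumr_ge0 => i _; apply: (ext_nneg ed).
    by lia.
  have [big|small] := leP 3 (valency X M s); first by exists s.
  have /andP[sp sp'] := Ms.
  have d_pos i : M i -> 0 < d 0 i by move=> /andP[ip _]; apply: (ext_pos ed).
  have du0 : 0 <= d 0 u by apply: (ext_nneg ed).
  have sq' : s != q' by apply/eqP => e; move: d's du; rewrite e dq'; clear -a0 du0; nia.
  have Xsp' : X s p' = 0 by apply: Xp'.
  have Xsp : u != p -> X s p = 0.
    move=> up; apply: Xp => //; apply/eqP => e; have := ext_pos ed up.
    by move: du; rewrite e dq; clear; lia.
  pose rest j := [&& M j, j != s & j != u].
  have split_sum (c : 'rV[int]_n) : B (simple_root s) c =
      2 * c 0 s - c 0 u + \sum_(j | rest j) X s j * c 0 j.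
    rewrite pairing_simple_coord (bigD1 s) //= (bigD1 u) //= (sl_diag SL) Xsu mulN1r addrA.
    congr (_ + _); rewrite big_mkcond [RHS]big_mkcond; apply: eq_bigr => j _.
    rewrite /rest /M; have [->|jp'] := eqVneq j p'; first by rewrite Xsp' mul0r !if_same.
    have [->|jp] := eqVneq j p; last by rewrite andbT /=.
    rewrite /=; case: ifP => // /andP[_ pu]; rewrite Xsp ?mul0r //.
    by rewrite eq_sym.
  pose w j := - X s j.
  have w0 j : rest j -> 0 <= w j.
    by move=> /and3P[_ js _]; rewrite oppr_ge0 sl_neg // eq_sym.
  have Sw_c (c : 'rV[int]_n) : \sum_(j | rest j) w j * c 0 j = - \sum_(j | rest j) X s j * c 0 j.
    by rewrite -sumrN; apply: eq_bigr => j _; rewrite mulNr.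
  have Sd : \sum_(j | rest j) w j * d 0 j = d 0 s + 1.
    rewrite Sw_c; have := split_sum d; rewrite (ext_pair0 ed sp).
    by set r := \sum_(j | _) _; clear -du; lia.
  have Sd' : \sum_(j | rest j) w j * d' 0 j = a * (d 0 s + 2).
    rewrite Sw_c; have := split_sum d'; rewrite (ext_pair0 ed' sp') d's d'u du.
    by set r := \sum_(j | _) _; clear; lia.
  have Sw : valency X M s = (u != p)%:R + \sum_(j | rest j) w j.
    rewrite /valency; have [eup|up] := eqVneq u p.
      rewrite add0r; apply: eq_bigl => j; rewrite /rest /M eup.
      by case: (j != p); rewrite ?andbT.
    rewrite (bigD1 u) /= ?Xsu ?opprK; last by rewrite /M up up'.
    by congr (_ + _); apply: eq_bigl => j; rewrite /rest andbA.
  have W0 : 0 <= \sum_(j | rest j) w j by apply: sumr_ge0.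
  (* The total weight of the edges leaving s other than the one to u. Weight 0 contradicts [Sd];
     weight 1 gives the next vertex t, with d_t = d_s + 1 and d'_t = a (d_t + 1). *)
  have [W1|W1] := leP (\sum_(j | rest j) w j) 1.
    have [Wz|Wz] := eqVneq (\sum_(j | rest j) w j) 0.
      move/eqP: Wz; rewrite psumr_eq0 // => /allP wz.
      have : \sum_(j | rest j) w j * d 0 j = 0.
        apply: big1 => j rj; have := wz j (mem_index_enum j); rewrite rj /= => /eqP ->.
        by rewrite mul0r.
      by rewrite Sd; clear -du du0; lia.
    have W1' : \sum_(j | rest j) w j = 1.
      by move: W0 W1 Wz; set r := \sum_(j | _) _; clear; lia.
    have [//|t [rt wt wz]] := sum_eq1 _ W1'.
    have pick1 (c : 'rV[int]_n) : \sum_(j | rest j) w j * c 0 j = c 0 t.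
      rewrite (bigD1 t) //= wt mul1r big1 ?addr0 // => j /andP[rj jt].
      by rewrite wz // mul0r.
    move: Sd Sd'; rewrite !pick1 => dt d't; have /and3P[Mt ts tu] := rt.
    apply: (IH t s) => //; try by rewrite ?d's //.
    - by move: hN; rewrite dt; clear; lia.
    - by rewrite eq_sym.
    - by rewrite (sl_sym SL) -[LHS]opprK -/(w t) wt.
    - by rewrite d't dt; congr (_ * _); clear; lia.
  (* Weight at least 2 with valency at most 2 is possible only at the start, where u = p is not
     counted in the valency; so d_s = 1 and the weight is exactly 2. *)
  have up : u = p.
    by apply/eqP; apply: contraT => up; move: small; rewrite Sw up; move: W1; set r := \sum_(j | _) _; clear; lia.
  have ds : d 0 s = 1 by rewrite du up (ext_p ed).
  have W2 : \sum_(j | rest j) w j = 2.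
    by move: small W1; rewrite Sw up eqxx; set r := \sum_(j | _) _; clear; lia.
  have w1 j : rest j -> w j != 0 -> d 0 j = 1.
    move=> rj wj; have : \sum_(j | rest j) w j * (d 0 j - 1) == 0.
      rewrite (eq_bigr (fun j => w j * d 0 j - w j)); last by move=> k _; ring.
      by rewrite sumrB Sd W2 ds.
    rewrite psumr_eq0; last first.
      by move=> k rk; rewrite mulr_ge0 ?w0 // subr_ge0; have /and3P[/d_pos] := rk.
    move=> /allP/(_ j (mem_index_enum j)); rewrite rj mulf_eq0 (negPf wj) subr_eq0.
    by move=> /eqP.
  (* Now d would be 1 on all of M: if d_i = 1 and one neighbour of i has coefficient 1, then
     (alpha_i | d) = 0 leaves at most 1 for any other neighbour. But q' is in M and d_q' = 2a. *)
  pose T i := (d 0 i == 1) && [exists j, [&& M j, j != i, X i j != 0 & d 0 j == 1]].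
  have : T q'; last by rewrite /T dq'2 => /andP[/eqP]; clear; lia.
  apply: (ext_conn2 (T := T)) => //.
    exists s => //; rewrite /T ds eqxx /=.
    have [j [rj wj]] : exists j, rest j /\ w j != 0.
      apply: contrapT => nex; have : \sum_(j | rest j) w j = 0.
        by apply: big1 => j rj; apply/eqP; apply: contrapT => /negP wj; apply: nex; exists j.
      by rewrite W2.
    apply/existsP; exists j; have /and3P[-> -> _] := rj.
    by rewrite w1 // eqxx andbT; move: wj; rewrite oppr_eq0.
  move=> i k Mi Mk /andP[/eqP di /existsP[j0 /and4P[Mj0 j0i Xj0 /eqP dj0]]] Xik.
  have [->|ki] := eqVneq k i.
    by rewrite /T di eqxx; apply/existsP; exists j0; rewrite Mj0 j0i Xj0 dj0.
  rewrite /T; apply/andP; split; last first.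
    by apply/existsP; exists i; rewrite Mi eq_sym ki (sl_sym SL) Xik di.
  have [->|kj0] := eqVneq k j0; first by rewrite dj0.
  have /andP[ip _] := Mi.
  have := ext_pair0 ed ip; rewrite pairing_simple_coord (bigD1 i) //= (sl_diag SL) di.
  rewrite (bigD1 j0) //= (bigD1 k) /=; last by rewrite ki.
  have : \sum_(l | (l != i) && (l != j0) && (l != k)) X i l * d 0 l <= 0.
    apply: sumr_le0 => l /andP[/andP[li _] _]; apply: mulr_le0_ge0; last exact: ext_nneg ed _.
    by rewrite sl_neg // eq_sym.
  have := sl_neg SL (i := i) (j := j0); rewrite eq_sym => /(_ j0i).
  have := sl_neg SL (i := i) (j := k); rewrite eq_sym => /(_ ki).
  have := d_pos k Mk; rewrite dj0; set r := \sum_(l | _) _ => dk Xk Xj r0 eq0.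
  have Xk1 : X i k <= -1 by move: Xk Xik; clear; lia.
  have Xj1 : X i j0 <= -1 by move: Xj Xj0; clear; lia.
  by apply/eqP; clear -Xk1 Xj1 dk r0 eq0; nia.
have pq : p != q by rewrite eq_sym.
(* The chain starts at u = p and s = q, where d takes the values 0 and 1, and d' the values a and
   2a. *)
refine (main (absz (height d - d 0 q)%R).+1 q p _ Mq pq pp' Xq _ _ _).
- by clear; lia.
- by rewrite dq (ext_p ed).
- by rewrite aE (ext_p ed) /a; clear; lia.
- by rewrite d'q dq; clear; lia.
Qed.

End TwoVertices.

(** By symmetry there are branch vertices v with d'_v = a (d_v + 1) and v' with d_v' = a (d'_v' +
    1), for the same a = d_p' = d'_p = -(d | d') >= 1. A connected positive definite diagram has at
    most one branch vertex, so v = v', and the two equations are incompatible. *)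
Lemma ext_vertex_unique p p' d d' : ext_datum X p d -> ext_datum X p' d' -> p = p'.
Proof.
move=> ed ed'; apply/eqP/contraT => pp'.
have [q [qp dq Xq Xp]] := ext_neighbour SL ed.
have [q' [qp' dq' Xq' Xp']] := ext_neighbour SL ed'.
have p'p : p' != p by rewrite eq_sym.
have [v [Mv vv ev]] := ext_branch_vertex ed ed' pp' qp dq Xq Xp qp' dq' Xq' Xp'.
have [v' [Mv' vv' ev']] := ext_branch_vertex ed' ed p'p qp' dq' Xq' Xp' qp dq Xq Xp.
have aE : d' 0 p = d 0 p'.
  by have := pairing_ext ed' d; rewrite pairingC // (pairing_ext ed) => /oppr_inj.
have a0 := ext_pos ed p'p.
have vE : valency X (fun i => (i != p') && (i != p)) v' = valency X (fun i => (i != p) && (i != p')) v'.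
  by apply: eq_bigl => j; rewrite [(j != p') && _]andbC.
rewrite vE in vv'; rewrite andbC in Mv'.
have cM := ext_conn2 ed Xp'.
have e := branch_vertex_unique SL (ext_posdef2 ed pp') cM Mv Mv' vv vv'.
rewrite -e aE in ev'.
have := ext_nneg ed v; have := ext_nneg ed' v.
by nia.
Qed.

End ExtUnique.

(** * Normal forms of pi-systems of overextended type *)

Section Tuples.
Variables (k : nat) (K : 'M[int]_k) (n : nat) (X : 'M[int]_n).
Hypotheses (SK : simply_laced K) (SX : simply_laced X).
Notation B := (pairing X).
Notation a := (@simple_root n).
Implicit Types (b : 'I_k -> 'rV[int]_n) (v : 'rV[int]_k) (x y : 'rV[int]_n).

Definition real_tuple b := (forall i, real X (b i)) /\ forall i j, B (b i) (b j) = K i j.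

Definition lcomb b v : 'rV[int]_n := \sum_i v 0 i *: b i.

Lemma lcombD b v v' : lcomb b (v + v') = lcomb b v + lcomb b v'.
Proof. by rewrite -big_split; apply: eq_bigr => i _; rewrite coordD scalerDl. Qed.
Lemma lcombZ b c v : lcomb b (c *: v) = c *: lcomb b v.
Proof. by rewrite scaler_sumr; apply: eq_bigr => i _; rewrite coordZ scalerA. Qed.
Lemma lcombN b v : lcomb b (- v) = - lcomb b v.
Proof. by rewrite -scaleN1r lcombZ scaleN1r. Qed.
Lemma lcomb_simple b i : lcomb b (simple_root i) = b i.
Proof.
rewrite /lcomb (bigD1 i) //= simple_rootE eqxx scale1r big1 ?addr0 // => j ji.
by rewrite simple_rootE (negPf ji) scale0r.
Qed.

Lemma pairing_lcomb b v v' : real_tuple b -> B (lcomb b v) (lcomb b v') = pairing K v v'.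
Proof.
move=> [_ Gb]; rewrite pairing_suml [RHS]pairing_coord; apply: eq_bigr => i _.
rewrite pairingZl pairing_sumr pairing_simple_coord; congr (_ * _).
by apply: eq_bigr => j _; rewrite pairingZr Gb mulrC.
Qed.

Lemma pairing_lcomb_simple b v i : real_tuple b -> B (b i) (lcomb b v) = pairing K (simple_root i) v.
Proof. by move=> Tb; rewrite -(lcomb_simple b i) pairing_lcomb. Qed.

(** Under [lcomb b] a simple reflection of K becomes the reflection in the real root b_j, which
    preserves the real roots of X. *)
Lemma real_lcomb b v : real_tuple b -> real K v -> real X (lcomb b v).
Proof.
move=> Tb [w [i ->]]; elim: w => [|j w IH]; first by rewrite lcomb_simple; apply: (proj1 Tb).
rewrite weyl_act_cons /simple_refl lcombD lcombN lcombZ lcomb_simple.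
rewrite -(pairing_lcomb_simple _ _ Tb); apply: real_reflect => //; exact: (proj1 Tb).
Qed.

Lemma real_tuple_weyl w b : real_tuple b -> real_tuple (fun i => weyl_act X w (b i)).
Proof.
move=> [Rb Gb]; split=> [i|i j]; first exact: real_weyl.
by rewrite weyl_act_iso.
Qed.

Lemma lcomb_weyl w b v : lcomb (fun i => weyl_act X w (b i)) v = weyl_act X w (lcomb b v).
Proof. by rewrite weyl_act_sum; apply: eq_bigr => i _; rewrite weyl_actZ. Qed.

Lemma real_tupleN b : real_tuple b -> real_tuple (fun i => - b i).
Proof.
move=> [Rb Gb]; split=> [i|i j]; first exact: real_opp.
by rewrite pairingNl pairingNr opprK.
Qed.

Lemma lcomb_opp b v : lcomb (fun i => - b i) v = - lcomb b v.
Proof. by rewrite -sumrN; apply: eq_bigr => i _; rewrite scalerN. Qed.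

Variables (p q : 'I_k) (d : 'rV[int]_k).
Hypothesis ed : ext_datum K p d.
Hypotheses (qp : q != p) (dq : d 0 q = 1).
Hypothesis Kp : forall i, i != p -> i != q -> K i p = 0.

Let pdd : pairing K d d = 0. Proof. exact: (ext_norm ed). Qed.
Let pqd : pairing K (simple_root q) d = 0. Proof. exact: (ext_pair0 ed qp). Qed.

(** d - alpha_q has norm 2 and does not involve p, so [norm2_real] applies. *)
Lemma ext_theta_real : real K (d - simple_root q).
Proof.
have [||w [i [-> _ _]]] := norm2_real SK (ext_almost_posdef SK ed) (v := d - simple_root q).
- move=> i; rewrite negbK => /eqP ->.
  by rewrite coordB (ext_p ed) simple_rootE eq_sym (negPf qp) subr0.
- rewrite !(pairingBl, pairingBr) pdd pqd [pairing K d _]pairingC // pqd.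
  by rewrite pairing_simple sl_diag.
- by apply/real_weyl/real_simple.
Qed.

(* The product of the reflections in alpha_q and d - alpha_q is a translation by 2d. *)
Lemma ext_translate_real m : real K (simple_root q + (2 * m)%N%:Z *: d).
Proof.
elim: m => [|m IH]; first by rewrite muln0 scale0r addr0; apply: real_simple.
have R1 := real_reflect SK ext_theta_real IH.
have := real_reflect SK (real_simple K q) R1; congr (real K _).
rewrite !(pairingDl, pairingDr, pairingNl, pairingNr, pairingZl, pairingZr).
rewrite !pairing_simple !(sl_diag SK) pqd pdd [pairing K d (simple_root q)]pairingC // pqd.
apply/rowP => i; rewrite !(coordD, coordZ, coordN) simple_rootE mulnS PoszD.
ring.
Qed.

(** For m large, x + 2m y has the sign of y at each of two coordinates where y is non-zero; opposite
    signs there contradict the coherence of real roots. *)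
Lemma affine_line_coherent x y : (forall m : nat, real X (x + (2 * m)%N%:Z *: y)) ->
  nneg y \/ nneg (- y).
Proof.
move=> R; apply: contrapT => nc.
have [[i yi] [j yj]] : (exists i, y 0 i < 0) /\ (exists j, 0 < y 0 j).
  split; apply: contrapT => ne; apply: nc; [left|right] => l; last rewrite coordN oppr_ge0;
  by rewrite leNgt; apply/negP => h; apply: ne; exists l.
pose m := (absz (x 0%R i) + absz (x 0%R j) + 1)%N.
have [/(_ i)|/(_ j)] := real_coherent SX (R m).
  rewrite coordD coordZ /m; clear -yi; nia.
rewrite coordN coordD coordZ /m; clear -yj; nia.
Qed.

Lemma null_coherent b : real_tuple b -> nneg (lcomb b d) \/ nneg (- lcomb b d).
Proof.
move=> Tb; apply: (@affine_line_coherent (b q)) => m.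
by rewrite -lcombZ -(lcomb_simple b q) -lcombD; apply/real_lcomb/ext_translate_real.
Qed.

Lemma null_neq0 b : real_tuple b -> lcomb b d != 0.
Proof.
move=> Tb; apply/eqP => e; have := pairing_lcomb_simple d p Tb.
by rewrite e pairing0r (ext_pair ed) eqxx.
Qed.

Lemma null_norm b : real_tuple b -> B (lcomb b d) (lcomb b d) = 0.
Proof. by move=> Tb; rewrite pairing_lcomb. Qed.

(** The reflected vector is the null vector of the reflected tuple, hence coherent. Were it
    negative, D would be a multiple of alpha_i of norm 0, that is, zero. *)
Lemma null_refl_nneg b i : real_tuple b -> nneg (lcomb b d) -> nneg (simple_refl X i (lcomb b d)).
Proof.
move=> Tb pb; have Tb' := real_tuple_weyl [:: i] Tb.
have := null_coherent Tb'; rewrite lcomb_weyl weyl_act_seq1 => -[//|nb].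
have ex := refl_flip pb nb; have y0 := null_neq0 Tb; have := null_norm Tb.
rewrite {1 2}ex pairingZl pairingZr pairing_simple (sl_diag SX) => N.
have c0 : lcomb b d 0 i = 0 by clear -N; nia.
by move: y0; rewrite ex c0 scale0r eqxx.
Qed.

Lemma null_weyl_nneg b w : real_tuple b -> nneg (lcomb b d) -> nneg (weyl_act X w (lcomb b d)).
Proof.
move=> Tb pb; elim: w => // i w; rewrite weyl_act_cons -lcomb_weyl => pw.
by apply: null_refl_nneg => //; apply: real_tuple_weyl.
Qed.

(** Reflecting where the pairing is positive lowers the height while D stays non-negative, so the
    process stops. *)
Lemma null_antidominant b : real_tuple b -> nneg (lcomb b d) ->
  exists w, nneg (weyl_act X w (lcomb b d)) /\ forall i, B (a i) (weyl_act X w (lcomb b d)) <= 0.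
Proof.
move=> Tb pb; have := nneg_height pb; case Eh : (height _) => [h|//] _.
elim/ltn_ind: h b Tb pb Eh => h IH b Tb pb Eh.
have [anti|] := pselect (forall i, B (a i) (lcomb b d) <= 0); first by exists [::].
move=> /existsNP[i /negP]; rewrite -ltNge => pos.
have ps := null_refl_nneg i Tb pb.
have := nneg_height ps; case Es : (height _) => [h'|//] _.
have Tb' := real_tuple_weyl [:: i] Tb.
have E : lcomb (fun j => weyl_act X [:: i] (b j)) d = simple_refl X i (lcomb b d).
  by rewrite lcomb_weyl.
have [|||w [pw aw]] := IH h' _ _ Tb' _ _.
- by move: Es; rewrite height_refl Eh; clear -pos; lia.
- by rewrite E.
- by rewrite E.
by exists (w ++ [:: i]); rewrite weyl_act_cat -lcomb_weyl.
Qed.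

Lemma pairing_disconnected (S T : pred 'I_n) x y :
  (forall i j, S i -> S j -> T i -> ~~ T j -> X i j = 0) ->
  supported S x -> supported S y -> supported T x -> supported (predC T) y -> B x y = 0.
Proof.
move=> h sx sy tx ty; rewrite pairing_coord big1 // => i _; rewrite pairing_simple_coord.
have [/andP[Si Ti]|] := boolP (S i && T i); last first.
  by rewrite negb_and => /orP[/sx|/tx] ->; rewrite mul0r.
rewrite big1 ?mulr0 // => j _; have [/andP[Sj Tj]|] := boolP (S j && ~~ T j).
  by rewrite h ?mul0r.
by rewrite negb_and => /orP[/sy|/ty] ->; rewrite mulr0.
Qed.

(** Each real root b_i lies on one side of T. Roots on different sides are orthogonal, and K without
    p is connected, so all b_i with i <> p lie on the same side. *)
Lemma tuple_split (S T : pred 'I_n) b : real_tuple b ->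
  (forall i, i != p -> supported S (b i)) ->
  (forall i j, S i -> S j -> T i -> ~~ T j -> X i j = 0) ->
  (forall i, i != p -> supported T (b i)) \/ (forall i, i != p -> supported (predC T) (b i)).
Proof.
move=> [Rb Gb] sb ST.
have Sx i l : i != p -> b i 0 l != 0 -> S l.
  by move=> ip bl; apply: contraNT bl => /(sb i ip) ->.
have dich i : i != p -> supported T (b i) \/ supported (predC T) (b i).
  move=> ip; have [pb|nb] := real_coherent SX (Rb i).
    by apply: (real_connected SX) => // j l bj bl; apply: ST; apply: (Sx i).
  have [||||] := @real_connected n X SX (- b i) T => //.
  - exact: (real_opp SX).
  - move=> j l; rewrite !coordN !oppr_eq0 => bj bl; apply: ST; exact: (Sx i).
  - by move=> /supportedN; rewrite opprK; left.
  - by move=> /supportedN; rewrite opprK; right.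
have [[i0 [i0p Ti0]]|nex] := pselect (exists i, i != p /\ supported T (b i)); last first.
  by right=> i ip; have [Ti|//] := dich i ip; case: nex; exists i.
left=> i ip; apply/asboolP; move: i ip.
apply: (ext_conn ed (T := fun i => `[< supported T (b i) >])).
  by exists i0 => //; apply/asboolP.
move=> i j ip jp /asboolP Ti Kij; apply/asboolP; have [//|nTj] := dich j jp.
by move: Kij; rewrite -Gb (pairing_disconnected ST (sb i ip) (sb j jp) Ti nTj).
Qed.

(** Only the support of [dl] and the vertex j are described, with no reference to the rest of X. In
    [normal_tuple_pos], r is the only neighbour of j in this support, so removing r leaves the
    finite part. *)
Record normal_tuple b (dl : 'rV[int]_n) (j r : 'I_n) : Prop := {
  nf_nneg : nneg dl;
  nf_anti : forall i, B (a i) dl <= 0;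
  nf_ker : forall i, dl 0 i != 0 -> B (a i) dl = 0;
  nf_j : B (a j) dl = -1;
  nf_r : dl 0 r = 1;
  nf_conn : forall T : pred 'I_n, (exists2 i, dl 0 i != 0 & T i) ->
    (forall i l, dl 0 i != 0 -> dl 0 l != 0 -> T i -> X i l != 0 -> T l) ->
    forall i, dl 0 i != 0 -> T i;
  nf_p : b p = a j;
  nf_supp : forall i, i != p -> supported (fun l => dl 0 l != 0) (b i);
  nf_supp0 : forall i, i != p -> i != q -> b i 0 r = 0;
  nf_delta : lcomb b d = dl;
  nf_real : real_tuple b }.

(* Minimise the height of c over the orbit of the stabiliser of dl. *)
Lemma move_to_simple (P : pred 'I_n) j x : ~~ P j -> real X x -> nneg x -> x 0 j = 1 ->
  supported (fun i => P i || (i == j)) x ->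
  exists w, all P w /\ weyl_act X w x = a j.
Proof.
move=> Pj rx px xj sx; have := nneg_height px; case Eh : (height x) => [h|//] _.
elim/ltn_ind: h x rx px xj sx Eh => h IH x rx px xj sx Eh.
have [[i [Pi pos]]|nex] := pselect (exists i, P i /\ 0 < B (a i) x).
  have ij : j != i by apply: contraNneq Pj => ->.
  have sj : simple_refl X i x 0 j = 1.
    by rewrite simple_refl_coord (negPf ij) mulr0 subr0.
  have rs := real_refl i rx.
  have [ps|/(_ j)] := real_coherent SX rs; last by rewrite coordN sj.
  have := nneg_height ps; case Es : (height _) => [h'|//] _.
  have [||w [Pw ew]] := IH h' _ _ rs ps sj _ Es.
  - by move: Es; rewrite height_refl Eh; clear -pos; lia.
  - by apply: supported_refl => //; rewrite Pi.
  exists (w ++ [:: i]); rewrite all_cat Pw /= Pi weyl_act_cat weyl_act_seq1.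
  by split.
exists [::]; split=> //; rewrite -[LHS]/x.
have anti i : P i -> B (a i) x <= 0 by move=> Pi; rewrite leNgt; apply/negP => h'; apply: nex; exists i.
pose v := x - a j.
have vc i : v 0 i = if i == j then 0 else x 0 i.
  by rewrite coordB simple_rootE; case: eqP => [->|_]; rewrite ?xj ?subrr ?subr0.
have vn : nneg v by move=> i; rewrite vc; case: ifP.
have ev : x = a j + v by rewrite /v addrC subrK.
have Bxv : B v x <= 0.
  rewrite pairing_coord; apply: sumr_le0 => i _; rewrite vc; case: eqP => [_|ij]; first by rewrite mul0r.
  have [xi|xi] := eqVneq (x 0 i) 0; first by rewrite xi mul0r.
  apply: mulr_ge0_le0 => //; apply: anti; apply: contraNT xi => nPi.
  by rewrite sx // negb_or nPi; apply/eqP.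
have Bjv : B (a j) v <= 0.
  rewrite pairing_simple_coord; apply: sumr_le0 => i _; rewrite vc; case: eqVneq => [_|ij].
    by rewrite mulr0.
  by apply: mulr_le0_ge0 => //; apply: (sl_neg SX); rewrite eq_sym; exact: ij.
(* 2 = (x | x) = 2 + (alpha_j | v) + (v | x), and the last two terms are <= 0. *)
have Bjv0 : B (a j) v = 0.
  have := real_norm SX rx; rewrite {1}ev pairingDl {1}ev pairingDr pairing_simple (sl_diag SX).
  by clear -Bxv Bjv; lia.
have Xjv i : i != j -> x 0 i != 0 -> X j i = 0.
  move=> ij xi; apply/eqP; apply: contraTT isT => Xji.
  have : B (a j) v < 0; last by rewrite Bjv0.
  rewrite pairing_simple_coord (bigD1 i) //= vc (negPf ij).
  rewrite -[ltRHS]addr0; apply: ltr_leD.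
    have xp : 0 < x 0 i by rewrite lt_def xi px.
    have Xn : X j i <= 0 by apply: (sl_neg SX); rewrite eq_sym; exact: ij.
    by rewrite nmulr_rlt0 // lt_def eq_sym Xji.
  apply: sumr_le0 => l _; rewrite vc; case: eqVneq => [_|lj]; first by rewrite mulr0.
  by apply: mulr_le0_ge0 => //; apply: (sl_neg SX); rewrite eq_sym; exact: lj.
(* j is isolated in the support of x, and the support of a real root is connected. *)
have [|sT|sT] := real_connected SX (T := pred1 j) rx px _.
- by move=> i l xi xl /= /eqP-> lj; apply: Xjv.
- by apply/rowP => i; rewrite simple_rootE; case: eqVneq => [->//|ij]; apply: sT.
- by have := sT j; rewrite /= eqxx xj => /(_ isT).
Qed.

Lemma weyl_act_fix (v : 'rV[int]_n) w : all (fun i => B (a i) v == 0) w -> weyl_act X w v = v.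
Proof.
elim: w => // i w IH /= /andP[/eqP vi /IH e].
by rewrite weyl_act_cons e /simple_refl vi scale0r subr0.
Qed.

Lemma lcomb_supported (J : pred 'I_n) b : (forall i, i != p -> supported J (b i)) ->
  supported J (lcomb b d).
Proof.
move=> h; apply: supported_sum => i _; have [->|ip] := eqVneq i p.
  by rewrite (ext_p ed) scale0r; apply: supported0.
by apply/supportedZ/h.
Qed.

Lemma normal_tuple_pos b : real_tuple b -> nneg (lcomb b d) ->
  exists w dl j r, normal_tuple (fun i => weyl_act X w (b i)) dl j r.
Proof.
move=> Tb pb; have [w0 [pd ad]] := null_antidominant Tb pb.
pose b1 i := weyl_act X w0 (b i); have T1 : real_tuple b1 by apply: real_tuple_weyl.
have [dl edl] : exists dl, dl = weyl_act X w0 (lcomb b d) by eexists.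
rewrite -edl in pd ad; have L1 : lcomb b1 d = dl by rewrite lcomb_weyl edl.
pose P i := B (a i) dl == 0.
(* (dl | dl) = 0 is a sum of non-positive terms dl_i (alpha_i | dl), so each of them vanishes. *)
have kd i : dl 0 i != 0 -> P i.
  move=> di; have : \sum_i - (dl 0 i * B (a i) dl) == 0.
    by rewrite sumrN -pairing_coord -L1 null_norm // oppr0.
  rewrite psumr_eq0; last by move=> l _; rewrite oppr_ge0 mulr_ge0_le0.
  move=> /allP/(_ i (mem_index_enum i)); rewrite oppr_eq0 mulf_eq0 (negPf di).
  by [].
have Bc : B (b1 p) dl = -1.
  by rewrite -L1 pairing_lcomb_simple // (ext_pair ed) eqxx.
have pc : nneg (b1 p).
  have [//|nc] := real_coherent SX (proj1 T1 p).
  suff : B (- b1 p) dl <= 0 by rewrite pairingNl Bc.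
  by rewrite pairing_coord; apply: sumr_le0 => i _; apply: mulr_ge0_le0.
(* (b_p | dl) = -1 is a sum of non-positive integers, so exactly one vertex j contributes. The
   remaining support of b_p lies in P, whose reflections fix dl. *)
have [||j [_ cj hj]] := @sum_eq1 _ xpredT (fun i => - (b1 p 0 i * B (a i) dl)).
- by move=> i _; rewrite oppr_ge0 mulr_ge0_le0.
- by rewrite sumrN -pairing_coord Bc opprK.
have [cj1 dj1] : b1 p 0 j = 1 /\ B (a j) dl = -1.
  have [||-> e] := nneg_mul_eq1 (pc j) _ (s := - B (a j) dl); first by rewrite oppr_ge0.
  - by rewrite mulrN.
  - by split=> //; apply: oppr_inj; rewrite opprK.
have nPj : ~~ P j by rewrite /P dj1.
have [|w1 [Pw1 ew1]] := move_to_simple nPj (proj1 T1 p) pc cj1.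
  move=> i; rewrite negb_or => /andP[nP ij]; have /eqP := hj i isT ij.
  by rewrite oppr_eq0 mulf_eq0 => /orP[/eqP//|]; rewrite -/(P i) (negPf nP).
pose b2 i := weyl_act X (w1 ++ w0) (b i).
have T2 : real_tuple b2 by apply: real_tuple_weyl.
have L2 : lcomb b2 d = dl by rewrite lcomb_weyl weyl_act_cat -edl weyl_act_fix.
have b2p : b2 p = a j by rewrite /b2 weyl_act_cat.
have dl0 : dl != 0 by rewrite -L2 null_neq0.
have sP i : i != p -> supported P (b2 i).
  move=> ip; have B0 : B (b2 i) dl = 0.
    by rewrite -L2 pairing_lcomb_simple // (ext_pair0 ed).
  have main y : nneg y -> B y dl = 0 -> supported P y.
    move=> py By l nPl; have : \sum_i - (y 0 i * B (a i) dl) == 0.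
      by rewrite sumrN -pairing_coord By oppr0.
    rewrite psumr_eq0; last by move=> m _; rewrite oppr_ge0 mulr_ge0_le0.
    move=> /allP/(_ l (mem_index_enum l)); rewrite oppr_eq0 mulf_eq0 -/(P l) (negPf nPl) orbF.
    by move=> /eqP.
  have [pi|ni] := real_coherent SX (proj1 T2 i); first exact: main.
  by rewrite -[b2 i]opprK; apply/supportedN/main; rewrite // pairingNl B0 oppr0.
pose S i := dl 0 i != 0.
have nonpos i l : i != l -> X i l * dl 0 l <= 0.
  by move=> il; apply: mulr_le0_ge0 => //; apply: (sl_neg SX).
have dlsplit T : (forall i, i != p -> supported (predC T) (b2 i)) -> forall i, T i -> dl 0 i = 0.
  by move=> h i Ti; rewrite -L2; apply: (lcomb_supported h); rewrite /= Ti.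
have sS i : i != p -> supported S (b2 i).
  (* P \ S is not joined to S: for m in P \ S, the equation (alpha_m | dl) = 0 only has non-positive
     terms, so all of them vanish. *)
  have PS l m : P l -> P m -> S l -> ~~ S m -> X l m = 0.
    move=> Pl /eqP Pm Sl; rewrite /S negbK => /eqP Sm; rewrite (sl_sym SX).
    have lm : l != m by apply: contraNneq Sl => ->; rewrite Sm.
    have : \sum_(i | i != m) - (X m i * dl 0 i) == 0.
      by move: Pm; rewrite pairing_simple_coord (bigD1 m) //= Sm mulr0 add0r sumrN => ->; rewrite oppr0.
    rewrite psumr_eq0; last by move=> u um; rewrite oppr_ge0 nonpos // eq_sym.
    move=> /allP/(_ l (mem_index_enum l)); rewrite lm oppr_eq0 mulf_eq0 (negPf Sl) orbF.
    by move=> /eqP.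
  (* Were all b_i with i <> p outside S, their combination dl would vanish on its own support. *)
  have [h|h] := tuple_split T2 sP PS; first exact: h.
  case/eqP: dl0; apply/rowP => l; rewrite coord0.
  by have [Sl|] := boolP (S l); [apply: (dlsplit S h)|rewrite negbK => /eqP].
have dlj : dl 0 j = 0 by apply/eqP; apply: contraNT nPj; apply: kd.
(* Since dl_j = 0, the equation (alpha_j | dl) = -1 singles out one neighbour r of j in the support,
   as in [ext_neighbour]. *)
have [||r [rj dr hr]] := @sum_eq1 _ (fun i => i != j) (fun i => - (X j i * dl 0 i)).
- by move=> i ij; rewrite oppr_ge0 nonpos // eq_sym.
- by rewrite sumrN; move: dj1; rewrite pairing_simple_coord (bigD1 j) //= dlj mulr0 add0r => ->; rewrite opprK.
have [dr1 Xjr] : dl 0 r = 1 /\ X j r = -1.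
  have Xn : X j r <= 0 by apply: (sl_neg SX); rewrite eq_sym.
  have [|| e ->] := nneg_mul_eq1 (u := - X j r) _ (pd r); first by rewrite oppr_ge0.
  - by rewrite mulNr.
  - by split=> //; apply: oppr_inj; rewrite opprK.
exists (w1 ++ w0), dl, j, r; split=> //.
- by move=> i /kd /eqP.
- move=> T [i0 di0 Ti0] cl i di.
  have ST l m : S l -> S m -> T l -> ~~ T m -> X l m = 0.
    move=> Sl Sm Tl; apply: contraNeq => Xlm; exact: cl Xlm.
  have [h|h] := tuple_split T2 sS ST; last by move: di0; rewrite (dlsplit T h) ?eqxx.
  by apply: contraT => nT; move: di; rewrite -L2 (lcomb_supported h) ?eqxx.
(* K_ip = 0 makes b_i orthogonal to b_p = alpha_j, and r is the only vertex of the support joined to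
   j. *)
- move=> i ip iq; have : B (a j) (b2 i) = 0 by rewrite -b2p (proj2 T2) sl_sym // Kp.
  rewrite pairing_simple_coord (bigD1 r) //= Xjr big1 ?addr0 => [/eqP|l lr].
    by rewrite mulN1r oppr_eq0 => /eqP.
  have [Sl|Sl] := boolP (S l); last by rewrite (sS i ip l Sl) mulr0.
  have lj : l != j by apply: contraNneq Sl => ->; rewrite dlj.
  have /eqP := hr l lj lr; rewrite oppr_eq0 mulf_eq0 (negPf Sl) orbF => /eqP ->.
  by rewrite mul0r.
Qed.

Lemma normal_tuple_exists b : real_tuple b -> exists (e : bool) w dl j r,
  normal_tuple (fun i => weyl_act X w (if e then - b i else b i)) dl j r.
Proof.
move=> Tb; have [pb|nb] := null_coherent Tb.
  by have [w [dl [j [r N]]]] := normal_tuple_pos Tb pb; exists false, w, dl, j, r.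
have [|w [dl [j [r N]]]] := normal_tuple_pos (real_tupleN Tb); first by rewrite lcomb_opp.
by exists true, w, dl, j, r.
Qed.

Lemma normal_semi b dl j r (v : 'rV[int]_n) : normal_tuple b dl j r ->
  supported (fun l => dl 0 l != 0) v -> 0 <= B v v /\ (B v v <= 0 -> v = v 0 r *: dl).
Proof.
move=> N sv; split; first exact: (null_form_ge0 SX (nf_nneg N) (nf_ker N) sv).
move=> Nv; have prop := null_form_eq0 SX (nf_nneg N) (nf_ker N) sv Nv.
have T i : dl 0 i != 0 -> v 0 i == v 0 r * dl 0 i.
  move: i; apply: (nf_conn N).
    by exists r; rewrite (nf_r N) // mulr1.
  move=> i l di dl' /eqP vi Xil; have := prop i l Xil di dl'; rewrite vi => e.
  by apply/eqP/(mulIf di); rewrite -e; ring.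
apply/rowP => i; rewrite coordZ; have [di|di] := eqVneq (dl 0 i) 0.
  by rewrite di mulr0 sv // di.
exact/eqP/T.
Qed.

(** Null vectors with the same connected support are proportional, and both are 1 at r. *)
Lemma normal_null_unique b b' dl dl' j j' r : normal_tuple b dl j r -> normal_tuple b' dl' j' r ->
  (forall i, (dl 0 i != 0) = (dl' 0 i != 0)) -> dl = dl'.
Proof.
move=> N N' s; have sd : supported (fun l => dl 0 l != 0) dl'.
  by move=> i; rewrite s negbK => /eqP.
have [_ ->] := normal_semi N sd; first by rewrite (nf_r N') scale1r.
by rewrite -(nf_delta N') null_norm //; exact: nf_real N'.
Qed.

Lemma normal_posdef b dl j r : normal_tuple b dl j r ->
  posdef_on X (fun l => (dl 0 l != 0) && (l != r)).
Proof.
move=> N v sv v0; have sv' : supported (fun l => dl 0 l != 0) v.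
  by apply: sub_supported sv => l /andP[].
have [ge h] := normal_semi N sv'; rewrite lt_def ge andbT.
apply: contraNneq v0 => e; rewrite h ?e // sv ?scale0r //.
by rewrite eqxx andbF.
Qed.

(** This makes the set of normal forms finite. For i different from p and q, b_i lies in a positive
    definite lattice, where residues mod 3 determine a vector of norm 2. Then b_q is recovered from
    the null vector because d_q = 1. *)
Lemma normal_tuple_inj b b' dl dl' j r : normal_tuple b dl j r -> normal_tuple b' dl' j r ->
  (forall i, (dl 0 i != 0) = (dl' 0 i != 0)) ->
  (forall i l, (b i 0%R l = b' i 0%R l %[mod 3])%Z) -> b =1 b'.
Proof.
move=> N N' s m; have ed' := normal_null_unique N N' s.
have Rb := nf_real N; have Rb' := nf_real N'.
have eq0 i : i != p -> i != q -> b i = b' i.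
  move=> ip iq; apply: (norm2_mod3 SX (normal_posdef N)).
  - move=> l; rewrite negb_and negbK => /orP[dl0|]; first by apply: (nf_supp N ip); rewrite negbK.
    by rewrite negbK => /eqP ->; apply: (nf_supp0 N).
  - move=> l; rewrite negb_and negbK => /orP[dl0|].
      by apply: (nf_supp N' ip); rewrite -s negbK.
    by rewrite negbK => /eqP ->; apply: (nf_supp0 N').
  - exact: real_norm (proj1 Rb i).
  - exact: real_norm (proj1 Rb' i).
  - exact: m.
have eqp : b p = b' p by rewrite (nf_p N) (nf_p N').
move=> i; have [->//|ip] := eqVneq i p; have [->|iq] := eqVneq i q; last exact: eq0.
have := nf_delta N; rewrite -(nf_delta N') in ed'; rewrite ed' /lcomb.
rewrite (bigD1 q) //= [RHS](bigD1 q) //= dq !scale1r.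
rewrite (eq_bigr (fun i => d 0 i *: b' i)) => [/addIr//|l lq].
by have [->|lp] := eqVneq l p; [rewrite (ext_p ed) !scale0r|rewrite eq0].
Qed.

End Tuples.

(** * Finiteness of the number of orbits *)

Section Orbits.
Local Open Scope classical_set_scope.
Variables (k : nat) (K : 'M[int]_k) (n : nat) (X : 'M[int]_n).
Hypotheses (SK : simply_laced K) (SX : simply_laced X).
Notation B := (pairing X).
Notation a := (@simple_root n).
Implicit Types (b : 'I_k -> 'rV[int]_n).

Definition tuple_set b : {fset 'rV[int]_n} := [fset b i | i in 'I_k]%fset.

Lemma tuple_setP b x : reflect (exists i, x = b i) (x \in tuple_set b).
Proof.
apply: (iffP (imfsetP _ _ _ _)) => [[i _ ->]|[i ->]]; first by exists i.
by exists i.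
Qed.

Lemma eq_tuple_set b b' : b =1 b' -> tuple_set b = tuple_set b'.
Proof. by move=> e; apply/fsetP => x; apply/tuple_setP/tuple_setP => -[i ->]; exists i. Qed.

Lemma weyl_tuple_set w b :
  [fset weyl_act X w y | y in tuple_set b]%fset = tuple_set (fun i => weyl_act X w (b i)).
Proof.
apply/fsetP => x; apply/imfsetP/tuple_setP => [[y /tuple_setP[i ->] ->]|[i ->]].
  by exists i.
by exists (b i) => //; apply/tuple_setP; exists i.
Qed.

Lemma weyl_orbitP b T : weyl_orbit X (tuple_set b) T <->
  exists w, T = tuple_set (fun i => weyl_act X w (b i)).
Proof. by split=> -[w ->]; exists w; rewrite weyl_tuple_set. Qed.

Lemma weyl_orbit_tuple w b :
  weyl_orbit X (tuple_set (fun i => weyl_act X w (b i))) = weyl_orbit X (tuple_set b).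
Proof.
apply/seteqP; split=> T /weyl_orbitP[w' ->]; apply/weyl_orbitP.
  by exists (w' ++ w); apply: eq_tuple_set => i; rewrite weyl_act_cat.
exists (w' ++ rev w); apply: eq_tuple_set => i; rewrite weyl_act_cat.
by rewrite weyl_act_revK.
Qed.

Lemma real_tuple_inj b : real_tuple K X b -> injective b.
Proof.
move=> [Rb Gb] i j e; apply/eqP; apply: contraT => ij.
by have := sl_neg SK ij; rewrite -Gb e real_norm.
Qed.

Lemma is_corootE x c : is_coroot X x c <-> real X x /\ c = x.
Proof.
rewrite /is_coroot (proj2 SX); split=> [[w [i [-> ->]]]|[[w [i ->]] ->]].
  by split=> //; exists w, i.
by exists w, i.
Qed.

Lemma pi_system_tuple (F : numFieldType) S :
  pi_system F X S /\ of_type K X S <-> exists2 b, real_tuple K X b & S = tuple_set b.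
Proof.
split=> [[_ [b [c [bi -> bc G]]]]|[b Tb ->]].
  exists b => //; split=> [i|i j]; first by case/is_corootE: (bc i).
  by rewrite -G; case/is_corootE: (bc i) => _ ->.
have bi := real_tuple_inj Tb; case: (Tb) => Rb Gb; split.
  apply: (pi_system_sl SX) => [x /tuple_setP[i ->] //|x y /tuple_setP[i ->] /tuple_setP[j ->] ij].
  by rewrite Gb (sl_neg SK) //; apply: contraNneq ij => ->.
by exists b, b; split=> // i; apply/is_corootE.
Qed.

Lemma pi_system_orbitsE (F : numFieldType) : pi_system_orbits F K X =
  [set weyl_orbit X (tuple_set b) | b in real_tuple K X].
Proof.
apply/seteqP; split=> o /=.
  by move=> [S /pi_system_tuple[b Tb ->] <-]; exists b.
by move=> [b Tb <-]; exists (tuple_set b) => //; apply/pi_system_tuple; exists b.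
Qed.

Definition residues (b : {ffun 'I_k -> 'rV[int]_n}) : {ffun 'I_k * 'I_n -> 'I_3} :=
  [ffun x => inord (absz (b x.1 0%R x.2 %% 3)%Z)].

Lemma residuesP (b b' : {ffun 'I_k -> 'rV[int]_n}) : residues b = residues b' ->
  forall i l, (b i 0%R l = b' i 0%R l %[mod 3])%Z.
Proof.
move=> /ffunP e i l; have := congr1 val (e (i, l)); rewrite !ffunE /=.
rewrite !inordK; [|lia..].
by move=> h; lia.
Qed.

End Orbits.

Section FiniteInjection.
Local Open Scope classical_set_scope.

Lemma finite_set_code (T : Type) (C : finType) (A : set T) (c : T -> C) :
  {in A &, injective c} -> finite_set A.
Proof.
move=> ci; have := inj_card_eq ci => /eq_finite_set <-.
exact: finite_finset.
Qed.

End FiniteInjection.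

Section FinitelyManyOrbits.
Local Open Scope classical_set_scope.
Variables (k : nat) (K : 'M[int]_k) (n : nat) (X : 'M[int]_n).
Hypotheses (SK : simply_laced K) (SX : simply_laced X).

Lemma finite_orbits (F : numFieldType) (N : set {ffun 'I_k -> 'rV[int]_n}) : finite_set N ->
  (forall b, real_tuple K X b -> exists (e : bool) w (b' : {ffun 'I_k -> 'rV[int]_n}),
     N b' /\ forall i, b' i = weyl_act X w (if e then - b i else b i)) ->
  exists m, mult_eq F K X m.
Proof.
move=> fN hN; apply/finite_setP; rewrite pi_system_orbitsE //.
pose f (x : {ffun 'I_k -> 'rV[int]_n} * bool) :=
  weyl_orbit X (tuple_set (fun i => if x.2 then - x.1 i else x.1 i)).
apply: (@sub_finite_set _ _ (f @` (N `*` [set: bool]))).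
  move=> o [b Tb <-]; have [e [w [b' [Nb' eb]]]] := hN b Tb.
  exists (b', e) => //; rewrite /f /= -(weyl_orbit_tuple SX w b).
  congr weyl_orbit; apply: eq_tuple_set => i; rewrite eb.
  by case: e {eb} => //; rewrite weyl_actN opprK.
by apply: finite_image; apply: finite_setX => //; apply: finite_finset.
Qed.

Lemma finite_mult_ext (F : numFieldType) p d : ext_datum K p d -> exists m, mult_eq F K X m.
Proof.
move=> ed; have [q [qp dq Kq Kp]] := ext_neighbour SK ed.
pose N (b : {ffun 'I_k -> 'rV[int]_n}) := exists x : 'rV[int]_n * ('I_n * 'I_n),
  normal_tuple K X p q d b x.1 x.2.1 x.2.2.
(* Of the null vector only the support is recorded, since [normal_null_unique] recovers the rest
   from it and r. [None] is the default value outside N. *)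
pose code (b : {ffun 'I_k -> 'rV[int]_n}) :
    option ('I_n * 'I_n * {set 'I_n} * {ffun 'I_k * 'I_n -> 'I_3}) :=
  if pselect (N b) is left h then
    let x := projT1 (cid h) in Some (x.2, [set i | x.1 0 i != 0]%SET, residues b)
  else None.
apply: (@finite_orbits F N).
  apply: (@finite_set_code _ _ _ code) => b b' /set_mem Nb /set_mem Nb'.
  rewrite /code; case: pselect => // h; case: pselect => // h'.
  case: (cid h) => -[dl [j r]] nf /=; case: (cid h') => -[dl' [j' r']] nf' /=.
  move=> [= ej er es em]; move: nf nf' => /= nf; rewrite -ej -er => nf'; apply/ffunP.
  apply: (normal_tuple_inj SX ed dq nf nf').
    by move=> i; have /setP/(_ i) := es; rewrite !inE.
  exact: residuesP.
move=> b Tb; have [e [w [dl [j [r nf]]]]] := normal_tuple_exists SK SX ed qp Kp Tb.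
exists e, w, [ffun i => weyl_act X w (if e then - b i else b i)].
split; last by move=> i; rewrite ffunE.
exists (dl, (j, r)); rewrite /= (_ : fun_of_fin _ = fun i => weyl_act X w (if e then - b i else b i)) //.
by apply/funext => i; rewrite ffunE.
Qed.

End FinitelyManyOrbits.

(** * Hyperbolic diagrams *)

Section Hyperbolic.
Variables (R : realType) (n : nat) (X : 'M[int]_n).
Hypothesis SX : simply_laced X.
Notation B := (pairing X).

(** Finite and affine type both provide a positive vector u with A u >= 0, which is what the
    rescaled form needs. *)
Lemma block_vector (C : {set 'I_n}) :
  finite_type R (principal X C) \/ affine_type R (principal X C) ->
  exists u : 'I_n -> R, (forall i, i \in C -> 0 < u i) /\
    forall i, i \in C -> 0 <= \sum_(j in C) (X i j)%:~R * u j.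
Proof.
move=> tC; have [u [u0 Xu]] : exists u : 'cV[R]_#|C|, vpos u /\
    forall l, 0 <= (map_mx intr (principal X C) *m u) l 0.
  case: tC => [[_ _ _ [u [u0 Xu]] _]|[_ _ _ [u [u0 Xu]] _]]; exists u; split=> // l.
    exact: ltW.
  by rewrite Xu mxE.
pose U i : R := \sum_(l < #|C|) (i == enum_val l)%:R * u l 0.
have UE l : U (enum_val l) = u l 0.
  rewrite /U (bigD1 l) //= eqxx mul1r big1 ?addr0 // => m ml.
  by rewrite (inj_eq enum_val_inj) eq_sym (negPf ml) mul0r.
exists U; split=> i iC; rewrite -(enum_rankK_in iC iC).
  by rewrite UE.
rewrite big_enum_val /=; move: (Xu (enum_rank_in iC i)); rewrite mxE.
rewrite (eq_bigr (fun j => (X (enum_val (enum_rank_in iC i)) (enum_val j))%:~R * U (enum_val j))) //.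
by move=> j _; rewrite !mxE UE.
Qed.

(** Distinct blocks are orthogonal, so the vectors of the blocks glue to one vector u, positive on
    J, with X u >= 0 there. *)
Lemma sum_of_finite_affine_ge0 (J : {set 'I_n}) v : sum_of_finite_affine R X J ->
  supported (fun i => i \in J) v -> 0 <= B v v.
Proof.
move=> [P [parP orthP tP]] sv.
have hU (C : {set 'I_n}) : exists u : 'I_n -> R, C \in P -> (forall i, i \in C -> 0 < u i) /\
    forall i, i \in C -> 0 <= \sum_(j in C) (X i j)%:~R * u j.
  have [CP|nCP] := boolP (C \in P); last by exists (fun=> 0).
  by have [u hu] := block_vector (tP C CP); exists u.
have [U {}hU] := choice hU.
have [/eqP covP trivP _] := and3P parP.
have pbP i : i \in J -> finset.pblock P i \in P by move=> iJ; apply: finset.pblock_mem; rewrite covP.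
have pbi i : i \in J -> i \in finset.pblock P i by move=> iJ; rewrite finset.mem_pblock covP.
pose u i : R := if i \in J then U (finset.pblock P i) i else 0.
have u0 i : i \in J -> 0 < u i.
  by move=> iJ; rewrite /u iJ; have [+ _] := hU _ (pbP i iJ); apply; apply: pbi.
apply: (@rescaled_ge0 n X SX R u).
- by move=> i; have [/u0/ltW//|iJ] := boolP (i \in J); rewrite /u (negPf iJ).
- move=> i; have [iJ|iJ] := boolP (i \in J); last by rewrite {1}/u (negPf iJ) mul0r.
  apply: mulr_ge0; first exact/ltW/u0.
  have [_ /(_ i (pbi i iJ))] := hU _ (pbP i iJ).
  rewrite big_mkcond; congr (0 <= _); apply: eq_bigr => j _; rewrite /u.
  have [jC|jC] := boolP (j \in finset.pblock P i).
    have jJ : j \in J by rewrite -covP; apply/finset.bigcupP; exists (finset.pblock P i); first exact: pbP.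
    by rewrite jJ (finset.def_pblock trivP (pbP i iJ) jC).
  have [jJ|_] := boolP (j \in J); last by rewrite mulr0.
  rewrite (orthP (finset.pblock P i) (finset.pblock P j)) ?mul0r ?pbP ?pbi //.
  by apply: contraNneq jC => ->; apply: pbi.
- move=> i ui; apply: sv; apply/negP => iJ.
  by have := u0 i iJ; rewrite ui ltxx.
Qed.

(* 2 dl + alpha_j has norm -2, so it cannot be supported on a proper subdiagram. *)
Lemma hyperbolic_support (dl : 'rV[int]_n) (j : 'I_n) : hyperbolic_type R X -> B dl dl = 0 ->
  B (simple_root j) dl = -1 -> forall i, i != j -> dl 0 i != 0.
Proof.
move=> [_ _ _ _ hyp] N Bj i ij; apply/negP => /eqP di.
pose J := [set l | (dl 0 l != 0) || (l == j)]%SET.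
have JT : J != [set: 'I_n]%SET.
  by apply/eqP => /setP/(_ i); rewrite !inE di eqxx (negPf ij).
have sv : supported (fun l => l \in J) (2 *: dl + simple_root j).
  move=> l; rewrite inE negb_or negbK => /andP[/eqP dl0 lj].
  by rewrite coordD coordZ dl0 simple_rootE (negPf lj) mulr0.
have := sum_of_finite_affine_ge0 (hyp J JT) sv.
rewrite !(pairingDl, pairingDr, pairingZl, pairingZr) N Bj pairing_simple (sl_diag SX).
by rewrite [B dl _]pairingC // Bj.
Qed.

End Hyperbolic.

(** * Lifting pi-systems from the finite part *)

Section FinitePart.
Variables (k : nat) (K : 'M[int]_k) (p q : 'I_k) (d : 'rV[int]_k).
Hypotheses (SK : simply_laced K) (ed : ext_datum K p d).
Hypotheses (qp : q != p) (dq : d 0 q = 1).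
Variables (k0 : nat) (K0 : 'M[int]_k0) (g : 'I_k0 -> 'I_k).
Hypotheses (ginj : injective g) (gK : forall i j, K0 i j = K (g i) (g j)).
Hypotheses (gp : forall j, g j != p) (gq : forall j, g j != q).
Hypothesis gsurj : forall i, i != p -> i != q -> exists j, i = g j.

Let SK0 : simply_laced K0 := emb_simply_laced ginj gK SK.

Lemma ext_null_unique d' : ext_datum K p d' -> d' = d.
Proof.
move=> ed'; have e : d' = d' 0 q *: d.
  by apply: (ext_form_eq0 SK ed dq (ext_p ed')); rewrite (ext_norm ed').
have := ext_pair ed' p; rewrite {1}e pairingZr (ext_pair ed) eqxx => e1.
suff : d' 0 q = 1 by move=> h; rewrite e h scale1r.
by clear -e1; lia.
Qed.

Lemma emb_supported (x : 'rV[int]_k0) : supported (fun i => (i != p) && (i != q)) (emb g x).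
Proof.
move=> i; rewrite negb_and !negbK => ipq; apply: emb_coord0 => j.
by apply: contraTneq ipq => ->; rewrite negb_or gp gq.
Qed.

Lemma emb_preimage (x : 'rV[int]_k) : supported (fun i => (i != p) && (i != q)) x ->
  exists y, x = emb g y.
Proof.
move=> sx; exists (\row_j x 0 (g j)); apply: embK => // i ni; apply: sx.
by apply/negP => /andP[ip iq]; have [j ij] := gsurj ip iq; have := ni j; rewrite ij eqxx.
Qed.

Lemma finite_part_posdef : posdef_on K0 xpredT.
Proof.
move=> x _ x0; rewrite -(pairing_emb gK); apply: (ext_posdef SK ed qp); first exact: emb_supported.
by apply: contra_neq x0 => e; apply: (emb_inj ginj); rewrite e emb0.
Qed.

Lemma posdef_almost n0 (A : 'M[int]_n0) (J : pred 'I_n0) : posdef_on A J -> almost_posdef A J.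
Proof. by move=> pA v sv v0 _; apply: pA. Qed.

(** d - alpha_q read in the root lattice of the finite part. *)
Definition theta : 'rV[int]_k0 := \row_j d 0 (g j).

Lemma thetaE j : theta 0 j = d 0 (g j). Proof. by rewrite mxE. Qed.

Lemma emb_theta : emb g theta = d - simple_root q.
Proof.
apply/rowP => i; rewrite coordB simple_rootE.
have [->|ip] := eqVneq i p.
  by rewrite (emb_supported theta) ?eqxx // (ext_p ed) eq_sym (negPf qp).
have [->|iq] := eqVneq i q.
  by rewrite (emb_supported theta) ?eqxx ?andbF // dq.
by have [j ->] := gsurj ip iq; rewrite emb_coord // thetaE subr0.
Qed.

Lemma theta_pair j : pairing K0 (simple_root j) theta = - K (g j) q.
Proof.
rewrite -(pairing_emb gK) emb_theta emb_simple pairingBr pairing_simple (ext_pair0 ed) //.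
by rewrite sub0r.
Qed.

Lemma theta_norm : pairing K0 theta theta = 2.
Proof.
rewrite -(pairing_emb gK) emb_theta !(pairingBl, pairingBr) (ext_norm ed) (ext_pair0 ed qp).
by rewrite [pairing K d _]pairingC // (ext_pair0 ed qp) pairing_simple sl_diag.
Qed.

(* theta is the highest root; uniqueness of the dominant vector of norm 2 with
   full support makes it invariant under diagram automorphisms. *)
Lemma theta_auto (s : 'I_k0 -> 'I_k0) : injective s ->
  (forall i j, K0 (s i) (s j) = K0 i j) -> forall j, d 0 (g (s j)) = d 0 (g j).
Proof.
move=> sinj sK j; pose th' : 'rV[int]_k0 := \row_i theta 0 (s i).
have th'E i : th' 0 i = theta 0 (s i) by rewrite mxE.
have th_pos i : 0 < theta 0 i by rewrite thetaE; apply: (ext_pos ed).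
have th'_pair i : pairing K0 (simple_root i) th' = pairing K0 (simple_root (s i)) theta.
  rewrite !pairing_simple_coord [RHS](reindex_inj sinj); apply: eq_bigr => l _.
  by rewrite th'E sK.
have dom i : 0 <= pairing K0 (simple_root i) theta.
  by rewrite theta_pair oppr_ge0; apply: (sl_neg SK).
have dom' i : 0 <= pairing K0 (simple_root i) th' by rewrite th'_pair.
have N' : pairing K0 th' th' = 2.
  rewrite -theta_norm !pairing_coord [RHS](reindex_inj sinj); apply: eq_bigr => l _.
  by rewrite th'E th'_pair.
(* Some alpha_l pairs positively with th', every coefficient of theta is at least 1, and all terms
   of the sum are >= 0 since th' is dominant. *)
have c1 : 1 <= pairing K0 theta th'.
  have [||l [_ hl]] := norm_descent (X := K0) (x := th').
  - by move=> i; rewrite th'E ltW.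
  - by rewrite N'.
  rewrite pairing_coord (bigD1 l) //= -[leLHS]addr0; apply: lerD.
    by have := th_pos l; clear -hl; nia.
  by apply: sumr_ge0 => i _; apply: mulr_ge0 => //; apply: ltW.
have N := theta_norm.
suff : theta - th' = 0.
  by move/eqP; rewrite subr_eq0 => /eqP e; rewrite -!thetaE -th'E -e.
(* theta - th' would have norm 4 - 2 (theta | th') > 0, so (theta | th') = 1 and the norm is 2. The
   difference then has a sign, but pairing it with th', or its opposite with theta, gives 1 - 2 = -1
   against dominance. *)
apply/eqP; apply: contraT => u0.
have su : supported xpredT (theta - th') by [].
have pu := finite_part_posdef su u0.
have Nu : pairing K0 (theta - th') (theta - th') = 4 - 2 * pairing K0 theta th'.
  rewrite !(pairingBl, pairingBr) N N' [pairing K0 th' theta]pairingC //.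
  by ring.
have c2 : pairing K0 theta th' = 1 by rewrite Nu in pu; clear -pu c1; lia.
have pos_dom x y : nneg x -> (forall i, 0 <= pairing K0 (simple_root i) y) -> 0 <= pairing K0 x y.
  by move=> px py; rewrite pairing_coord; apply: sumr_ge0 => i _; apply: mulr_ge0.
have [|pu'|nu] := norm2_coherent SK0 (posdef_almost finite_part_posdef) su.
- by rewrite Nu c2.
- have := pos_dom _ _ pu' dom'; rewrite pairingBl c2 N'; by [].
- have := pos_dom _ _ nu dom; rewrite pairingNl pairingBl N pairingC // c2; by [].
Qed.

End FinitePart.

(** * Lifts of tuples from X0 to X *)

Section Lifting.
Variables (k : nat) (K : 'M[int]_k) (p q : 'I_k) (d : 'rV[int]_k).
Hypotheses (SK : simply_laced K) (ed : ext_datum K p d).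
Hypotheses (qp : q != p) (dq : d 0 q = 1) (Kq : K q p = -1).
Hypothesis Kp : forall i, i != p -> i != q -> K i p = 0.
Variables (k0 : nat) (K0 : 'M[int]_k0) (g : 'I_k0 -> 'I_k).
Hypotheses (ginj : injective g) (gK : forall i j, K0 i j = K (g i) (g j)).
Hypotheses (gp : forall j, g j != p) (gq : forall j, g j != q).
Hypothesis gsurj : forall i, i != p -> i != q -> exists j, i = g j.
Variables (n : nat) (X : 'M[int]_n) (p' q' : 'I_n) (d' : 'rV[int]_n).
Hypotheses (SX : simply_laced X) (ed' : ext_datum X p' d').
Hypotheses (qp' : q' != p') (dq' : d' 0 q' = 1) (Xq' : X q' p' = -1).
Hypothesis Xp' : forall i, i != p' -> i != q' -> X i p' = 0.
Variables (n0 : nat) (X0 : 'M[int]_n0) (f : 'I_n0 -> 'I_n).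
Hypotheses (finj : injective f) (fX : forall i j, X0 i j = X (f i) (f j)).
Hypotheses (fp : forall j, f j != p') (fq : forall j, f j != q').
Hypothesis fsurj : forall i, i != p' -> i != q' -> exists j, i = f j.
Notation B := (pairing X).
Notation a := (@simple_root n).
Implicit Types (t : 'I_k0 -> 'rV[int]_n0).

Let SK0 : simply_laced K0 := emb_simply_laced ginj gK SK.
Let SX0 : simply_laced X0 := emb_simply_laced finj fX SX.

Let cases i : [\/ i = p, i = q | exists j, i = g j].
Proof.
have [->|ip] := eqVneq i p; first by constructor 1.
have [->|iq] := eqVneq i q; first by constructor 2.
by constructor 3; apply: gsurj.
Qed.

(** The value at q is the one that makes the null vector equal to d', given b_p = alpha_p' and the
    embedded t. The sum in the last branch selects the j with i = g j. *)
Definition lift_tuple t (i : 'I_k) : 'rV[int]_n :=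
  if i == p then a p' else if i == q then d' - emb f (lcomb t (theta d g))
  else emb f (\sum_j (i == g j)%:R *: t j).

Lemma lift_p t : lift_tuple t p = a p'. Proof. by rewrite /lift_tuple eqxx. Qed.
Lemma lift_q t : lift_tuple t q = d' - emb f (lcomb t (theta d g)).
Proof. by rewrite /lift_tuple (negPf qp) eqxx. Qed.
Lemma lift_g t j : lift_tuple t (g j) = emb f (t j).
Proof.
rewrite /lift_tuple (negPf (gp j)) (negPf (gq j)) (bigD1 j) //= eqxx scale1r.
rewrite big1 ?addr0 // => i ij; rewrite (inj_eq ginj) eq_sym (negPf ij).
by rewrite scale0r.
Qed.

Let embp x : emb f x 0 p' = 0.
Proof. by apply: (emb_supported fp fq); rewrite eqxx. Qed.
Let embq x : emb f x 0 q' = 0.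
Proof. by apply: (emb_supported fp fq); rewrite eqxx andbF. Qed.

Let emb_d' x : B (emb f x) d' = 0.
Proof. by rewrite (pairing_ext ed') embp oppr0. Qed.

Let emb_p' x : B (a p') (emb f x) = 0.
Proof.
rewrite pairing_simple_coord big1 // => i _.
have [->|ip] := eqVneq i p'; first by rewrite embp mulr0.
have [->|iq] := eqVneq i q'; first by rewrite embq mulr0.
by rewrite (sl_sym SX) Xp' ?mul0r.
Qed.

(** The root at q is real because it has norm 2 and avoids p', where the form of X is almost
    positive definite. *)
Lemma real_lift t : real_tuple K0 X0 t -> real_tuple K X (lift_tuple t).
Proof.
move=> Tt; have [Rt Gt] := Tt.
have Nth : B (emb f (lcomb t (theta d g))) (emb f (lcomb t (theta d g))) = 2.
  by rewrite (pairing_emb fX) (pairing_lcomb _ _ Tt) (theta_norm SK ed qp dq ginj gK gp gq gsurj).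
have Nq : B (lift_tuple t q) (lift_tuple t q) = 2.
  rewrite lift_q !(pairingBl, pairingBr) (ext_norm ed') emb_d' Nth.
  by rewrite [B d' _]pairingC // emb_d'.
split=> [i|].
  have [->|->|[j ->]] := cases i.
  - by rewrite lift_p; apply: real_simple.
  - have [||w [l [-> _ _]]] := norm2_real SX (ext_almost_posdef SX ed') (v := lift_tuple t q).
    + move=> l; rewrite negbK => /eqP ->.
      by rewrite lift_q coordB embp (ext_p ed') subr0.
    + exact: Nq.
    + by apply/real_weyl/real_simple.
  - by rewrite lift_g; apply: (real_emb fX).
have Gpq : B (lift_tuple t p) (lift_tuple t q) = -1.
  by rewrite lift_p lift_q pairingBr (ext_pair ed') eqxx emb_p' subr0.
have Gpg j : B (lift_tuple t p) (lift_tuple t (g j)) = 0 by rewrite lift_p lift_g emb_p'.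
have Gqg j : B (lift_tuple t (g j)) (lift_tuple t q) = K (g j) q.
  rewrite lift_g lift_q pairingBr emb_d' (pairing_emb fX) (pairing_lcomb_simple _ _ Tt).
  by rewrite (theta_pair ed qp dq ginj gK gp gq gsurj) sub0r opprK.
have Kpg j : K p (g j) = 0 by rewrite sl_sym // Kp.
move=> i j; have [->|->|[i' ->]] := cases i; have [->|->|[j' ->]] := cases j.
- by rewrite lift_p pairing_simple !sl_diag.
- by rewrite Gpq sl_sym.
- by rewrite Gpg Kpg.
- by rewrite pairingC // Gpq.
- by rewrite Nq sl_diag.
- by rewrite pairingC // Gqg sl_sym.
- by rewrite pairingC // Gpg sl_sym.
- exact: Gqg.
- by rewrite !lift_g (pairing_emb fX) Gt.
Qed.

Lemma lcomb_lift t : lcomb (lift_tuple t) d = d'.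
Proof.
have -> : d = simple_root q + emb g (theta d g).
  by rewrite (emb_theta ed qp dq ginj gp gq gsurj) addrC subrK.
rewrite lcombD lcomb_simple lift_q.
suff -> : lcomb (lift_tuple t) (emb g (theta d g)) = emb f (lcomb t (theta d g)) by rewrite subrK.
have lc0 : lcomb (lift_tuple t) 0 = 0 by rewrite /lcomb big1 // => i _; rewrite coord0 scale0r.
rewrite /emb (big_morph (lcomb _) (lcombD _) lc0) -/(emb f _) [RHS]emb_sum.
by apply: eq_bigr => j _; rewrite lcombZ lcomb_simple lift_g embZ.
Qed.

Lemma normal_lift b dl j r :
  (forall dl j, B dl dl = 0 -> B (a j) dl = -1 -> forall i, i != j -> dl 0 i != 0) ->
  normal_tuple K X p q d b dl j r ->
  exists2 t, real_tuple K0 X0 t & b =1 lift_tuple t.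
Proof.
move=> hyp N; have Tb := nf_real N; have [Rb Gb] := Tb.
have Ndl : B dl dl = 0 by rewrite -(nf_delta N) (null_norm ed Tb).
have full i : i != j -> dl 0 i != 0 by apply: hyp Ndl (nf_j N) i.
have dlj : dl 0 j = 0.
  apply/eqP; apply: contraT => /(nf_ker N); rewrite (nf_j N).
  by [].
have edl : ext_datum X j dl.
  split=> //.
  - by move=> i ij; rewrite lt_def full // (nf_nneg N).
  - move=> i; have [->|ij] := eqVneq i j; first exact: nf_j N.
    by rewrite oppr0 (nf_ker N) ?full.
  - move=> T [i ij Ti] cl l lj; have nj m : dl 0 m != 0 -> m != j.
      by apply: contraNneq => ->; rewrite dlj.
    apply: (nf_conn N (T := T)); [|move=> i1 l1 /nj h1 /nj h2; exact: cl|exact: full].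
    by exists i => //; apply: full.
have jp : j = p' := ext_vertex_unique SX edl ed'.
rewrite jp in edl; have dl' : dl = d' by apply: (ext_null_unique SX ed' dq' edl).
have sb i : i != p -> i != q -> supported (fun l => (l != p') && (l != q')) (b i).
  move=> ip iq; have bp : b i 0 p' = 0.
    by apply: (nf_supp N ip); rewrite -jp dlj eqxx.
  move=> l; rewrite negb_and !negbK => /orP[/eqP->//|/eqP->].
  have := Gb p i; rewrite (nf_p N) jp sl_sym // Kp // pairing_simple_coord.
  rewrite (bigD1 q') //= sl_sym // Xq' big1 ?addr0; first by clear; lia.
  move=> m mq; have [->|mp] := eqVneq m p'; first by rewrite bp mulr0.
  by rewrite sl_sym // Xp' ?mul0r.
have ex j0 : exists x, b (g j0) = emb f x by apply: (emb_preimage finj fsurj); apply: sb.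
have [t ht] := choice ex.
have Gt i l : pairing X0 (t i) (t l) = K0 i l.
  by rewrite -(pairing_emb fX) -!ht Gb gK.
have Tt : real_tuple K0 X0 t.
  split=> // i; have [||w [l [-> _ _]]] := norm2_real SX0
      (posdef_almost (finite_part_posdef SX ed' qp' finj fX fp fq)) (v := t i) => //.
    by rewrite Gt sl_diag.
  by apply/real_weyl/real_simple.
exists t => // i; have [->|->|[l ->]] := cases i.
- by rewrite lift_p (nf_p N) jp.
- have e : lcomb b d = lcomb (lift_tuple t) d by rewrite lcomb_lift (nf_delta N) dl'.
  move: e; rewrite /lcomb (bigD1 q) //= [RHS](bigD1 q) //= dq !scale1r.
  rewrite (eq_bigr (fun i => d 0 i *: lift_tuple t i)) => [/addIr//|m mq].
  have [->|mp] := eqVneq m p; first by rewrite (ext_p ed) !scale0r.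
  by have [l ->] := gsurj mp mq; rewrite lift_g ht.
- by rewrite lift_g ht.
Qed.

Definition sgv (e : bool) (x : 'rV[int]_n) := if e then - x else x.

Lemma sgvK e : involutive (sgv e). Proof. by case: e => x //=; rewrite opprK. Qed.
Lemma weyl_sgv w e x : weyl_act X w (sgv e x) = sgv e (weyl_act X w x).
Proof. by case: e => //=; rewrite weyl_actN. Qed.

Definition lift_orbit (e : bool) t := weyl_orbit X (tuple_set (fun i => sgv e (lift_tuple t i))).

Lemma weyl_emb_fix w (x : 'rV[int]_n) : (forall l, B (a (f l)) x = 0) ->
  weyl_act X (map f w) x = x.
Proof.
move=> h; apply: weyl_act_fix; rewrite all_map; apply/allP => l _ /=.
by rewrite h.
Qed.

Lemma same_set_perm (m N : nat) (b b' : 'I_m -> 'rV[int]_N) : injective b ->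
  tuple_set b = tuple_set b' -> exists2 s : 'I_m -> 'I_m, injective s & forall i, b i = b' (s i).
Proof.
move=> bi e; have ex i : exists j, b i = b' j.
  by apply/tuple_setP; rewrite -e; apply/tuple_setP; exists i.
have [s hs] := choice ex.
by exists s => // i j ij; apply: bi; rewrite !hs ij.
Qed.

(** The orbits concern sets, so the two tuples agree only up to an automorphism s of K0. Since s
    preserves the coefficients of theta, the root at q is the same for both, and W(X0) fixes
    alpha_p' and d'. *)
Lemma lift_orbit_eq e t t' : real_tuple K0 X0 t -> real_tuple K0 X0 t' ->
  weyl_orbit X0 (tuple_set t) = weyl_orbit X0 (tuple_set t') ->
  lift_orbit e t = lift_orbit e t'.
Proof.
move=> Tt Tt' eo; have : weyl_orbit X0 (tuple_set t') (tuple_set t).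
  by rewrite -eo; apply/weyl_orbitP; exists [::].
move=> /weyl_orbitP[w ew].
have [s sinj hs] := same_set_perm (real_tuple_inj SK0 SX0 Tt) ew.
have sK i j : K0 (s i) (s j) = K0 i j.
  by rewrite -(proj2 Tt') -(weyl_act_iso SX0 w) -!hs (proj2 Tt).
have th := theta_auto SK ed qp dq ginj gK gp gq gsurj sinj sK.
rewrite /lift_orbit -(weyl_orbit_tuple SX (map f w) (fun i => sgv e (lift_tuple t' i))).
congr weyl_orbit; set b' := (fun i => weyl_act X _ _).
have b'p : b' p = sgv e (a p').
  by rewrite /b' weyl_sgv lift_p weyl_emb_fix // => l; rewrite pairing_simple Xp'.
have b'g j : b' (g (s j)) = sgv e (emb f (t j)).
  by rewrite /b' weyl_sgv lift_g (weyl_act_emb fX) -hs.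
have b'q : b' q = sgv e (lift_tuple t q).
  rewrite /b' weyl_sgv !lift_q weyl_actD weyl_actN (weyl_act_emb fX) weyl_emb_fix; last first.
    by move=> l; rewrite (ext_pair0 ed').
  congr (sgv e (_ - emb f _)); rewrite -lcomb_weyl /lcomb (reindex_inj sinj).
  by apply: eq_bigr => j _; rewrite !thetaE th hs.
have [s' s'K Ks'] := injF_bij sinj.
apply/fsetP => x; apply/tuple_setP/tuple_setP => -[i ->].
  have [->|->|[j ->]] := cases i.
  - by exists p; rewrite b'p lift_p.
  - by exists q; rewrite b'q.
  - by exists (g (s j)); rewrite b'g lift_g.
have [->|->|[j ->]] := cases i.
- by exists p; rewrite b'p lift_p.
- by exists q; rewrite b'q.
- by exists (g (s' j)); rewrite lift_g -[j]Ks' b'g Ks'.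
Qed.

(** Transporting the overextension datum along s gives another one, so uniqueness of the vertex
    fixes p, and uniqueness of the null vector then fixes d. *)
Lemma ext_datum_perm (s : 'I_k -> 'I_k) : injective s ->
  (forall i j, K (s i) (s j) = K i j) -> s p = p /\ forall i, d 0 (s i) = d 0 i.
Proof.
move=> sinj sK; have [s' s'K Ks'] := injF_bij sinj.
pose ds : 'rV[int]_k := \row_i d 0 (s i).
have dsE i : ds 0 i = d 0 (s i) by rewrite mxE.
have eds : ext_datum K (s' p) ds.
  have ne i : i != s' p -> s i != p by apply: contra_neq => <-; rewrite s'K.
  have neV i : i != p -> s' i != s' p by apply: contra_neq => /(can_inj Ks').
  split.
  - by rewrite dsE Ks' (ext_p ed).
  - by move=> i /ne; rewrite dsE; apply: (ext_pos ed).
  - move=> i; rewrite -(inj_eq sinj) Ks' -(ext_pair ed) !pairing_simple_coord.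
    rewrite [RHS](reindex_inj sinj); apply: eq_bigr => j _.
    by rewrite sK dsE.
  - move=> T [i ip Ti] cl j jp.
    suff : T (s' (s j)) by rewrite s'K.
    apply: (ext_conn ed (T := fun l => T (s' l))); last exact: ne.
      by exists (s i); [exact: ne|rewrite s'K].
    move=> i1 j1 ip1 jp1 T1 K1; apply: (cl (s' i1)) => //; try exact: neV.
    by rewrite -sK !Ks'.
have sp : s p = p by rewrite -{1}(ext_vertex_unique SK eds ed) Ks'.
split=> // i; have e : s' p = p by rewrite -{1}sp s'K.
by rewrite e in eds; rewrite -dsE (ext_null_unique SK ed dq eds).
Qed.

Lemma lift_orbit_inj e e' t t' : real_tuple K0 X0 t -> real_tuple K0 X0 t' ->
  lift_orbit e t = lift_orbit e' t' ->
  e = e' /\ weyl_orbit X0 (tuple_set t) = weyl_orbit X0 (tuple_set t').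
Proof.
move=> Tt Tt' eo; have : weyl_orbit X (tuple_set (fun i => sgv e' (lift_tuple t' i)))
    (tuple_set (fun i => sgv e (lift_tuple t i))).
  by rewrite -/(lift_orbit e' t') -eo; apply/weyl_orbitP; exists [::].
move=> /weyl_orbitP[w ew].
have Tl := real_lift Tt; have Tl' := real_lift Tt'.
have sgp e0 x y : B (sgv e0 x) (sgv e0 y) = B x y.
  by case: e0 => //=; rewrite pairingNl pairingNr opprK.
have linj : injective (fun i => sgv e (lift_tuple t i)).
  by move=> i j /(can_inj (sgvK e)); apply: (real_tuple_inj SK SX Tl).
have [s sinj hs] := same_set_perm linj ew.
have sK i j : K (s i) (s j) = K i j.
  by rewrite -(proj2 Tl') -(sgp e') -(weyl_act_iso SX w) -!hs sgp (proj2 Tl).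
have [sp sd] := ext_datum_perm sinj sK.
have wd : sgv e d' = sgv e' (weyl_act X w d').
  have sg_sum e0 (c : 'I_k -> 'rV[int]_n) : \sum_i d 0 i *: sgv e0 (c i) = sgv e0 (lcomb c d).
    by case: e0 => //=; rewrite -sumrN; apply: eq_bigr => i _; rewrite scalerN.
  rewrite -{1}(lcomb_lift t) -(lcomb_lift t') -weyl_sgv -!sg_sum weyl_act_sum.
  rewrite [RHS](reindex_inj sinj); apply: eq_bigr => i _.
  by rewrite weyl_actZ -hs sd.
have pw : nneg (weyl_act X w d').
  rewrite -(lcomb_lift t); apply: (null_weyl_nneg SK SX ed qp) => //.
  by rewrite lcomb_lift; apply: (ext_nneg ed').
have d'0 : d' != 0 by apply/eqP => e0; have := dq'; rewrite e0 coord0.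
have ee : e = e'.
  have pd := ext_nneg ed'.
  case: (e) (e') wd => -[] //= wd; case/eqP: d'0; apply: nneg_antisym => //.
    by rewrite wd.
  by rewrite wd opprK.
split=> //; rewrite -ee in wd hs; have {}wd := esym (can_inj (sgvK e) wd).
have {}hs i : lift_tuple t i = weyl_act X w (lift_tuple t' (s i)).
  by apply: (can_inj (sgvK e)); rewrite hs weyl_sgv.
have wp : weyl_act X w (a p') = a p' by have := hs p; rewrite sp !lift_p => <-.
(* v pairs to -3 + 2 = -1 with alpha_p', to -1 with alpha_q' and to 0 with the other simple roots,
   so its stabiliser is W(X0). With 2 instead of 3 the reflection at p' would also fix v. *)
pose v := 3 *: d' + a p'.
have vp i : B (a i) v = - 3 * (i == p')%:R + X i p'.
  by rewrite /v pairingDr pairingZr pairing_simple (ext_pair ed') mulrN mulNr.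
have wv : weyl_act X w v = v by rewrite weyl_actD weyl_actZ wd wp.
have [|w' [aw' ew']] := weyl_stabilizer SX _ wv.
  move=> i; rewrite vp; have [->|ip] := eqVneq i p'; first by rewrite (sl_diag SX).
  by rewrite mulr0 add0r; apply: (sl_neg SX).
have [w0 ew0] : exists w0, w' = map f w0.
  elim: w' aw' {ew'} => [|i w' IH] /=; first by exists [::].
  move=> /andP[vi /IH[w0 ->]]; have [||j ->] := fsurj (i := i).
  - by apply: contraTneq vi => ->; rewrite vp eqxx (sl_diag SX).
  - by apply: contraTneq vi => ->; rewrite vp (negPf qp') Xq'.
  by exists (j :: w0).
(* q is the only neighbour of p, which s fixes. *)
have sq : s q = q.
  apply/eqP; apply: contraT => sq; have : K (s q) (s p) = 0.
    by rewrite sp Kp // -[p]sp (inj_eq sinj).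
  by rewrite sK Kq.
have sg j : exists l, s (g j) = g l.
  by apply: gsurj; [rewrite -[p]sp|rewrite -[q]sq]; rewrite (inj_eq sinj).
have [s0 hs0] := choice sg.
have s0inj : injective s0 by move=> i j ij; apply/ginj/sinj; rewrite !hs0 ij.
have ht j : t j = weyl_act X0 w0 (t' (s0 j)).
  apply: (emb_inj finj); rewrite -lift_g hs hs0 lift_g ew' ew0.
  by rewrite (weyl_act_emb fX).
rewrite -(weyl_orbit_tuple SX0 w0 t'); congr weyl_orbit.
have [s0' s0'K Ks0'] := injF_bij s0inj.
apply/fsetP => x; apply/tuple_setP/tuple_setP => -[i ->].
  by exists (s0 i); rewrite ht.
by exists (s0' i); rewrite ht Ks0'.
Qed.

End Lifting.

Section Doubling.
Local Open Scope classical_set_scope.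

Lemma card_union_double (T : choiceType) (A B : set T) m :
  (A #= `I_m)%card -> (B #= `I_m)%card -> A `&` B = set0 -> (A `|` B #= `I_(2 * m))%card.
Proof.
move=> cA cB AB; have fA : finite_set A by apply/finite_setP; exists m.
have fB : finite_set B by apply/finite_setP; exists m.
have fAB : finite_set (A `|` B) by rewrite finite_setU.
rewrite -(fset_setK fAB); apply/card_eq_fsetP; rewrite fset_setU // cardfsU.
rewrite -fset_setI // AB fset_set0 cardfs0 subn0.
by rewrite (card_fset_set cA) (card_fset_set cB) mul2n addnn.
Qed.

End Doubling.

(** * Counting orbits through the finite parts *)

Section Counting.
Local Open Scope classical_set_scope.

Record finite_part_data k (K : 'M[int]_k) k0 (K0 : 'M[int]_k0) (p q : 'I_k)
    (d : 'rV[int]_k) (g : 'I_k0 -> 'I_k) : Prop := {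
  fpd_ext : ext_datum K p d;
  fpd_qp : q != p;
  fpd_dq : d 0 q = 1;
  fpd_Kq : K q p = -1;
  fpd_Kp : forall i, i != p -> i != q -> K i p = 0;
  fpd_inj : injective g;
  fpd_K0 : forall i j, K0 i j = K (g i) (g j);
  fpd_gp : forall j, g j != p;
  fpd_gq : forall j, g j != q;
  fpd_surj : forall i, i != p -> i != q -> exists j, i = g j }.

Lemma finite_partP (R : realType) k (K : 'M[int]_k) (K0 : 'M[int]_k.-1.-1) :
  simply_laced K -> finite_part R K K0 -> exists p q d g, finite_part_data K K0 p q d g.
Proof.
move=> SK [p [q0 [extp adj ->]]]; have [d ed] := ext_vertex_datum SK extp.
have [q [qp dq Kq Kp]] := ext_neighbour SK ed.
have eq : lift p q0 = q.
  apply/eqP; apply: contraNT adj => nq.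
  by rewrite pairing_simple Kp // eq_sym neq_lift.
exists p, q, d, (fun j => lift p (lift q0 j)); split=> //.
- by move=> i j /lift_inj/lift_inj.
- by move=> i j; rewrite !mxE.
- by move=> j; rewrite eq_sym neq_lift.
- by move=> j; rewrite -eq (inj_eq (@lift_inj _ p)) eq_sym neq_lift.
move=> i; rewrite eq_sym => /unlift_some[j -> _].
rewrite -eq (inj_eq (@lift_inj _ p)) eq_sym => /unlift_some[l -> _].
by exists l.
Qed.

Lemma finite_mult_posdef (F : numFieldType) k0 (K0 : 'M[int]_k0) n0 (X0 : 'M[int]_n0) :
  simply_laced K0 -> simply_laced X0 -> posdef_on X0 xpredT -> exists m, mult_eq F K0 X0 m.
Proof.
move=> SK0 SX0 pX0.
apply: (@finite_orbits _ _ _ _ SK0 SX0 F [set t : {ffun 'I_k0 -> 'rV[int]_n0} | real_tuple K0 X0 t]).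
  apply: (@finite_set_code _ _ _ (@residues k0 n0)) => t t' /set_mem /= Tt /set_mem /= Tt' e.
  apply/ffunP => i; apply: (norm2_mod3 SX0 pX0) => //.
  - exact: real_norm (proj1 Tt i).
  - exact: real_norm (proj1 Tt' i).
  - by move=> l; apply: residuesP.
move=> b Tb; exists false, [::], [ffun i => b i]; split; last by move=> i; rewrite ffunE.
by rewrite /= (_ : fun_of_fin _ = b) //; apply/funext => i; rewrite ffunE.
Qed.

(** Each sign e embeds the orbits of X0 into those of X by lifting. The two images are disjoint, and
    by the normal forms they exhaust all orbits. *)
Lemma mult_double (F : numFieldType) k (K : 'M[int]_k) k0 (K0 : 'M[int]_k0) p q d g
    n (X : 'M[int]_n) n0 (X0 : 'M[int]_n0) p' q' d' f m :
  simply_laced K -> simply_laced X ->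
  finite_part_data K K0 p q d g -> finite_part_data X X0 p' q' d' f ->
  (forall dl j, pairing X dl dl = 0 -> pairing X (simple_root j) dl = -1 ->
     forall i, i != j -> dl 0 i != 0) ->
  mult_eq F K0 X0 m -> mult_eq F K X (2 * m).
Proof.
move=> SK SX [ed qp dq Kq Kp ginj gK gp gq gsurj] [ed' qp' dq' Xq' Xp' finj fX fp fq fsurj] hyp.
have SK0 := emb_simply_laced ginj gK SK; have SX0 := emb_simply_laced finj fX SX.
rewrite /mult_eq !pi_system_orbitsE //.
set O0 := [set weyl_orbit X0 (tuple_set t) | t in real_tuple K0 X0] => cO0.
pose good o (t : 'I_k0 -> 'rV[int]_n0) := real_tuple K0 X0 t /\ weyl_orbit X0 (tuple_set t) = o.
(* A representative chosen in the orbit, with the zero tuple as default value outside [O0]; by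
   [PhiE] the lifted orbit does not depend on the choice. *)
pose rep o : 'I_k0 -> 'rV[int]_n0 :=
  if pselect (exists t, good o t) is left h then projT1 (cid h) else fun=> 0.
have repP t : real_tuple K0 X0 t -> good (weyl_orbit X0 (tuple_set t)) (rep (weyl_orbit X0 (tuple_set t))).
  move=> Tt; rewrite /rep; case: pselect => [h|[]]; first by case: (cid h).
  by exists t.
pose lo e t := lift_orbit p q d g X p' d' f e t.
pose Phi e o := lo e (rep o).
have PhiE e t : real_tuple K0 X0 t -> Phi e (weyl_orbit X0 (tuple_set t)) = lo e t.
  move=> Tt; have [Tr er] := repP t Tt.
  exact: (lift_orbit_eq SK ed qp dq ginj gK gp gq gsurj SX ed' Xp' finj fX fp fq e Tr Tt er).
have loI e e' t t' : real_tuple K0 X0 t -> real_tuple K0 X0 t' -> lo e t = lo e' t' ->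
    e = e' /\ weyl_orbit X0 (tuple_set t) = weyl_orbit X0 (tuple_set t').
  exact: (lift_orbit_inj SK ed qp dq Kq Kp ginj gK gp gq gsurj SX ed' qp' dq' Xq' Xp' finj fX fp fq fsurj).
have cPhi e : (Phi e @` O0 #= `I_m)%card.
  apply: card_eq_trans cO0; apply: inj_card_eq => o o' /set_mem[t Tt <-] /set_mem[t' Tt' <-].
  by rewrite !PhiE // => /loI[].
have -> : [set weyl_orbit X (tuple_set b) | b in real_tuple K X] =
    Phi false @` O0 `|` Phi true @` O0.
  apply/seteqP; split=> o.
    move=> [b Tb <-]; have [e [w [dl [j [r nf]]]]] := normal_tuple_exists SK SX ed qp Kp Tb.
    have [t Tt bt] : exists2 t, real_tuple K0 X0 t &
        (fun i => weyl_act X w (if e then - b i else b i)) =1 lift_tuple p q d g p' d' f t.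
      exact: (normal_lift SK ed qp dq Kp ginj gK gp gq gsurj SX ed' qp' dq' Xq' Xp' finj fX fp fq fsurj hyp nf).
    have -> : weyl_orbit X (tuple_set b) = Phi e (weyl_orbit X0 (tuple_set t)).
      rewrite PhiE // /lo /lift_orbit -(weyl_orbit_tuple SX w b); congr weyl_orbit.
      apply: eq_tuple_set => i; rewrite -bt -weyl_sgv.
      by case: (e) => //=; rewrite opprK.
    by case: (e); [right|left]; exists (weyl_orbit X0 (tuple_set t)) => //; exists t.
  have main e : (Phi e @` O0) `<=` [set weyl_orbit X (tuple_set b) | b in real_tuple K X].
    move=> _ [_ [t Tt <-] <-]; rewrite PhiE //=.
    have Tl : real_tuple K X (lift_tuple p q d g p' d' f t).
      exact: (real_lift SK ed qp dq Kq Kp ginj gK gp gq gsurj SX ed' Xp' fX fp fq Tt).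
    exists (fun i => sgv e (lift_tuple p q d g p' d' f t i)) => //.
    by case: e => //=; apply: real_tupleN.
  by case=> /main.
apply: card_union_double => //; apply/seteqP; split=> // o [[_ [t Tt <-] <-] [_ [t' Tt' <-]]].
by rewrite !PhiE // => /loI[].
Qed.

End Counting.

Local Close Scope ring_scope.

Theorem corollary7p2 (R : realType) (k : nat) (K : 'M[int]_k) (hK : Ext R K) :
  (forall (n : nat) (X : 'M[int]_n), simply_laced X ->
     exists m : nat, mult_eq R[i] K X m) /\
  (forall (n : nat) (X : 'M[int]_n), Hyp R X -> Ext R X ->
     forall (K0 : 'M[int]_k.-1.-1) (X0 : 'M[int]_n.-1.-1),
       finite_part R K K0 -> finite_part R X X0 ->
       exists m : nat, mult_eq R[i] K0 X0 m /\ mult_eq R[i] K X (2 * m)).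
Proof.
case: hK => SK [pK extK]; have [dK edK] := ext_vertex_datum SK extK.
split=> [n X SX|n X [hypX _] [SX _] K0 X0 /(finite_partP SK) fK /(finite_partP SX) fX].
  exact: (finite_mult_ext SK SX R[i] edK).
have [p [q [d [g DK]]]] := fK; have [p' [q' [d' [f DX]]]] := fX.
have SK0 := emb_simply_laced (fpd_inj DK) (fpd_K0 DK) SK.
have SX0 := emb_simply_laced (fpd_inj DX) (fpd_K0 DX) SX.
have pX0 := finite_part_posdef SX (fpd_ext DX) (fpd_qp DX) (fpd_inj DX) (fpd_K0 DX) (fpd_gp DX) (fpd_gq DX).
have [m hm] := finite_mult_posdef R[i] SK0 SX0 pX0.
exists m; split=> //; apply: (mult_double SK SX DK DX) hm.
by move=> dl j; apply: (hyperbolic_support SX hypX).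
Qed.
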